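(* We have the trigonometric Fourier series on $[0,1]$, as a function of $\alpha$, $$\zeta'(0,\alpha)=\log\frac{\Gamma(\alpha)}{\sqrt{2\pi}}=\sum_{n\ge1}\frac{\sin 2\pi n\alpha}{\pi n}\left(\log 2\pi n+\gamma\right)+\sum_{n\ge1}\frac{\cos 2\pi n\alpha}{2n},$$ and we have Parseval's equation $$\int_0^1\left(\zeta'(0,\alpha)\right)^2\,d\alpha=\sum_{n\ge1}\frac{1}{n^2}\left(\left(\frac{\log 2\pi n+\gamma}{\pi}\right)^2+\frac14\right),$$ where $\gamma$ is Euler's constant.
   Context: The Hurwitz zeta function $\zeta(s,\alpha)$ is defined by $\zeta(s,\alpha)=\sum_{n\ge 0}(n+\alpha)^{-s}$ for $\operatorname{Re}s>1$ and by its analytic continuation in $s$; $\zeta'(s,\alpha)=\frac{\partial}{\partial s}\zeta(s,\alpha)$. $\Gamma$ denotes the gamma function.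
   Formalization: Parseval's equation as printed is false by a factor of 2 (sin 2πnα and cos 2πnα have mean square 1/2 on [0,1]); the formal statement has 1/2 times the sum on the right-hand side. *)

(* Defs.v *)
From Stdlib Require Export Reals.
From Coquelicot Require Export Coquelicot.
Open Scope R_scope.

Definition Cexp (z : C) : C :=
  (exp (Re z) * cos (Im z), exp (Re z) * sin (Im z)).

(* [x^s] with the real logarithm of [x]; only meaningful for [0 < x]. *)
Definition Cpow_pos (x : R) (s : C) : C := Cexp (s * RtoC (ln x))%C.

Definition analytic_at (f : C -> C) (z0 : C) : Prop :=
  exists (a : nat -> C) (r : posreal),
    forall h : C, Cmod h < r ->
      is_pseries (K := C_AbsRing) (V := C_NormedModule) a h (f (z0 + h)%C).

(* The continuation lives on the connected set [C \ {1}], which meets the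
   half-plane [Re s > 1], so for each [alpha] at most one function of [s] on
   [C \ {1}] satisfies both clauses. *)
Definition is_Hurwitz_zeta (zeta : C -> R -> C) : Prop :=
  forall alpha : R, 0 < alpha ->
    (forall s : C, 1 < Re s ->
       is_series (K := C_AbsRing) (V := C_NormedModule)
         (fun n : nat => Cpow_pos (INR n + alpha) (- s)%C) (zeta s alpha)) /\
    (forall s : C, s <> RtoC 1 -> analytic_at (fun w => zeta w alpha) s).

(* Only meaningful for [0 < x]. *)
Definition Gamma (x : R) : R :=
  RInt_gen (fun t : R => Rpower t (x - 1) * exp (- t))
    (at_right 0) (Rbar_locally p_infty).

Definition Euler_gamma : R :=
  real (Lim_seq (fun n : nat => sum_n_m (fun k : nat => / INR k) 1 n - ln (INR n))).

(* The Fourier series on [[0,1]] of [f] is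
     c + sum_(n >= 1) a_n cos (2 pi n x) + sum_(n >= 1) b_n sin (2 pi n x);
   the values [a 0] and [b 0] play no role. The integrals are improper at both
   endpoints since [f] may be unbounded there. *)
Definition is_trig_Fourier_series (f : R -> R) (c : R) (a b : nat -> R) : Prop :=
  is_RInt_gen f (at_right 0) (at_left 1) c /\
  forall n : nat, (1 <= n)%nat ->
    is_RInt_gen (fun x : R => 2 * (f x * cos (2 * PI * INR n * x)))
      (at_right 0) (at_left 1) (a n) /\
    is_RInt_gen (fun x : R => 2 * (f x * sin (2 * PI * INR n * x)))
      (at_right 0) (at_left 1) (b n).

(* Main.v *)
Require Import Defs.
From Stdlib Require Import Psatz.

(* Write [f(x) = ln (Gamma(x) / sqrt(2 pi))]. On [(0,1]] the Gauss approximations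
   [(x - 1) ln N + ln N! - sum_(k < N) ln (x + k)] converge uniformly, at rate [1/N], to
   [ln Gamma], so the Fourier coefficients of [f] are limits of integrals over [[0,N]] of [ln x]
   against [cos(2 pi n x)] and [sin(2 pi n x)]. Integration by parts turns these into
   [Si(2 pi n N)] and [Cin(2 pi n N) - ln N], whose limits [pi/2] and [gamma + ln(2 pi n)] follow
   from the Dirichlet kernels and the Riemann-Lebesgue lemma.

   Bessel's inequality, applied to [(f(u) - f(alpha)) / sin(pi (u - alpha))] and the waves
   [sin((2N+1) pi (u - alpha))], bounds [sum_N (S_N(alpha) - f(alpha))^2] uniformly for [alpha] in
   compact subsets of [(0,1)]. This gives the pointwise expansion, and integrated over [alpha] it
   gives the inequality that complements Bessel's in Parseval's equation.

   The trapezoidal Euler-Maclaurin series continues [(s - 1) zeta(s, alpha)] across [Re s = 0].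
   By the identity theorem along a semicircle from [2] to [0] around [1] it agrees with the given
   continuation, and its derivative at [0] is Stirling's series for [ln Gamma(alpha)]. *)

(** * Improper integrals *)

(** The obstacle is the regularity of [Gamma]: it is known only as an improper integral and is never
    differentiated. On [(0,1]] the Gauss approximations have derivatives bounded by [1/x + 1]
    uniformly in [N], so Lipschitz and difference-quotient estimates are proved for them and survive
    the uniform limit. The logarithmic singularity at 0 is recorded as [O(x^(-1/4))]: products of
    two such functions are [O(x^(-1/2))], so every inner product exists as an improper integral.
    Square sums of errors over [N] replace both a pointwise convergence criterion and the
    completeness of the trigonometric system.

    On the complex side contour integrals are avoided. Multiplication by [s - 1] clears the pole,
    the trapezoidal correction makes the terms [O(x^(-3/2))] near the semicircle, and expansions
    carry explicit coefficient bounds, so that infinitely many of them can be summed coefficient by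
    coefficient. Comparing the coefficients of order 0 and 1 at [s = 0] gives the value and the
    derivative of zeta there. *)

Lemma is_RInt_gen_primitive (Fa Fb : (R -> Prop) -> Prop)
  {HFa : ProperFilter Fa} {HFb : ProperFilter Fb}
  (D : R -> Prop) (F P : R -> R) (la lb : R) :
  (forall u v w, D u -> D w -> u <= v <= w -> D v) ->
  Fa D -> Fb D ->
  (forall x, D x -> is_derive P x (F x)) ->
  (forall x, D x -> continuous F x) ->
  filterlim P Fa (locally la) -> filterlim P Fb (locally lb) ->
  is_RInt_gen F Fa Fb (lb - la).
Proof.
  intros Dconv Da Db HP HF Hla Hlb.
  unfold is_RInt_gen.
  apply (filterlimi_lim_ext_loc (fun ab => minus (P (snd ab)) (P (fst ab)))).
  (* [D] is an interval that both filters eventually enter, so the segment between two sample points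
     stays inside it. The same argument thus serves [(0,1)] and [(0, infinity)]. *)
  - apply (Filter_prod _ _ _ D D Da Db).
    intros x y Hx Hy; simpl.
    assert (Dxy : forall z, Rmin x y <= z <= Rmax x y -> D z).
    { intros z Hz. destruct (Rle_dec x y) as [H|H].
      - rewrite Rmin_left, Rmax_right in Hz by lra. now apply (Dconv x z y).
      - rewrite Rmin_right, Rmax_left in Hz by lra. now apply (Dconv y z x). }
    apply (is_RInt_derive P F); auto.
  - assert (Ha : filterlim (fun ab : R * R => opp (P (fst ab))) (filter_prod Fa Fb) (locally (opp la))).
    { eapply filterlim_comp; [| apply (filterlim_opp (V := R_NormedModule))].
      eapply filterlim_comp; [apply filterlim_fst | exact Hla]. }
    assert (Hb : filterlim (fun ab : R * R => P (snd ab)) (filter_prod Fa Fb) (locally lb)).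
    { eapply filterlim_comp; [apply filterlim_snd | exact Hlb]. }
    exact (filterlim_comp_2 _ _ plus Hb Ha (filterlim_plus (V := R_NormedModule) lb (opp la))).
Qed.

(** The majorant has a primitive [P] with limits at both ends, so [|P v - P u|] controls every
    partial integral of [F] and supplies the Cauchy criterion. *)
Lemma ex_RInt_gen_dominated (Fa Fb : (R -> Prop) -> Prop)
  {HFa : ProperFilter Fa} {HFb : ProperFilter Fb}
  (D : R -> Prop) (F p P : R -> R) (la lb : R) :
  (forall u v w, D u -> D w -> u <= v <= w -> D v) ->
  Fa D -> Fb D ->
  (forall x, D x -> continuous F x) ->
  (forall x, D x -> continuous p x) ->
  (forall x, D x -> is_derive P x (p x)) ->
  (forall x, D x -> Rabs (F x) <= p x) ->
  filterlim P Fa (locally la) -> filterlim P Fb (locally lb) ->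
  ex_RInt_gen F Fa Fb.
Proof.
  intros Dconv Da Db HF Hp HP Hle Hla Hlb.
  assert (Hex : forall u v, D u -> D v -> ex_RInt F u v).
  { intros u v Hu Hv. apply (ex_RInt_continuous F).
    intros z Hz. apply HF. destruct (Rle_dec u v) as [H|H].
    - rewrite Rmin_left, Rmax_right in Hz by lra. now apply (Dconv u z v).
    - rewrite Rmin_right, Rmax_left in Hz by lra. now apply (Dconv v z u). }
  assert (Hle1 : forall u v, D u -> D v -> u <= v -> Rabs (RInt F u v) <= Rabs (P v - P u)).
  { intros u v Hu Hv Huv.
    assert (Dz : forall z, Rmin u v <= z <= Rmax u v -> D z).
    { intros z Hz. rewrite Rmin_left, Rmax_right in Hz by lra. now apply (Dconv u z v). }
    eapply Rle_trans; [apply abs_RInt_le; auto |].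
    eapply Rle_trans; [| apply Rle_abs].
    assert (E : is_RInt p u v (minus (P v) (P u))).
    { apply (is_RInt_derive P p); intros z Hz; auto. }
    rewrite <- (is_RInt_unique _ _ _ _ E : RInt p u v = P v - P u).
    apply RInt_le; auto.
    - apply (ex_RInt_continuous (fun t => Rabs (F t))). intros z Hz.
      apply (continuous_comp F Rabs); [apply HF; auto | apply (continuous_Rabs (F z))].
    - eexists; exact E.
    - intros z Hz. apply Hle, Dz. rewrite Rmin_left, Rmax_right by lra. lra. }
  assert (Hle2 : forall u v, D u -> D v -> Rabs (RInt F u v) <= Rabs (P v - P u)).
  { intros u v Hu Hv. destruct (Rle_dec u v) as [H|H]; [auto|].
    rewrite <- (opp_RInt_swap F v u) by auto.
    change (Rabs (- RInt F v u) <= Rabs (P v - P u)).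
    rewrite Rabs_Ropp, Rabs_minus_sym. apply Hle1; auto; lra. }
  (* A base point turns the limit over pairs into one Cauchy criterion at each end, for
     [RInt F c]. *)
  destruct (@filter_ex _ Fa _ D Da) as [c Hc].
  assert (Hch : forall u v, D u -> D v -> RInt F u v = RInt F c v - RInt F c u).
  { intros u v Hu Hv. rewrite <- (RInt_Chasles F c u v) by auto.
    assert (E : forall a b : R, b = (a + b) - a) by (intros; ring). apply E. }
  assert (Hlim : forall G l, ProperFilter G -> G D -> filterlim P G (locally l) ->
     exists y, filterlim (fun x => RInt F c x) G (locally y)).
  { intros G l HG HD Hl.
    apply (filterlim_locally_cauchy (U := R_CompleteSpace)).
    intros eps.
    exists (fun x => D x /\ ball l (pos_div_2 eps) (P x)). split.
    - apply filter_and; [exact HD |]. exact (proj1 (filterlim_locally P l) Hl (pos_div_2 eps)).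
    - intros u v [Du Bu] [Dv Bv].
      change (Rabs (RInt F c v - RInt F c u) < eps).
      rewrite <- (Hch u v) by auto.
      eapply Rle_lt_trans; [now apply Hle2 |].
      change (Rabs (P u - l) < eps / 2) in Bu. change (Rabs (P v - l) < eps / 2) in Bv.
      replace (P v - P u) with ((P v - l) - (P u - l)) by ring.
      eapply Rle_lt_trans; [apply Rabs_triang |]. rewrite Rabs_Ropp. lra. }
  destruct (Hlim Fa la HFa Da Hla) as [ya Hya].
  destruct (Hlim Fb lb HFb Db Hlb) as [yb Hyb].
  exists (yb - ya).
  unfold is_RInt_gen.
  apply (filterlimi_lim_ext_loc (fun ab => minus (RInt F c (snd ab)) (RInt F c (fst ab)))).
  - apply (Filter_prod _ _ _ D D Da Db).
    intros x y Hx Hy; simpl.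
    change (minus (RInt F c y) (RInt F c x)) with (RInt F c y - RInt F c x).
    rewrite <- Hch by auto. apply (RInt_correct F). auto.
  - assert (Ha : filterlim (fun ab : R * R => opp (RInt F c (fst ab))) (filter_prod Fa Fb) (locally (opp ya))).
    { eapply filterlim_comp; [| apply (filterlim_opp (V := R_NormedModule))].
      eapply (filterlim_comp _ _ _ fst (fun x => RInt F c x)); [apply filterlim_fst | exact Hya]. }
    assert (Hb : filterlim (fun ab : R * R => RInt F c (snd ab)) (filter_prod Fa Fb) (locally yb)).
    { eapply (filterlim_comp _ _ _ snd (fun x => RInt F c x)); [apply filterlim_snd | exact Hyb]. }
    exact (filterlim_comp_2 _ _ plus Hb Ha (filterlim_plus (V := R_NormedModule) yb (opp ya))).
Qed.

(** [F] dominates its own norm, so the norm inequality for improper integrals yields [|l| <= l]. *)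
Lemma is_RInt_gen_nonneg (Fa Fb : (R -> Prop) -> Prop)
  {HFa : ProperFilter Fa} {HFb : ProperFilter Fb}
  (D : R -> Prop) (F : R -> R) (l : R) :
  filter_prod Fa Fb (fun ab => fst ab <= snd ab) ->
  (forall u v w, D u -> D w -> u <= v <= w -> D v) ->
  Fa D -> Fb D ->
  (forall x, D x -> 0 <= F x) ->
  is_RInt_gen F Fa Fb l -> 0 <= l.
Proof.
  intros Hab Dconv Da Db Hpos Hl.
  eapply Rle_trans; [apply (norm_ge_0 l) |].
  apply (RInt_gen_norm (V := R_CompleteNormedModule) (Fa := Fa) (Fb := Fb) F F l l); auto.
  apply (Filter_prod _ _ _ D D Da Db). intros x y Hx Hy z Hz. simpl in Hz.
  change (Rabs (F z) <= F z). rewrite Rabs_right; [lra |].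
  apply Rle_ge, Hpos, (Dconv x z y); auto.
Qed.

Lemma ex_derive_continuous_R (f : R -> R) (x : R) : ex_derive f x -> continuous f x.
Proof. exact (ex_derive_continuous f x). Qed.

(** * Integrable functions on the open unit interval *)

Definition J (F : R -> R) : R := RInt_gen F (at_right 0) (at_left 1).

Definition cont01 (F : R -> R) : Prop := forall x, 0 < x < 1 -> continuous F x.

(** The majorant blows up only at 0, the one end where log-gamma is singular, and has the primitive
    [2 * K * sqrt x]. *)
Definition tame (F : R -> R) : Prop :=
  cont01 F /\ exists K, forall x, 0 < x < 1 -> Rabs (F x) <= K / sqrt x.

(* The exponent [1/4] makes the product of two such functions [tame]. *)
Definition root_tame (F : R -> R) : Prop :=
  cont01 F /\ exists K, forall x, 0 < x < 1 -> Rabs (F x) <= K / sqrt (sqrt x).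

Lemma unit_interval_convex (u v w : R) :
  0 < u < 1 -> 0 < w < 1 -> u <= v <= w -> 0 < v < 1.
Proof. lra. Qed.

Lemma at_right_0_lt (d : R) : 0 < d -> at_right 0 (fun x => 0 < x < d).
Proof.
  intros Hd. exists (mkposreal d Hd). intros y Hy H. split; [exact H |].
  change (Rabs (y - 0) < d) in Hy. apply Rabs_def2 in Hy. lra.
Qed.

Lemma at_left_1_gt (d : R) : d < 1 -> at_left 1 (fun x => d < x < 1).
Proof.
  intros Hd. assert (H0 : 0 < 1 - d) by lra.
  exists (mkposreal (1 - d) H0). intros y Hy H. split; [| exact H].
  change (Rabs (y - 1) < 1 - d) in Hy. apply Rabs_def2 in Hy. lra.
Qed.

Lemma at_right_0_in : at_right 0 (fun x => 0 < x < 1).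
Proof. apply at_right_0_lt; lra. Qed.

Lemma at_left_1_in : at_left 1 (fun x => 0 < x < 1).
Proof. apply at_left_1_gt; lra. Qed.

Lemma filter_prod01_le :
  filter_prod (at_right 0) (at_left 1) (fun ab => fst ab <= snd ab).
Proof.
  apply (Filter_prod _ _ _ _ _ (at_right_0_lt (1/2) ltac:(lra)) (at_left_1_gt (1/2) ltac:(lra))).
  simpl; intros; lra.
Qed.

Lemma continuous_filterlim_at_right (F : R -> R) (a : R) :
  continuous F a -> filterlim F (at_right a) (locally (F a)).
Proof. intros H. eapply filterlim_filter_le_1; [apply filter_le_within | exact H]. Qed.

Lemma continuous_filterlim_at_left (F : R -> R) (a : R) :
  continuous F a -> filterlim F (at_left a) (locally (F a)).
Proof. intros H. eapply filterlim_filter_le_1; [apply filter_le_within | exact H]. Qed.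

Lemma sqrt_inv_ge_1 (x : R) : 0 < x < 1 -> 1 <= / sqrt x.
Proof.
  intros Hx. assert (0 < sqrt x) by (apply sqrt_lt_R0; lra).
  assert (sqrt x <= 1) by (rewrite <- sqrt_1; apply sqrt_le_1_alt; lra).
  rewrite <- Rinv_1 at 1. apply Rinv_le_contravar; lra.
Qed.

Lemma sqrt_unit (x : R) : 0 < x < 1 -> 0 < sqrt x < 1.
Proof.
  intros Hx. split; [apply sqrt_lt_R0; lra |].
  rewrite <- sqrt_1. apply sqrt_lt_1_alt; lra.
Qed.

Lemma tame_bound (F : R -> R) :
  tame F -> exists K, 0 <= K /\ forall x, 0 < x < 1 -> Rabs (F x) <= K * / sqrt x.
Proof.
  intros [_ [K HK]]. exists (Rabs K). split; [apply Rabs_pos |].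
  intros x Hx. eapply Rle_trans; [apply HK, Hx |].
  apply Rmult_le_compat_r; [| apply Rle_abs].
  generalize (sqrt_inv_ge_1 x Hx); lra.
Qed.

Lemma root_tame_bound (F : R -> R) :
  root_tame F -> exists K, 0 <= K /\ forall x, 0 < x < 1 -> Rabs (F x) <= K * / sqrt (sqrt x).
Proof.
  intros [_ [K HK]]. exists (Rabs K). split; [apply Rabs_pos |].
  intros x Hx. eapply Rle_trans; [apply HK, Hx |].
  apply Rmult_le_compat_r; [| apply Rle_abs].
  generalize (sqrt_inv_ge_1 _ (sqrt_unit x Hx)); lra.
Qed.

Lemma is_derive_2sqrt (K x : R) : 0 < x -> is_derive (fun t => 2 * K * sqrt t) x (K * / sqrt x).
Proof.
  intros Hx. assert (0 < sqrt x) by (apply sqrt_lt_R0; lra).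
  auto_derive; [lra |]. field. lra.
Qed.

Lemma continuous_inv_sqrt (K x : R) : 0 < x -> continuous (fun t => K * / sqrt t) x.
Proof.
  intros Hx. assert (0 < sqrt x) by (apply sqrt_lt_R0; lra).
  apply ex_derive_continuous_R. auto_derive. split; [lra | split; [lra | auto]].
Qed.

Lemma is_J_inv_sqrt (K : R) :
  is_RInt_gen (fun t => K * / sqrt t) (at_right 0) (at_left 1) (2 * K).
Proof.
  replace (2 * K) with (2 * K * sqrt 1 - 2 * K * sqrt 0) by (rewrite sqrt_1, sqrt_0; ring).
  apply (is_RInt_gen_primitive _ _ (fun x => 0 < x < 1) _ (fun t => 2 * K * sqrt t)).
  - exact unit_interval_convex.
  - exact at_right_0_in.
  - exact at_left_1_in.
  - intros x Hx. apply is_derive_2sqrt; lra.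
  - intros x Hx. apply continuous_inv_sqrt; lra.
  - apply (continuous_filterlim_at_right (fun t => 2 * K * sqrt t)).
    apply (continuous_scal_r (2 * K) sqrt). apply continuous_sqrt.
  - apply (continuous_filterlim_at_left (fun t => 2 * K * sqrt t)).
    apply (continuous_scal_r (2 * K) sqrt). apply continuous_sqrt.
Qed.

Lemma tame_is_RInt_gen (F : R -> R) :
  tame F -> is_RInt_gen F (at_right 0) (at_left 1) (J F).
Proof.
  intros HF. destruct (tame_bound F HF) as [K [HK0 HK]]. destruct HF as [HF _].
  apply (RInt_gen_correct (V := R_CompleteNormedModule)).
  apply (ex_RInt_gen_dominated _ _ (fun x => 0 < x < 1) F (fun t => K * / sqrt t)
           (fun t => 2 * K * sqrt t) (2 * K * sqrt 0) (2 * K * sqrt 1)); auto.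
  - exact unit_interval_convex.
  - exact at_right_0_in.
  - exact at_left_1_in.
  - intros x Hx. apply continuous_inv_sqrt; lra.
  - intros x Hx. apply is_derive_2sqrt; lra.
  - apply (continuous_filterlim_at_right (fun t => 2 * K * sqrt t)).
    apply (continuous_scal_r (2 * K) sqrt). apply continuous_sqrt.
  - apply (continuous_filterlim_at_left (fun t => 2 * K * sqrt t)).
    apply (continuous_scal_r (2 * K) sqrt). apply continuous_sqrt.
Qed.

Lemma J_unique (F : R -> R) (l : R) :
  is_RInt_gen F (at_right 0) (at_left 1) l -> J F = l.
Proof. apply (is_RInt_gen_unique (V := R_CompleteNormedModule)). Qed.

Lemma is_J_ext (F G : R -> R) (l : R) :
  (forall x, 0 < x < 1 -> F x = G x) ->
  is_RInt_gen F (at_right 0) (at_left 1) l -> is_RInt_gen G (at_right 0) (at_left 1) l.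
Proof.
  intros H. apply is_RInt_gen_ext.
  apply (Filter_prod _ _ _ _ _ at_right_0_in at_left_1_in). simpl. intros x y Hx Hy z Hz.
  apply H. revert Hz. unfold Rmin, Rmax. destruct (Rle_dec x y); lra.
Qed.

Lemma J_ext (F G : R -> R) : tame F -> (forall x, 0 < x < 1 -> F x = G x) -> J F = J G.
Proof.
  intros HF H. symmetry. apply J_unique, (is_J_ext F); auto. apply tame_is_RInt_gen, HF.
Qed.

Lemma J_plus (F G : R -> R) : tame F -> tame G -> J (fun x => F x + G x) = J F + J G.
Proof.
  intros HF HG. apply J_unique.
  apply (is_RInt_gen_plus F G); apply tame_is_RInt_gen; auto.
Qed.

Lemma J_minus (F G : R -> R) : tame F -> tame G -> J (fun x => F x - G x) = J F - J G.
Proof.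
  intros HF HG. apply J_unique.
  apply (is_RInt_gen_minus F G); apply tame_is_RInt_gen; auto.
Qed.

Lemma J_scal (c : R) (F : R -> R) : tame F -> J (fun x => c * F x) = c * J F.
Proof.
  intros HF. apply J_unique.
  apply (is_RInt_gen_scal F c); apply tame_is_RInt_gen; auto.
Qed.

Lemma is_J_nonneg (F : R -> R) (l : R) :
  is_RInt_gen F (at_right 0) (at_left 1) l -> (forall x, 0 < x < 1 -> 0 <= F x) -> 0 <= l.
Proof.
  intros Hl HF.
  apply (is_RInt_gen_nonneg (at_right 0) (at_left 1) (fun x => 0 < x < 1) F); auto.
  - exact filter_prod01_le.
  - exact unit_interval_convex.
  - exact at_right_0_in.
  - exact at_left_1_in.
Qed.

Lemma J_nonneg (F : R -> R) : tame F -> (forall x, 0 < x < 1 -> 0 <= F x) -> 0 <= J F.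
Proof. intros HF. apply is_J_nonneg, tame_is_RInt_gen, HF. Qed.

Lemma cont01_plus (F G : R -> R) : cont01 F -> cont01 G -> cont01 (fun x => F x + G x).
Proof. intros HF HG x Hx. apply (continuous_plus F G); auto. Qed.

Lemma cont01_minus (F G : R -> R) : cont01 F -> cont01 G -> cont01 (fun x => F x - G x).
Proof. intros HF HG x Hx. apply (continuous_minus F G); auto. Qed.

Lemma cont01_mult (F G : R -> R) : cont01 F -> cont01 G -> cont01 (fun x => F x * G x).
Proof. intros HF HG x Hx. apply (continuous_mult F G); auto. Qed.

Lemma tame_plus (F G : R -> R) : tame F -> tame G -> tame (fun x => F x + G x).
Proof.
  intros HF HG. split; [apply cont01_plus; [apply HF | apply HG] |].
  destruct HF as [_ [K HK]], HG as [_ [L HL]]. exists (K + L). intros x Hx.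
  eapply Rle_trans; [apply Rabs_triang |].
  unfold Rdiv. rewrite Rmult_plus_distr_r. apply Rplus_le_compat; [apply HK | apply HL]; auto.
Qed.

Lemma root_tame_plus (F G : R -> R) : root_tame F -> root_tame G -> root_tame (fun x => F x + G x).
Proof.
  intros HF HG. split; [apply cont01_plus; [apply HF | apply HG] |].
  destruct HF as [_ [K HK]], HG as [_ [L HL]]. exists (K + L). intros x Hx.
  eapply Rle_trans; [apply Rabs_triang |].
  unfold Rdiv. rewrite Rmult_plus_distr_r. apply Rplus_le_compat; [apply HK | apply HL]; auto.
Qed.

Lemma bounded_root_tame (F : R -> R) (K : R) :
  cont01 F -> (forall x, 0 < x < 1 -> Rabs (F x) <= K) -> root_tame F.
Proof.
  intros HF HK. split; [exact HF |]. exists K. intros x Hx.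
  generalize (sqrt_inv_ge_1 _ (sqrt_unit x Hx)); intros H.
  unfold Rdiv. assert (0 <= K) by (eapply Rle_trans; [apply Rabs_pos | apply (HK x Hx)]).
  generalize (HK x Hx). nra.
Qed.

Lemma root_tame_const (c : R) : root_tame (fun _ => c).
Proof.
  apply (bounded_root_tame _ (Rabs c)).
  - intros x _. apply continuous_const.
  - intros; lra.
Qed.

Lemma root_tame_mult (F G : R -> R) : root_tame F -> root_tame G -> tame (fun x => F x * G x).
Proof.
  intros HF HG. split; [apply cont01_mult; [apply HF | apply HG] |].
  destruct (root_tame_bound F HF) as [K [HK0 HK]], (root_tame_bound G HG) as [L [HL0 HL]].
  exists (K * L). intros x Hx. rewrite Rabs_mult.
  replace (K * L / sqrt x) with ((K * / sqrt (sqrt x)) * (L * / sqrt (sqrt x))).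
  - apply Rmult_le_compat; try apply Rabs_pos; auto.
  - assert (0 < sqrt x) by (apply sqrt_lt_R0; lra).
    assert (0 < sqrt (sqrt x)) by (apply sqrt_lt_R0; lra).
    replace (sqrt x) with (sqrt (sqrt x) * sqrt (sqrt x)) at 3 by (apply sqrt_sqrt; lra).
    field. lra.
Qed.

Lemma root_tame_tame (F : R -> R) : root_tame F -> tame F.
Proof.
  intros HF. destruct (root_tame_mult F (fun _ => 1) HF (root_tame_const 1)) as [H [K HK]].
  split; [apply HF |]. exists K. intros x Hx. generalize (HK x Hx). rewrite Rmult_1_r. auto.
Qed.

Lemma tame_scal (c : R) (F : R -> R) : tame F -> tame (fun x => c * F x).
Proof.
  intros HF. split.
  - apply cont01_mult; [| apply HF]. intros x _. apply continuous_const.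
  - destruct (tame_bound F HF) as [K [HK0 HK]]. exists (Rabs c * K). intros x Hx.
    rewrite Rabs_mult. unfold Rdiv. rewrite Rmult_assoc.
    apply Rmult_le_compat_l; [apply Rabs_pos | auto].
Qed.

Lemma tame_minus (F G : R -> R) : tame F -> tame G -> tame (fun x => F x - G x).
Proof.
  intros HF HG.
  destruct (tame_plus F (fun x => -1 * G x) HF (tame_scal (-1) G HG)) as [_ [K HK]].
  split; [apply cont01_minus; [apply HF | apply HG] |]. exists K. intros x Hx.
  replace (F x - G x) with (F x + -1 * G x) by ring. auto.
Qed.

Lemma root_tame_mult_bounded (F G : R -> R) (L : R) :
  root_tame F -> cont01 G -> (forall x, 0 < x < 1 -> Rabs (G x) <= L) ->
  root_tame (fun x => F x * G x).
Proof.
  intros HF HG HL. split; [apply cont01_mult; [apply HF | auto] |].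
  destruct (root_tame_bound F HF) as [K [HK0 HK]]. exists (K * L). intros x Hx.
  rewrite Rabs_mult. unfold Rdiv.
  replace (K * L * / sqrt (sqrt x)) with (K * / sqrt (sqrt x) * L) by ring.
  apply Rmult_le_compat; try apply Rabs_pos; auto.
Qed.

Lemma root_tame_scal (c : R) (F : R -> R) : root_tame F -> root_tame (fun x => c * F x).
Proof.
  intros HF. destruct (root_tame_mult_bounded F (fun _ => c) (Rabs c) HF) as [H [K HK]].
  - intros x _. apply continuous_const.
  - intros; lra.
  - split.
    + intros x Hx. apply (continuous_ext (fun x => F x * c)); [intros; apply Rmult_comm | auto].
    + exists K. intros x Hx. rewrite Rmult_comm. auto.
Qed.

Lemma J_le (F G : R -> R) :
  tame F -> tame G -> (forall x, 0 < x < 1 -> F x <= G x) -> J F <= J G.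
Proof.
  intros HF HG H. enough (0 <= J (fun x => G x - F x)) by (rewrite J_minus in *; auto; lra).
  apply J_nonneg; [apply tame_minus; auto |]. intros x Hx. generalize (H x Hx); lra.
Qed.

Lemma is_J_const (c : R) : is_RInt_gen (fun _ => c) (at_right 0) (at_left 1) c.
Proof.
  enough (H : is_RInt_gen (fun _ => c) (at_right 0) (at_left 1) (c * 1 - c * 0))
    by (replace (c * 1 - c * 0) with c in H by ring; exact H).
  apply (is_RInt_gen_primitive _ _ (fun x => 0 < x < 1) _ (fun t => c * t)).
  - exact unit_interval_convex.
  - exact at_right_0_in.
  - exact at_left_1_in.
  - intros x Hx. auto_derive; [auto | ring].
  - intros x Hx. apply continuous_const.
  - apply (continuous_filterlim_at_right (fun t => c * t)).
    apply (continuous_scal_r c (fun t : R => t)). apply continuous_id.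
  - apply (continuous_filterlim_at_left (fun t => c * t)).
    apply (continuous_scal_r c (fun t : R => t)). apply continuous_id.
Qed.

Lemma J_const (c : R) : J (fun _ => c) = c.
Proof. apply J_unique, is_J_const. Qed.

Lemma J_abs_le_const (F : R -> R) (c : R) :
  tame F -> (forall x, 0 < x < 1 -> Rabs (F x) <= c) -> Rabs (J F) <= c.
Proof.
  intros HF H. apply Rabs_le.
  generalize (root_tame_tame _ (root_tame_const c)), (root_tame_tame _ (root_tame_const (- c))).
  intros Hc Hc'. split.
  - rewrite <- (J_const (- c)). apply J_le; auto. intros x Hx.
    generalize (H x Hx). intros H1. apply Rabs_le_between in H1. lra.
  - rewrite <- (J_const c). apply J_le; auto. intros x Hx.
    generalize (H x Hx). intros H1. apply Rabs_le_between in H1. lra.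
Qed.

Lemma J_le_inv_sqrt (F : R -> R) (K : R) :
  tame F -> (forall x, 0 < x < 1 -> F x <= K * / sqrt x) -> J F <= 2 * K.
Proof.
  intros HF H. rewrite <- (J_unique _ _ (is_J_inv_sqrt K)). apply J_le; auto.
  split; [intros x Hx; apply continuous_inv_sqrt; lra |].
  exists (Rabs K). intros x Hx. rewrite Rabs_mult. apply Rmult_le_compat_l; [apply Rabs_pos |].
  generalize (sqrt_inv_ge_1 x Hx). intros. rewrite Rabs_right; lra.
Qed.

Lemma is_J_primitive (F P : R -> R) (l0 l1 : R) :
  (forall x, 0 < x < 1 -> is_derive P x (F x)) -> cont01 F ->
  filterlim P (at_right 0) (locally l0) -> filterlim P (at_left 1) (locally l1) ->
  is_RInt_gen F (at_right 0) (at_left 1) (l1 - l0).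
Proof.
  intros. apply (is_RInt_gen_primitive _ _ (fun x => 0 < x < 1) _ P); auto.
  - exact unit_interval_convex.
  - exact at_right_0_in.
  - exact at_left_1_in.
Qed.

Lemma is_J_primitive_continuous (F P : R -> R) :
  (forall x, is_derive P x (F x)) -> (forall x, continuous F x) ->
  is_RInt_gen F (at_right 0) (at_left 1) (P 1 - P 0).
Proof.
  intros HP HF. assert (HP' : forall x, continuous P x).
  { intros x. apply ex_derive_continuous_R. eexists. apply HP. }
  apply (is_J_primitive F P); auto.
  - intros x _. apply HF.
  - apply continuous_filterlim_at_right, HP'.
  - apply continuous_filterlim_at_left, HP'.
Qed.

(** * Bessel's inequality *)

(** The indices are those below [m], so that inductions and telescopings start from the empty sum;
    [sum_n u n] has [n + 1] terms. *)
Fixpoint psum (u : nat -> R) (m : nat) : R :=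
  match m with O => 0 | S k => psum u k + u k end.

Lemma psum_S (u : nat -> R) (m : nat) : psum u (S m) = psum u m + u m.
Proof. reflexivity. Qed.

Lemma psum_ext (u v : nat -> R) (m : nat) :
  (forall i, (i < m)%nat -> u i = v i) -> psum u m = psum v m.
Proof.
  induction m as [|m IH]; intros H; simpl; [reflexivity |].
  rewrite IH by (intros; apply H; lia). now rewrite H by lia.
Qed.

Lemma psum_le (u v : nat -> R) (m : nat) :
  (forall i, (i < m)%nat -> u i <= v i) -> psum u m <= psum v m.
Proof.
  induction m as [|m IH]; intros H; simpl; [lra |].
  generalize (H m ltac:(lia)), (IH ltac:(intros; apply H; lia)). lra.
Qed.

Lemma psum_plus (u v : nat -> R) (m : nat) :
  psum (fun i => u i + v i) m = psum u m + psum v m.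
Proof. induction m; simpl; lra. Qed.

Lemma psum_scal (c : R) (u : nat -> R) (m : nat) :
  psum (fun i => c * u i) m = c * psum u m.
Proof. induction m as [|m IH]; simpl; [ring | rewrite IH; ring]. Qed.

Lemma psum_zero (u : nat -> R) (m : nat) :
  (forall i, (i < m)%nat -> u i = 0) -> psum u m = 0.
Proof.
  intros H. rewrite (psum_ext u (fun _ => 0) m H). induction m as [|m IH]; simpl; [reflexivity |].
  rewrite IH by (intros; apply H; lia). ring.
Qed.

Lemma psum_telescope (A : nat -> R) (N : nat) : psum (fun k => A k - A (S k)) N = A 0%nat - A N.
Proof. induction N as [|N IH]; [simpl; ring | rewrite psum_S, IH; ring]. Qed.

Lemma sum_n_psum (u : nat -> R) (n : nat) : sum_n u n = psum u (S n).
Proof.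
  induction n as [|n IH].
  - rewrite sum_O. simpl. ring.
  - rewrite sum_Sn, IH. reflexivity.
Qed.

Lemma is_series_psum (u : nat -> R) (l : R) : is_series u l <-> is_lim_seq (psum u) l.
Proof.
  split; intros H.
  - apply is_lim_seq_incr_1. apply (is_lim_seq_ext (sum_n u)); [apply sum_n_psum | exact H].
  - apply is_lim_seq_incr_1 in H.
    apply (is_lim_seq_ext (fun n => psum u (S n)) (sum_n u)) in H; [exact H |].
    intros; now rewrite sum_n_psum.
Qed.

Lemma psum_le_Series (u : nat -> R) (m : nat) :
  (forall n, 0 <= u n) -> ex_series u -> psum u m <= Series u.
Proof.
  intros Hu H. apply Series_correct in H. apply is_series_psum in H.
  apply (is_lim_seq_incr_compare (psum u)); [exact H |]. intros n. simpl. generalize (Hu n). lra.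
Qed.

Lemma ex_series_psum_bounded (u : nat -> R) (M : R) :
  (forall n, 0 <= u n) -> (forall m, psum u m <= M) -> ex_series u /\ Series u <= M.
Proof.
  intros Hu HM.
  assert (H : ex_finite_lim_seq (psum u)).
  { apply (ex_finite_lim_seq_incr _ M); [| exact HM].
    intros n. simpl. generalize (Hu n). lra. }
  destruct H as [l Hl].
  assert (Hs : is_series u l) by (apply is_series_psum; exact Hl).
  split; [exists l; exact Hs |].
  rewrite (is_series_unique _ _ Hs).
  apply (is_lim_seq_le (psum u) (fun _ => M) l M); auto. apply is_lim_seq_const.
Qed.

Lemma root_tame_psum (w : nat -> R -> R) (m : nat) :
  (forall i, root_tame (w i)) -> root_tame (fun x => psum (fun i => w i x) m).
Proof.
  intros H. induction m as [|m IH]; simpl; [apply root_tame_const |].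
  apply root_tame_plus; auto.
Qed.

Lemma J_mult_psum (h : R -> R) (w : nat -> R -> R) (m : nat) :
  root_tame h -> (forall i, root_tame (w i)) ->
  J (fun x => h x * psum (fun i => w i x) m) = psum (fun i => J (fun x => h x * w i x)) m.
Proof.
  intros Hh Hw. induction m as [|m IH]; simpl.
  - rewrite (J_ext _ (fun _ => 0)); [apply J_const | | intros; ring].
    apply root_tame_mult; auto. apply root_tame_const.
  - rewrite <- IH, <- J_plus.
    + apply J_ext; [| intros; ring].
      apply (root_tame_mult h (fun x => psum (fun i => w i x) m + w m x)); auto.
      apply root_tame_plus; auto. apply root_tame_psum; auto.
    + apply root_tame_mult; auto. apply root_tame_psum; auto.
    + apply root_tame_mult; auto.
Qed.

(** Pythagoras: pairing one summand with the whole sum leaves only its own square. *)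
Lemma J_psum_square (w : nat -> R -> R) (q : nat -> R) (m : nat) :
  (forall i, root_tame (w i)) ->
  (forall i j, i <> j -> J (fun x => w i x * w j x) = 0) ->
  (forall i, J (fun x => w i x * w i x) = q i) ->
  J (fun x => psum (fun i => w i x) m * psum (fun i => w i x) m) = psum q m.
Proof.
  intros Hw Ho Hq.
  assert (HS : forall k, root_tame (fun x => psum (fun i => w i x) k))
    by (intros; apply root_tame_psum; auto).
  rewrite J_mult_psum; auto.
  apply psum_ext. intros k Hk.
  rewrite (J_ext _ (fun x => w k x * psum (fun i => w i x) m));
    [| apply root_tame_mult; auto | intros; ring].
  rewrite J_mult_psum; auto.
  assert (E : forall n, psum (fun i => J (fun x => w k x * w i x)) n
                        = if Nat.ltb k n then q k else 0).
  { induction n as [|n IH]; [reflexivity |]. simpl psum. rewrite IH.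
    destruct (Nat.eq_dec k n) as [->|Hne].
    - rewrite Hq. rewrite (proj2 (Nat.ltb_ge n n)) by lia.
      rewrite (proj2 (Nat.ltb_lt n (S n))) by lia. ring.
    - rewrite Ho by auto.
      destruct (Nat.ltb k n) eqn:E1.
      + apply Nat.ltb_lt in E1. rewrite (proj2 (Nat.ltb_lt k (S n))) by lia. ring.
      + apply Nat.ltb_ge in E1. rewrite (proj2 (Nat.ltb_ge k (S n))) by lia. ring. }
  rewrite E. rewrite (proj2 (Nat.ltb_lt k m)) by lia. reflexivity.
Qed.

(** Each [w i] is already the projection of [h] on its own line, since its inner products with [h]
    and with itself both equal [q i]. Expanding the square of [h - sum w] then leaves
    [J (h * h) - psum q m], with no normalisation to divide by. *)
Lemma bessel_inequality (h : R -> R) (w : nat -> R -> R) (q : nat -> R) (m : nat) :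
  root_tame h -> (forall i, root_tame (w i)) ->
  (forall i j, i <> j -> J (fun x => w i x * w j x) = 0) ->
  (forall i, J (fun x => w i x * w i x) = q i) ->
  (forall i, J (fun x => h x * w i x) = q i) ->
  psum q m <= J (fun x => h x * h x).
Proof.
  intros Hh Hw Ho Hq Hc.
  pose (T := fun x => psum (fun i => w i x) m).
  assert (HT : root_tame T) by (apply root_tame_psum; auto).
  assert (E1 : J (fun x => T x * T x) = psum q m) by (apply J_psum_square; auto).
  assert (E2 : J (fun x => h x * T x) = psum q m).
  { unfold T. rewrite J_mult_psum by auto. apply psum_ext; auto. }
  assert (H0 : 0 <= J (fun x => (h x * h x - 2 * (h x * T x)) + T x * T x)).
  { apply J_nonneg.
    - apply tame_plus; [apply tame_minus; [| apply tame_scal] |]; apply root_tame_mult; auto.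
    - intros x _.
      replace (h x * h x - 2 * (h x * T x) + T x * T x) with ((h x - T x) ^ 2) by ring.
      apply pow2_ge_0. }
  rewrite J_plus, J_minus, J_scal, E1, E2 in H0;
    repeat (apply tame_minus || apply tame_scal || apply root_tame_mult; auto).
  lra.
Qed.

(** The waves have square norm 1/2, so the projection of [h] on [e i] is [2 * c i * e i], of square
    norm [2 * c i ^ 2]. *)
Lemma riemann_lebesgue_square (h : R -> R) (e : nat -> R -> R) (m : nat) :
  root_tame h -> (forall i, root_tame (e i)) ->
  (forall i j, i <> j -> J (fun x => e i x * e j x) = 0) ->
  (forall i, J (fun x => e i x * e i x) = 1 / 2) ->
  psum (fun i => J (fun x => h x * e i x) ^ 2) m <= 1 / 2 * J (fun x => h x * h x).
Proof.
  intros Hh He Ho Hn.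
  pose (c := fun i => J (fun x => h x * e i x)).
  generalize (bessel_inequality h (fun i x => 2 * c i * e i x) (fun i => 2 * c i ^ 2) m Hh).
  intros H. rewrite psum_scal in H. fold c.
  change (fun i : nat => J (fun x : R => h x * e i x) ^ 2) with (fun i : nat => c i ^ 2).
  enough (2 * psum (fun i : nat => c i ^ 2) m <= J (fun x : R => h x * h x)) by lra.
  apply H.
  - intros i. apply root_tame_scal; auto.
  - intros i j Hij. rewrite (J_ext _ (fun x => (2 * c i) * (2 * c j) * (e i x * e j x))).
    + rewrite J_scal, Ho; auto. ring. apply root_tame_mult; auto.
    + apply root_tame_mult; apply root_tame_scal; auto.
    + intros; ring.
  - intros i. rewrite (J_ext _ (fun x => (2 * c i) * (2 * c i) * (e i x * e i x))).
    + rewrite J_scal, Hn. field. apply root_tame_mult; auto.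
    + apply root_tame_mult; apply root_tame_scal; auto.
    + intros; ring.
  - intros i. rewrite (J_ext _ (fun x => (2 * c i) * (h x * e i x))).
    + rewrite J_scal. fold (c i). ring. apply root_tame_mult; auto.
    + apply root_tame_mult; auto; apply root_tame_scal; auto.
    + intros; ring.
Qed.

Lemma is_lim_seq_0_square (u : nat -> R) : is_lim_seq (fun n => u n ^ 2) 0 -> is_lim_seq u 0.
Proof.
  intros H. apply is_lim_seq_abs_0.
  apply (is_lim_seq_ext (fun n => sqrt (u n ^ 2))).
  - intros n. rewrite <- Rsqr_pow2. apply sqrt_Rsqr_abs.
  - rewrite <- sqrt_0. apply (is_lim_seq_continuous sqrt); [| exact H].
    apply continuity_pt_sqrt. lra.
Qed.

Lemma riemann_lebesgue (h : R -> R) (e : nat -> R -> R) :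
  root_tame h -> (forall i, root_tame (e i)) ->
  (forall i j, i <> j -> J (fun x => e i x * e j x) = 0) ->
  (forall i, J (fun x => e i x * e i x) = 1 / 2) ->
  is_lim_seq (fun i => J (fun x => h x * e i x)) 0.
Proof.
  intros Hh He Ho Hn. apply is_lim_seq_0_square.
  apply ex_series_lim_0.
  apply (ex_series_psum_bounded _ (1 / 2 * J (fun x => h x * h x))).
  - intros n. apply pow2_ge_0.
  - intros m. apply riemann_lebesgue_square; auto.
Qed.

(** * Orthogonality of trigonometric waves *)

Lemma sin_PI_IZR (k : Z) : sin (PI * IZR k) = 0.
Proof. apply sin_eq_0_1. exists k. ring. Qed.

Lemma sin_plus_2PI_IZR (k : Z) (B : R) : sin (2 * PI * IZR k + B) = sin B.
Proof.
  apply Rminus_diag_uniq. rewrite form4.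
  replace ((2 * PI * IZR k + B - B) / 2) with (PI * IZR k) by field.
  rewrite sin_PI_IZR. ring.
Qed.

Lemma cos_plus_2PI_IZR (k : Z) (B : R) : cos (2 * PI * IZR k + B) = cos B.
Proof.
  apply Rminus_diag_uniq. rewrite form2.
  replace ((2 * PI * IZR k + B - B) / 2) with (PI * IZR k) by field.
  rewrite sin_PI_IZR. ring.
Qed.

Lemma sin_2PI_INR (n : nat) : sin (2 * PI * INR n) = 0.
Proof.
  rewrite INR_IZR_INZ. generalize (sin_plus_2PI_IZR (Z.of_nat n) 0).
  rewrite Rplus_0_r, sin_0. auto.
Qed.

Lemma cos_2PI_INR (n : nat) : cos (2 * PI * INR n) = 1.
Proof.
  rewrite INR_IZR_INZ. generalize (cos_plus_2PI_IZR (Z.of_nat n) 0).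
  rewrite Rplus_0_r, cos_0. auto.
Qed.

Lemma continuous_cos_lin (A B x : R) : continuous (fun u => cos (A * u + B)) x.
Proof. apply ex_derive_continuous_R. auto_derive. auto. Qed.

Lemma continuous_sin_lin (A B x : R) : continuous (fun u => sin (A * u + B)) x.
Proof. apply ex_derive_continuous_R. auto_derive. auto. Qed.

Lemma Rabs_cos_le (x : R) : Rabs (cos x) <= 1.
Proof. apply Rabs_le. apply COS_bound. Qed.

Lemma Rabs_sin_le (x : R) : Rabs (sin x) <= 1.
Proof. apply Rabs_le. apply SIN_bound. Qed.

Lemma root_tame_cos_lin (A B : R) : root_tame (fun u => cos (A * u + B)).
Proof.
  apply (bounded_root_tame _ 1).
  - intros x _. apply continuous_cos_lin.
  - intros; apply Rabs_cos_le.
Qed.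

Lemma root_tame_sin_lin (A B : R) : root_tame (fun u => sin (A * u + B)).
Proof.
  apply (bounded_root_tame _ 1).
  - intros x _. apply continuous_sin_lin.
  - intros; apply Rabs_sin_le.
Qed.

Lemma is_J_cos_lin (A B : R) : A <> 0 ->
  is_RInt_gen (fun u => cos (A * u + B)) (at_right 0) (at_left 1) ((sin (A + B) - sin B) / A).
Proof.
  intros HA.
  replace ((sin (A + B) - sin B) / A) with (sin (A * 1 + B) / A - sin (A * 0 + B) / A)
    by (rewrite Rmult_1_r, Rmult_0_r, Rplus_0_l; field; auto).
  apply (is_J_primitive_continuous _ (fun u => sin (A * u + B) / A)).
  - intros x. auto_derive; [auto |]. field; auto.
  - intros x. apply continuous_cos_lin.
Qed.

Lemma J_cos_lin (A B : R) : A <> 0 -> J (fun u => cos (A * u + B)) = (sin (A + B) - sin B) / A.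
Proof. intros HA. apply J_unique, is_J_cos_lin, HA. Qed.

Lemma J_sin_lin (A B : R) : A <> 0 -> J (fun u => sin (A * u + B)) = (cos B - cos (A + B)) / A.
Proof.
  intros HA. apply J_unique.
  replace ((cos B - cos (A + B)) / A) with (- cos (A * 1 + B) / A - - cos (A * 0 + B) / A)
    by (rewrite Rmult_1_r, Rmult_0_r, Rplus_0_l; field; auto).
  apply (is_J_primitive_continuous _ (fun u => - cos (A * u + B) / A)).
  - intros x. auto_derive; [auto |]. field; auto.
  - intros x. apply continuous_sin_lin.
Qed.

Lemma J_cos_period (k : Z) (B : R) : k <> 0%Z -> J (fun u => cos (2 * PI * IZR k * u + B)) = 0.
Proof.
  intros Hk. assert (IZR k <> 0) by (intros H; apply Hk, eq_IZR, H).
  generalize PI_RGT_0; intros Hpi.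
  rewrite J_cos_lin.
  - rewrite sin_plus_2PI_IZR. field. split; lra.
  - apply Rmult_integral_contrapositive. split; lra.
Qed.

(** For odd [k] the phase has to be 0: the interval carries an odd number of half periods, and the
    mean vanishes because [sin] is zero at both of its ends. *)
Lemma J_cos_half_period (k : Z) : k <> 0%Z -> J (fun u => cos (PI * IZR k * u + 0)) = 0.
Proof.
  intros Hk. assert (IZR k <> 0) by (intros H; apply Hk, eq_IZR, H).
  generalize PI_RGT_0; intros Hpi.
  rewrite J_cos_lin.
  - rewrite Rplus_0_r, sin_PI_IZR, sin_0. field. split; lra.
  - apply Rmult_integral_contrapositive. split; lra.
Qed.

Lemma J_lincomb (F G : R -> R) (a b : R) :
  tame F -> tame G -> J (fun x => a * F x + b * G x) = a * J F + b * J G.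
Proof. intros HF HG. rewrite J_plus, !J_scal; auto; apply tame_scal; auto. Qed.

Lemma sin_sin_product (x y : R) : sin x * sin y = 1 / 2 * cos (x - y) + - (1 / 2) * cos (x + y).
Proof. rewrite cos_minus, cos_plus. field. Qed.

Lemma cos_cos_product (x y : R) : cos x * cos y = 1 / 2 * cos (x - y) + 1 / 2 * cos (x + y).
Proof. rewrite cos_minus, cos_plus. field. Qed.

(** Numerator of the Dirichlet kernel [sin((2i+1) y) / sin y] at [y = pi (u - alpha)]. *)
Definition dirichlet_wave (alpha : R) (i : nat) (u : R) : R :=
  sin ((2 * INR i + 1) * PI * (u - alpha)).

(** The same numerators at [y = pi u / 2], where the unit interval covers a quarter period of
    [sin y]; they serve the sine and cosine integrals. *)
Definition half_sine (i : nat) (u : R) : R := sin ((2 * INR i + 1) * (PI / 2) * u).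

Definition half_cosine (i : nat) (u : R) : R := cos ((2 * INR i + 1) * (PI / 2) * u).

Lemma root_tame_eq (F G : R -> R) : root_tame F -> (forall x, F x = G x) -> root_tame G.
Proof.
  intros [HF [K HK]] H. split.
  - intros x Hx. apply (continuous_ext F); auto.
  - exists K. intros x Hx. rewrite <- H. auto.
Qed.

Lemma root_tame_dirichlet_wave (alpha : R) (i : nat) : root_tame (dirichlet_wave alpha i).
Proof.
  eapply root_tame_eq; [apply (root_tame_sin_lin ((2 * INR i + 1) * PI) (- ((2 * INR i + 1) * PI * alpha))) |].
  intros x. unfold dirichlet_wave. f_equal. ring.
Qed.

Lemma root_tame_half_sine (i : nat) : root_tame (half_sine i).
Proof.
  eapply root_tame_eq; [apply (root_tame_sin_lin ((2 * INR i + 1) * (PI / 2)) 0) |].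
  intros x. unfold half_sine. f_equal. ring.
Qed.

Lemma root_tame_half_cosine (i : nat) : root_tame (half_cosine i).
Proof.
  eapply root_tame_eq; [apply (root_tame_cos_lin ((2 * INR i + 1) * (PI / 2)) 0) |].
  intros x. unfold half_cosine. f_equal. ring.
Qed.

(** Product-to-sum produces the frequencies [i - j] and [i + j + 1]. The second is never 0, so only
    the diagonal keeps a mean. The sign of [sg] distinguishes cosines from sines, and tying the
    phase to the frequency covers waves shifted by [alpha]. *)
Lemma J_wave_product (e : nat -> R -> R) (w B sg : R) :
  (forall i, root_tame (e i)) ->
  (forall k, k <> 0%Z -> J (fun u => cos (w * IZR k * u + IZR k * B)) = 0) ->
  (forall i j x, e i x * e j x
     = 1 / 2 * cos (w * (INR i - INR j) * x + (INR i - INR j) * B)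
       + sg * cos (w * (INR i + INR j + 1) * x + (INR i + INR j + 1) * B)) ->
  forall i j, J (fun x => e i x * e j x) = if Nat.eqb i j then 1 / 2 else 0.
Proof.
  intros He Hcos Hprod i j.
  pose (k1 := (Z.of_nat i - Z.of_nat j)%Z). pose (k2 := (Z.of_nat i + Z.of_nat j + 1)%Z).
  assert (E1 : INR i - INR j = IZR k1) by (unfold k1; rewrite minus_IZR, <- !INR_IZR_INZ; ring).
  assert (E2 : INR i + INR j + 1 = IZR k2)
    by (unfold k2; rewrite !plus_IZR, <- !INR_IZR_INZ; ring).
  rewrite (J_ext _ (fun x => 1 / 2 * cos (w * IZR k1 * x + IZR k1 * B)
                       + sg * cos (w * IZR k2 * x + IZR k2 * B))).
  - rewrite J_lincomb by apply root_tame_tame, root_tame_cos_lin.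
    rewrite (Hcos k2) by (unfold k2; lia).
    destruct (Nat.eqb i j) eqn:E.
    + apply Nat.eqb_eq in E. replace k1 with 0%Z by (unfold k1; lia).
      rewrite (J_ext _ (fun _ => 1)).
      * rewrite J_const. lra.
      * apply root_tame_tame, root_tame_cos_lin.
      * intros. rewrite <- cos_0. f_equal. ring.
    + apply Nat.eqb_neq in E. rewrite (Hcos k1) by (unfold k1; lia). lra.
  - apply root_tame_mult; apply He.
  - intros x _. rewrite Hprod, E1, E2. reflexivity.
Qed.

Lemma J_dirichlet_wave_product (alpha : R) (i j : nat) :
  J (fun x => dirichlet_wave alpha i x * dirichlet_wave alpha j x)
  = if Nat.eqb i j then 1 / 2 else 0.
Proof.
  apply (J_wave_product (dirichlet_wave alpha) (2 * PI) (- (2 * PI * alpha)) (- (1 / 2))).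
  - apply root_tame_dirichlet_wave.
  - intros k Hk. apply J_cos_period, Hk.
  - intros m n x. unfold dirichlet_wave. rewrite sin_sin_product.
    f_equal; f_equal; f_equal; ring.
Qed.

Lemma J_half_sine_product (i j : nat) :
  J (fun x => half_sine i x * half_sine j x) = if Nat.eqb i j then 1 / 2 else 0.
Proof.
  apply (J_wave_product half_sine PI 0 (- (1 / 2))).
  - apply root_tame_half_sine.
  - intros k Hk. rewrite Rmult_0_r. apply J_cos_half_period, Hk.
  - intros m n x. unfold half_sine. rewrite sin_sin_product.
    f_equal; f_equal; f_equal; field.
Qed.

Lemma J_half_cosine_product (i j : nat) :
  J (fun x => half_cosine i x * half_cosine j x) = if Nat.eqb i j then 1 / 2 else 0.
Proof.
  apply (J_wave_product half_cosine PI 0 (1 / 2)).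
  - apply root_tame_half_cosine.
  - intros k Hk. rewrite Rmult_0_r. apply J_cos_half_period, Hk.
  - intros m n x. unfold half_cosine. rewrite cos_cos_product.
    f_equal; f_equal; f_equal; field.
Qed.

Lemma riemann_lebesgue_eqb (h : R -> R) (e : nat -> R -> R) :
  root_tame h -> (forall i, root_tame (e i)) ->
  (forall i j, J (fun x => e i x * e j x) = if Nat.eqb i j then 1 / 2 else 0) ->
  is_lim_seq (fun i => J (fun x => h x * e i x)) 0.
Proof.
  intros Hh He Ho. apply riemann_lebesgue; auto.
  - intros i j Hij. rewrite Ho. apply Nat.eqb_neq in Hij. now rewrite Hij.
  - intros i. rewrite Ho, Nat.eqb_refl. reflexivity.
Qed.

(** The whole [n]-th harmonic is treated as one vector, so that Bessel and Pythagoras run over a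
    single index. *)
Definition trig_block (a b : nat -> R) (n : nat) (x : R) : R :=
  a n * cos (2 * PI * INR n * x) + b n * sin (2 * PI * INR n * x).

Lemma root_tame_cos_2PI (n : nat) : root_tame (fun x => cos (2 * PI * INR n * x)).
Proof.
  eapply root_tame_eq; [apply (root_tame_cos_lin (2 * PI * INR n) 0) |].
  intros x; cbv beta; f_equal; ring.
Qed.

Lemma root_tame_sin_2PI (n : nat) : root_tame (fun x => sin (2 * PI * INR n * x)).
Proof.
  eapply root_tame_eq; [apply (root_tame_sin_lin (2 * PI * INR n) 0) |].
  intros x; cbv beta; f_equal; ring.
Qed.

Lemma root_tame_trig_block (a b : nat -> R) (n : nat) : root_tame (trig_block a b n).
Proof.
  apply root_tame_plus; apply root_tame_scal; [apply root_tame_cos_2PI | apply root_tame_sin_2PI].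
Qed.

Lemma J_sin_period (k : Z) : J (fun u => sin (2 * PI * IZR k * u + 0)) = 0.
Proof.
  generalize PI_RGT_0; intros Hpi.
  destruct (Z.eq_dec k 0) as [->|Hk].
  - rewrite (J_ext _ (fun _ => 0)); [apply J_const | apply root_tame_tame, root_tame_sin_lin |].
    intros x _. replace (2 * PI * 0 * x + 0) with 0 by ring. apply sin_0.
  - assert (IZR k <> 0) by (intros H; apply Hk, eq_IZR, H).
    rewrite J_sin_lin.
    + rewrite cos_plus_2PI_IZR. field. split; lra.
    + apply Rmult_integral_contrapositive. split; lra.
Qed.

Lemma J_trig_block_product (a b : nat -> R) (n m : nat) : (1 <= n)%nat -> (1 <= m)%nat ->
  J (fun x => trig_block a b n x * trig_block a b m x)
  = if Nat.eqb n m then 1 / 2 * (a n ^ 2 + b n ^ 2) else 0.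
Proof.
  intros Hn Hm.
  pose (k1 := (Z.of_nat n - Z.of_nat m)%Z). pose (k2 := (Z.of_nat n + Z.of_nat m)%Z).
  assert (E1 : INR n - INR m = IZR k1) by (unfold k1; rewrite minus_IZR, <- !INR_IZR_INZ; ring).
  assert (E2 : INR n + INR m = IZR k2)
    by (unfold k2; rewrite !plus_IZR, <- !INR_IZR_INZ; ring).
  assert (Hc : forall k, tame (fun x => cos (2 * PI * IZR k * x + 0)))
    by (intros; apply root_tame_tame, root_tame_cos_lin).
  assert (Hs : forall k, tame (fun x => sin (2 * PI * IZR k * x + 0)))
    by (intros; apply root_tame_tame, root_tame_sin_lin).
  rewrite (J_ext _ (fun x =>
     1 * (((a n * a m + b n * b m) / 2) * cos (2 * PI * IZR k1 * x + 0)
          + ((a n * a m - b n * b m) / 2) * cos (2 * PI * IZR k2 * x + 0))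
     + 1 * (((a n * b m + b n * a m) / 2) * sin (2 * PI * IZR k2 * x + 0)
          + ((b n * a m - a n * b m) / 2) * sin (2 * PI * IZR k1 * x + 0)))).
  - rewrite J_lincomb by (apply tame_plus; apply tame_scal; auto).
    rewrite !J_lincomb by auto. rewrite !J_sin_period.
    rewrite (J_cos_period k2) by (unfold k2; lia).
    destruct (Nat.eqb n m) eqn:E.
    + apply Nat.eqb_eq in E. subst m. replace k1 with 0%Z by (unfold k1; lia).
      rewrite (J_ext _ (fun _ => 1)).
      * rewrite J_const. field.
      * auto.
      * intros. rewrite <- cos_0. f_equal. ring.
    + apply Nat.eqb_neq in E. rewrite (J_cos_period k1) by (unfold k1; lia). ring.
  - apply root_tame_mult; apply root_tame_trig_block.
  - intros x _. unfold trig_block. rewrite !Rplus_0_r, <- E1, <- E2.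
    rewrite !Rmult_minus_distr_l, !Rmult_plus_distr_l.
    rewrite !Rmult_minus_distr_r, !Rmult_plus_distr_r.
    rewrite cos_plus, cos_minus, sin_plus, sin_minus. field.
Qed.

(** * Sine and cosine integrals *)

Lemma ln_le_minus_1 (x : R) : 0 < x -> ln x <= x - 1.
Proof. intros Hx. generalize (exp_ineq1_le (ln x)). rewrite exp_ln by auto. lra. Qed.

Lemma ln_sqrt (x : R) : 0 < x -> ln x = 2 * ln (sqrt x).
Proof.
  intros Hx. assert (0 < sqrt x) by (apply sqrt_lt_R0; auto).
  rewrite <- (sqrt_sqrt x) at 1 by lra. rewrite ln_mult by auto. ring.
Qed.

Lemma Rabs_ln_le_inv (x : R) : 0 < x < 1 -> Rabs (ln x) <= / x.
Proof.
  intros Hx. assert (ln x < 0) by (rewrite <- ln_1; apply ln_increasing; lra).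
  rewrite Rabs_left by auto. rewrite <- ln_Rinv by lra.
  assert (0 < / x) by (apply Rinv_0_lt_compat; lra).
  generalize (ln_le_minus_1 (/ x)); lra.
Qed.

Lemma Rabs_ln_le_inv_sqrt (x : R) : 0 < x < 1 -> Rabs (ln x) <= 2 * / sqrt x.
Proof.
  intros Hx. rewrite ln_sqrt by lra. rewrite Rabs_mult, (Rabs_right 2) by lra.
  generalize (Rabs_ln_le_inv (sqrt x) (sqrt_unit x Hx)). lra.
Qed.

(** Two square roots improve the crude bound [1/x] to the exponent that [root_tame] asks for,
    doubling the constant each time. *)
Lemma Rabs_ln_le_inv_sqrt_sqrt (x : R) : 0 < x < 1 -> Rabs (ln x) <= 4 * / sqrt (sqrt x).
Proof.
  intros Hx. rewrite ln_sqrt by lra. rewrite Rabs_mult, (Rabs_right 2) by lra.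
  generalize (Rabs_ln_le_inv_sqrt (sqrt x) (sqrt_unit x Hx)). lra.
Qed.

Lemma Rabs_sin_le_Rabs (x : R) : Rabs (sin x) <= Rabs x.
Proof.
  assert (H : forall y, 0 < y -> Rabs (sin y) <= y).
  { intros y Hy. destruct (Rle_dec y 1) as [H1|H1].
    - rewrite Rabs_right; [generalize (sin_lt_x y Hy); lra |].
      generalize PI2_1; intros. apply Rle_ge, sin_ge_0; lra.
    - generalize (Rabs_sin_le y); lra. }
  destruct (Rtotal_order x 0) as [Hx|[->|Hx]].
  - rewrite <- (Rabs_Ropp (sin x)), <- sin_neg, (Rabs_left x) by auto. apply H; lra.
  - rewrite sin_0. lra.
  - rewrite (Rabs_right x) by lra. auto.
Qed.

Lemma one_minus_cos (x : R) : 1 - cos x = 2 * sin (x / 2) ^ 2.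
Proof. replace x with (2 * (x / 2)) at 1 by field. rewrite cos_2a_sin. ring. Qed.

Lemma Rabs_one_minus_cos_le (x : R) : Rabs (1 - cos x) <= Rabs x.
Proof.
  rewrite one_minus_cos, Rabs_mult, <- RPow_abs, (Rabs_right 2) by lra.
  generalize (Rabs_sin_le_Rabs (x / 2)) (Rabs_sin_le (x / 2)) (Rabs_pos (sin (x / 2))).
  unfold Rdiv at 2. rewrite Rabs_mult, (Rabs_right (/ 2)) by lra. nra.
Qed.

Lemma root_tame_ln_shift (k : nat) : root_tame (fun x => ln (x + INR k)).
Proof.
  assert (Hc : cont01 (fun x => ln (x + INR k))).
  { intros x Hx. apply ex_derive_continuous_R. auto_derive. generalize (pos_INR k); lra. }
  destruct k as [|k].
  - split; [exact Hc |]. exists 4. intros x Hx. simpl. rewrite Rplus_0_r.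
    apply Rabs_ln_le_inv_sqrt_sqrt, Hx.
  - apply (bounded_root_tame _ (ln (1 + INR (S k))) Hc).
    intros x Hx. generalize (pos_INR k). rewrite S_INR. intros.
    rewrite Rabs_right.
    + apply ln_le; lra.
    + apply Rle_ge. rewrite <- ln_1. apply ln_le; lra.
Qed.

Lemma filterlim_at_right_0_sqrt_bound (G : R -> R) (C : R) :
  (forall y, 0 < y < 1 -> Rabs (G y) <= C * sqrt y) -> filterlim G (at_right 0) (locally 0).
Proof.
  intros HG. apply filterlim_locally. intros eps.
  assert (HC : filterlim (fun y => C * sqrt y) (at_right 0) (locally (C * sqrt 0))).
  { apply (continuous_filterlim_at_right (fun y => C * sqrt y)).
    apply (continuous_scal_r C sqrt), continuous_sqrt. }
  rewrite sqrt_0, Rmult_0_r in HC.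
  generalize (proj1 (filterlim_locally _ _) HC eps); intros H1.
  generalize (filter_and _ _ H1 at_right_0_in). apply filter_imp.
  intros y [Hy Hy1]. change (Rabs (C * sqrt y - 0) < eps) in Hy.
  change (Rabs (G y - 0) < eps). rewrite Rminus_0_r in *.
  eapply Rle_lt_trans; [apply HG, Hy1 |]. eapply Rle_lt_trans; [apply Rle_abs | exact Hy].
Qed.

Lemma filterlim_ln_mult_0 (G : R -> R) (C : R) :
  (forall y, 0 < y < 1 -> Rabs (G y) <= C * y) ->
  filterlim (fun y => ln y * G y) (at_right 0) (locally 0).
Proof.
  intros HG. apply (filterlim_at_right_0_sqrt_bound _ (2 * C)).
  intros y Hy. rewrite Rabs_mult.
  assert (0 < sqrt y) by (apply sqrt_lt_R0; lra).
  replace (2 * C * sqrt y) with ((2 * / sqrt y) * (C * y)).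
  - apply Rmult_le_compat; try apply Rabs_pos; auto. apply Rabs_ln_le_inv_sqrt, Hy.
  - rewrite <- (sqrt_sqrt y) at 2 by lra. field. lra.
Qed.

Definition sinc (t : R) : R := if Req_EM_T t 0 then 1 else sin t / t.

(** This is [(1 - cos t) / t] with value 0 at 0; in product form its continuity is inherited from
    [sinc]. *)
Definition cosc (t : R) : R := sinc (t / 2) * sin (t / 2).

Lemma sinc_neq (t : R) : t <> 0 -> sinc t = sin t / t.
Proof. intros Ht. unfold sinc. destruct (Req_EM_T t 0); [contradiction | reflexivity]. Qed.

Lemma sinc_0 : sinc 0 = 1.
Proof. unfold sinc. destruct (Req_EM_T 0 0); [reflexivity | contradiction]. Qed.

Lemma cosc_neq (t : R) : t <> 0 -> cosc t = (1 - cos t) / t.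
Proof.
  intros Ht. unfold cosc. rewrite sinc_neq by lra. rewrite one_minus_cos. field. auto.
Qed.

Lemma continuous_sinc (t : R) : continuous sinc t.
Proof.
  destruct (Req_EM_T t 0) as [->|Ht].
  - apply continuity_pt_filterlim. apply continuity_pt_filterlim'.
    rewrite sinc_0.
    eapply filterlim_ext_loc; [| apply is_lim_sinc_0].
    exists (mkposreal 1 Rlt_0_1). intros y _ Hy. rewrite sinc_neq; auto.
  - apply (continuous_ext_loc _ (fun t => sin t / t)).
    + assert (Hp : 0 < Rabs t) by (apply Rabs_pos_lt; auto).
      exists (mkposreal _ Hp). intros y Hy. rewrite sinc_neq; [reflexivity |].
      intros ->. change (Rabs (0 - t) < Rabs t) in Hy.
      rewrite Rabs_minus_sym, Rminus_0_r in Hy. lra.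
    + apply ex_derive_continuous_R. auto_derive. auto.
Qed.

Lemma continuous_cosc (t : R) : continuous cosc t.
Proof.
  apply (continuous_mult (fun t => sinc (t / 2)) (fun t => sin (t / 2))).
  - apply (continuous_comp (fun t => t / 2) sinc); [| apply continuous_sinc].
    apply ex_derive_continuous_R. auto_derive. auto.
  - apply ex_derive_continuous_R. auto_derive. auto.
Qed.

Definition Si (x : R) : R := RInt sinc 0 x.

(** For [x > 0] this is the entire cosine integral [gamma + ln x - Ci x]. *)
Definition Cin (x : R) : R := RInt cosc 0 x.

Lemma is_derive_RInt_continuous (f : R -> R) (x : R) :
  (forall t, continuous f t) -> is_derive (fun y => RInt f 0 y) x (f x).
Proof.
  intros Hf. apply (is_derive_RInt f _ 0); [| apply Hf].
  exists (mkposreal 1 Rlt_0_1). intros y _. apply (RInt_correct f).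
  apply (ex_RInt_continuous f). auto.
Qed.

Lemma is_J_scaled (f : R -> R) (K c : R) : (forall t, continuous f t) ->
  is_RInt_gen (fun x => K * (c * f (c * x))) (at_right 0) (at_left 1) (K * RInt f 0 c).
Proof.
  intros Hf. pose (G := fun x => RInt f 0 x).
  replace (K * RInt f 0 c) with (K * G (c * 1) - K * G (c * 0)).
  - apply (is_J_primitive_continuous _ (fun x => K * G (c * x))).
    + intros x. assert (HG := is_derive_RInt_continuous f (c * x) Hf). auto_derive.
      * eexists. exact HG.
      * assert (E : Derive (fun x => G x) (c * x) = f (c * x)) by apply is_derive_unique, HG.
        rewrite E. ring.
    + intros x. apply (continuous_scal_r K (fun x => c * f (c * x))).
      apply (continuous_scal_r c (fun x => f (c * x))).
      apply (continuous_comp (fun x => c * x) f); [| apply Hf].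
      apply ex_derive_continuous_R. auto_derive. auto.
  - unfold G. rewrite Rmult_1_r, Rmult_0_r, RInt_point. change zero with 0. ring.
Qed.

Lemma Si_0 : Si 0 = 0.
Proof. unfold Si. now rewrite RInt_point. Qed.

Lemma Cin_0 : Cin 0 = 0.
Proof. unfold Cin. now rewrite RInt_point. Qed.

Lemma filterlim_shift_at_right (P : R -> R) (a l : R) :
  filterlim P (at_right a) (locally l) -> filterlim (fun x => P (x + a)) (at_right 0) (locally l).
Proof.
  intros H. eapply filterlim_comp; [| exact H].
  intros Q [d Hd]. exists d. intros y Hy H0. apply Hd; [| lra].
  change (Rabs (y - 0) < d) in Hy. change (Rabs (y + a - a) < d).
  replace (y + a - a) with (y - 0) by ring. auto.
Qed.

Lemma filterlim_shift_at_left (P : R -> R) (a l : R) :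
  filterlim P (at_left (1 + a)) (locally l) ->
  filterlim (fun x => P (x + a)) (at_left 1) (locally l).
Proof.
  intros H. eapply filterlim_comp; [| exact H].
  intros Q [d Hd]. exists d. intros y Hy H0. apply Hd; [| lra].
  change (Rabs (y - 1) < d) in Hy. change (Rabs (y + a - (1 + a)) < d).
  replace (y + a - (1 + a)) with (y - 1) by ring. auto.
Qed.

(** The limit at the left end is a hypothesis because for [k = 0] the primitive contains a logarithm
    that is singular there; the right end is always regular. *)
Lemma is_J_shift_primitive (F P : R -> R) (k : nat) (l : R) :
  (forall y, 0 < y -> is_derive P y (F y)) -> (forall y, 0 < y -> continuous F y) ->
  (filterlim P (at_right (INR k)) (locally l)) ->
  is_RInt_gen (fun x => F (x + INR k)) (at_right 0) (at_left 1) (P (INR (S k)) - l).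
Proof.
  intros HP HF Hl. generalize (pos_INR k); intros Hk.
  apply (is_J_primitive _ (fun x => P (x + INR k))).
  - intros x Hx. replace (F (x + INR k)) with (scal 1 (F (x + INR k))) by (unfold scal; simpl; unfold mult; simpl; ring).
    apply (is_derive_comp P (fun x => x + INR k)).
    + apply HP; lra.
    + auto_derive; [auto | ring].
  - intros x Hx. apply (continuous_comp (fun x => x + INR k) F).
    + apply ex_derive_continuous_R. auto_derive. auto.
    + apply HF; lra.
  - apply filterlim_shift_at_right, Hl.
  - apply filterlim_shift_at_left. rewrite S_INR, Rplus_comm.
    apply continuous_filterlim_at_left, ex_derive_continuous_R.
    eexists. apply HP. lra.
Qed.

(** For [k = 0] the stated limit uses the default value [ln 0 = 0], which agrees with the true limit
    of [ln y * G y] because [G y = O(y)]. *)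
Lemma filterlim_ln_mult_INR (G Q : R -> R) (C : R) (k : nat) :
  (forall y, 0 < y < 1 -> Rabs (G y) <= C * y) ->
  (forall y, ex_derive G y) -> (forall y, continuous Q y) ->
  filterlim (fun y => ln y * G y + Q y) (at_right (INR k)) (locally (ln (INR k) * G (INR k) + Q (INR k))).
Proof.
  intros HG HG' HQ. destruct k as [|k].
  - simpl INR. replace (ln 0 * G 0 + Q 0) with (0 + Q 0).
    + exact (filterlim_comp_2 (fun y => ln y * G y) Q plus (filterlim_ln_mult_0 G C HG)
        (continuous_filterlim_at_right Q 0 (HQ 0)) (filterlim_plus (V := R_NormedModule) 0 (Q 0))).
    + assert (E : ln 0 = 0) by (unfold ln; destruct (Rlt_dec 0 0); [exfalso; lra | reflexivity]).
      rewrite E. ring.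
  - apply (continuous_filterlim_at_right (fun y => ln y * G y + Q y)).
    apply (continuous_plus (fun y => ln y * G y) Q); [| apply HQ].
    apply ex_derive_continuous_R. auto_derive. split; [| split; auto].
    rewrite S_INR. generalize (pos_INR k); lra.
Qed.

(* [osc] is [cos] or [sin]; [g] is its primitive vanishing at multiples of [c]; integration
   by parts leaves [g t / t], extended by continuity to [f]. *)
Lemma is_J_ln_oscillation (osc g f : R -> R) (c : R) (k : nat) : 0 < c ->
  (forall t, is_derive g t (osc t)) -> (forall t, ex_derive osc t) ->
  (forall t, continuous f t) -> (forall t, t <> 0 -> f t = g t / t) ->
  (forall t, Rabs (g t) <= Rabs t) -> (forall j, g (c * INR j) = 0) ->
  (forall x, osc (c * (x + INR k)) = osc (c * x)) ->
  is_RInt_gen (fun x => ln (x + INR k) * osc (c * x)) (at_right 0) (at_left 1)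
    ((RInt f 0 (c * INR k) - RInt f 0 (c * INR (S k))) / c).
Proof.
  intros Hc Hg Hosc Hf Hfg Hgb Hg0 Hper.
  assert (HF := is_derive_RInt_continuous f).
  pose (P := fun y => ln y * (g (c * y) / c) + - RInt f 0 (c * y) / c).
  apply (is_J_ext (fun x => ln (x + INR k) * osc (c * (x + INR k)))).
  { intros x Hx. now rewrite Hper. }
  replace ((RInt f 0 (c * INR k) - RInt f 0 (c * INR (S k))) / c)
    with (P (INR (S k)) - (ln (INR k) * (g (c * INR k) / c) + - RInt f 0 (c * INR k) / c))
    by (unfold P; rewrite !Hg0; field; lra).
  apply (is_J_shift_primitive (fun y => ln y * osc (c * y)) P).
  - intros y Hy. unfold P.
    assert (E : Derive (fun x => g x) (c * y) = osc (c * y)) by apply is_derive_unique, Hg.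
    assert (E' : Derive (fun x => RInt f 0 x) (c * y) = f (c * y)) by apply is_derive_unique, HF, Hf.
    pose (G := fun x => RInt f 0 x). change (Derive G (c * y) = f (c * y)) in E'.
    change (is_derive (fun y => ln y * (g (c * y) / c) + - G (c * y) / c) y (ln y * osc (c * y))).
    auto_derive.
    + repeat split; auto; eexists; [apply Hg | apply HF, Hf].
    + change (Derive (fun x => G x) (c * y)) with (Derive G (c * y)).
      rewrite E, E', Hfg by nra. field. lra.
  - intros y Hy. apply ex_derive_continuous_R. auto_derive. auto.
  - apply (filterlim_ln_mult_INR (fun y => g (c * y) / c) (fun y => - RInt f 0 (c * y) / c) 1).
    + intros y Hy. unfold Rdiv. rewrite Rabs_mult, (Rabs_right (/ c)).
      * generalize (Hgb (c * y)). rewrite (Rabs_right (c * y)) by nra. intros H.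
        apply (Rmult_le_reg_r c); [auto |]. field_simplify; lra.
      * apply Rle_ge, Rlt_le, Rinv_0_lt_compat, Hc.
    + intros y. auto_derive. eexists. apply Hg.
    + intros y. apply ex_derive_continuous_R. pose (G := fun x => RInt f 0 x).
      change (ex_derive (fun y => - G (c * y) / c) y). auto_derive. eexists. apply HF, Hf.
Qed.

Lemma is_J_ln_cos (n k : nat) : (1 <= n)%nat ->
  is_RInt_gen (fun x => ln (x + INR k) * cos (2 * PI * INR n * x)) (at_right 0) (at_left 1)
    ((Si (2 * PI * INR n * INR k) - Si (2 * PI * INR n * INR (S k))) / (2 * PI * INR n)).
Proof.
  intros Hn.
  apply (is_J_ln_oscillation cos sin sinc).
  - generalize PI_RGT_0 (lt_0_INR n ltac:(lia)); nra.
  - intros t. auto_derive; [auto | ring].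
  - intros t. auto_derive. auto.
  - apply continuous_sinc.
  - apply sinc_neq.
  - apply Rabs_sin_le_Rabs.
  - intros j. replace (2 * PI * INR n * INR j) with (2 * PI * INR (n * j))
      by (rewrite mult_INR; ring). apply sin_2PI_INR.
  - intros x. rewrite <- (cos_plus_2PI_IZR (Z.of_nat (n * k)) (2 * PI * INR n * x)). f_equal.
    rewrite <- INR_IZR_INZ, mult_INR. ring.
Qed.

Lemma is_J_ln_sin (n k : nat) : (1 <= n)%nat ->
  is_RInt_gen (fun x => ln (x + INR k) * sin (2 * PI * INR n * x)) (at_right 0) (at_left 1)
    ((Cin (2 * PI * INR n * INR k) - Cin (2 * PI * INR n * INR (S k))) / (2 * PI * INR n)).
Proof.
  intros Hn.
  apply (is_J_ln_oscillation sin (fun t => 1 - cos t) cosc).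
  - generalize PI_RGT_0 (lt_0_INR n ltac:(lia)); nra.
  - intros t. auto_derive; [auto | ring].
  - intros t. auto_derive. auto.
  - apply continuous_cosc.
  - apply cosc_neq.
  - apply Rabs_one_minus_cos_le.
  - intros j. replace (2 * PI * INR n * INR j) with (2 * PI * INR (n * j))
      by (rewrite mult_INR; ring). rewrite cos_2PI_INR. ring.
  - intros x. rewrite <- (sin_plus_2PI_IZR (Z.of_nat (n * k)) (2 * PI * INR n * x)). f_equal.
    rewrite <- INR_IZR_INZ, mult_INR. ring.
Qed.

Lemma is_J_ln_shift (k : nat) :
  is_RInt_gen (fun x => ln (x + INR k)) (at_right 0) (at_left 1)
    (INR (S k) * ln (INR (S k)) - INR k * ln (INR k) - 1).
Proof.
  replace (INR (S k) * ln (INR (S k)) - INR k * ln (INR k) - 1)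
    with ((ln (INR (S k)) * INR (S k) + - INR (S k)) - (ln (INR k) * INR k + - INR k))
    by (rewrite S_INR; ring).
  apply (is_J_shift_primitive ln (fun y => ln y * y + - y)).
  - intros y Hy. auto_derive; [auto |]. field. lra.
  - intros y Hy. apply ex_derive_continuous_R. auto_derive. auto.
  - apply (filterlim_ln_mult_INR (fun y => y) (fun y => - y) 1).
    + intros y Hy. rewrite Rabs_right; lra.
    + intros y. auto_derive. auto.
    + intros y. apply ex_derive_continuous_R. auto_derive. auto.
Qed.

(** * Harmonic numbers, Dirichlet kernels and the limits of the sine and cosine integrals *)

Lemma ln_step_bounds (x : R) : 0 < x -> / (x + 1) <= ln (x + 1) - ln x <= / x.
Proof.
  intros Hx. assert (0 < (x + 1) / x) by (apply Rdiv_lt_0_compat; lra).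
  assert (0 < x / (x + 1)) by (apply Rdiv_lt_0_compat; lra).
  split.
  - generalize (ln_le_minus_1 (x / (x + 1)) ltac:(auto)). rewrite ln_div by lra.
    replace (x / (x + 1) - 1) with (- / (x + 1)) by (field; lra). lra.
  - generalize (ln_le_minus_1 ((x + 1) / x) ltac:(auto)). rewrite ln_div by lra.
    replace ((x + 1) / x - 1) with (/ x) by (field; lra). lra.
Qed.

Definition harmonic (n : nat) : R := psum (fun k => / INR (S k)) n.

Lemma harmonic_sum_n_m (n : nat) : sum_n_m (fun k => / INR k) 1 n = harmonic n.
Proof.
  induction n as [|n IH].
  - rewrite sum_n_m_zero by lia. reflexivity.
  - rewrite sum_n_Sm by lia. rewrite IH. reflexivity.
Qed.

Lemma harmonic_lower_bound (n : nat) : ln (INR n + 1) <= harmonic n.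
Proof.
  induction n as [|n IH].
  - unfold harmonic. simpl. rewrite Rplus_0_l, ln_1. lra.
  - unfold harmonic in *. rewrite !psum_S. generalize (pos_INR n); intros.
    generalize (proj2 (ln_step_bounds (INR n + 1) ltac:(lra))). rewrite S_INR. lra.
Qed.

Lemma is_lim_seq_harmonic_ln : is_lim_seq (fun n => harmonic n - ln (INR n)) Euler_gamma.
Proof.
  assert (H : ex_finite_lim_seq (fun n => harmonic n - ln (INR n))).
  (* The sequence decreases only from index 1 on: at index 0 the default [ln 0 = 0] gives the value
     0, below the value 1 that follows. *)
  { enough (H : ex_finite_lim_seq (fun n => harmonic (S n) - ln (INR (S n)))).
    { destruct H as [l Hl]. exists l.
      apply (is_lim_seq_incr_1 (fun n => harmonic n - ln (INR n))), Hl. }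
    apply (ex_finite_lim_seq_decr _ 0).
    - intros n. unfold harmonic. rewrite !psum_S. rewrite (S_INR (S n)).
      generalize (lt_0_INR (S n) ltac:(lia)); intros H.
      generalize (proj1 (ln_step_bounds _ H)). lra.
    - intros n. generalize (harmonic_lower_bound (S n)), (lt_0_INR (S n) ltac:(lia)); intros H1 H2.
      assert (ln (INR (S n)) <= ln (INR (S n) + 1)) by (apply ln_le; lra). lra. }
  destruct H as [l Hl].
  unfold Euler_gamma.
  rewrite (Lim_seq_ext _ (fun n => harmonic n - ln (INR n)))
    by (intros; now rewrite harmonic_sum_n_m).
  rewrite (is_lim_seq_unique _ _ Hl). exact Hl.
Qed.

Lemma dirichlet_kernel (y : R) (N : nat) :
  sin ((2 * INR N + 1) * y) = sin y * (1 + psum (fun k => 2 * cos (2 * INR (S k) * y)) N).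
Proof.
  induction N as [|N IH].
  - simpl. replace ((2 * 0 + 1) * y) with y by ring. ring.
  - assert (E : sin ((2 * INR (S N) + 1) * y) - sin ((2 * INR N + 1) * y)
             = sin y * (2 * cos (2 * INR (S N) * y))).
    { rewrite form4, S_INR.
      replace (((2 * (INR N + 1) + 1) * y - (2 * INR N + 1) * y) / 2) with y by field.
      replace (((2 * (INR N + 1) + 1) * y + (2 * INR N + 1) * y) / 2)
        with (2 * (INR N + 1) * y) by field. ring. }
    rewrite !psum_S. lra.
Qed.

Lemma conjugate_dirichlet_kernel (y : R) (N : nat) :
  cos y - cos ((2 * INR N + 1) * y) = sin y * psum (fun k => 2 * sin (2 * INR (S k) * y)) N.
Proof.
  induction N as [|N IH].
  - simpl. replace ((2 * 0 + 1) * y) with y by ring. ring.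
  - assert (E : cos ((2 * INR N + 1) * y) - cos ((2 * INR (S N) + 1) * y)
             = sin y * (2 * sin (2 * INR (S N) * y))).
    { rewrite form2, S_INR.
      replace (((2 * INR N + 1) * y - (2 * (INR N + 1) + 1) * y) / 2) with (- y) by field.
      replace (((2 * INR N + 1) * y + (2 * (INR N + 1) + 1) * y) / 2)
        with (2 * (INR N + 1) * y) by field. rewrite sin_neg. ring. }
    rewrite !psum_S. lra.
Qed.

Lemma sin_cubic_lower_bound (y : R) : 0 <= y <= 2 -> y - y ^ 3 / 6 <= sin y.
Proof.
  intros Hy. generalize (proj1 (pre_sin_bound y 0 (proj1 Hy) ltac:(lra))).
  unfold sin_approx, sin_term. simpl. lra.
Qed.

Lemma sin_le_id (y : R) : 0 <= y -> sin y <= y.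
Proof. intros [Hy| <-]; [left; apply sin_lt_x, Hy | rewrite sin_0; lra]. Qed.

Lemma PI_le_4 : PI <= 4.
Proof. generalize PI_4; lra. Qed.

(** With [y = pi x / 2], the bounded function [1 / sin y - 1 / y]. Exchanging the denominator
    [sin y] of a kernel for [y] turns it into [sinc] or [cosc], and the exchange costs an integral
    that Riemann-Lebesgue sends to 0. *)
Definition csc_defect (x : R) : R := / sin (PI / 2 * x) - / (PI / 2 * x).

Lemma half_angle_bounds (x : R) : 0 < x < 1 -> 0 < PI / 2 * x < 2 /\ 0 < sin (PI / 2 * x).
Proof.
  intros Hx. generalize PI_RGT_0 PI_le_4; intros.
  assert (0 < PI / 2 * x < 2) by nra. split; [auto |].
  apply sin_gt_0; nra.
Qed.

Lemma root_tame_csc_defect : root_tame csc_defect.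
Proof.
  apply (bounded_root_tame _ 1).
  - intros x Hx. destruct (half_angle_bounds x Hx). apply ex_derive_continuous_R.
    unfold csc_defect. auto_derive. repeat split; lra.
  - intros x Hx. destruct (half_angle_bounds x Hx) as [Hy Hs]. unfold csc_defect.
    set (y := PI / 2 * x) in *.
    generalize (sin_cubic_lower_bound y ltac:(lra)), (sin_le_id y ltac:(lra)); intros H1 H2.
    replace (/ sin y - / y) with ((y - sin y) / (y * sin y)) by (field; lra).
    assert (0 < y * sin y) by nra.
    rewrite Rabs_right.
    + apply (Rmult_le_reg_r (y * sin y)); [auto |].
      unfold Rdiv. rewrite Rmult_assoc, Rinv_l by lra.
      (* For [y <= 2] the cubic bound gives [sin y >= y / 3] and [y - sin y <= y^3 / 6], so the
         quotient is at most [y / 2]. *)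
      assert (y / 3 <= sin y) by nra. nra.
    + apply Rle_ge, Rdiv_le_0_compat; lra.
Qed.

Lemma root_tame_half_cos (k : nat) : root_tame (fun x => cos (2 * INR (S k) * (PI / 2 * x))).
Proof.
  eapply root_tame_eq; [apply (root_tame_cos_lin (2 * INR (S k) * (PI / 2)) 0) |].
  intros x; cbv beta; f_equal; ring.
Qed.

Lemma root_tame_half_sin (k : nat) : root_tame (fun x => sin (2 * INR (S k) * (PI / 2 * x))).
Proof.
  eapply root_tame_eq; [apply (root_tame_sin_lin (2 * INR (S k) * (PI / 2)) 0) |].
  intros x; cbv beta; f_equal; ring.
Qed.

Lemma J_psum (w : nat -> R -> R) (m : nat) :
  (forall i, root_tame (w i)) -> J (fun x => psum (fun i => w i x) m) = psum (fun i => J (w i)) m.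
Proof.
  intros Hw. rewrite (J_ext _ (fun x => 1 * psum (fun i => w i x) m)).
  - rewrite (J_mult_psum (fun _ => 1)); [| apply root_tame_const | exact Hw].
    apply psum_ext. intros i _. apply J_ext; [| intros; ring].
    apply root_tame_mult; auto using root_tame_const.
  - apply root_tame_tame, root_tame_psum, Hw.
  - intros; ring.
Qed.

Lemma J_half_dirichlet_kernel (N : nat) :
  J (fun x => 1 + psum (fun k => 2 * cos (2 * INR (S k) * (PI / 2 * x))) N) = 1.
Proof.
  assert (Hw : forall i, root_tame (fun x => 2 * cos (2 * INR (S i) * (PI / 2 * x))))
    by (intros; apply root_tame_scal, root_tame_half_cos).
  rewrite (J_plus (fun _ => 1) (fun x => psum (fun k => 2 * cos (2 * INR (S k) * (PI / 2 * x))) N)).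
  - rewrite J_const, (J_psum (fun k x => 2 * cos (2 * INR (S k) * (PI / 2 * x)))) by exact Hw.
    rewrite psum_zero; [ring |]. intros i _.
    rewrite J_scal by apply root_tame_tame, root_tame_half_cos.
    rewrite (J_ext _ (fun x => cos (PI * IZR (Z.of_nat (S i)) * x + 0))).
    + rewrite J_cos_half_period by lia. ring.
    + apply root_tame_tame, root_tame_half_cos.
    + intros x _. rewrite <- INR_IZR_INZ. f_equal. field.
  - apply root_tame_tame, root_tame_const.
  - apply root_tame_tame. apply (root_tame_psum (fun k x => 2 * cos (2 * INR (S k) * (PI / 2 * x)))), Hw.
Qed.

(** Chosen so that [half_freq N * x = (2N+1) y] with [y = pi x / 2]. *)
Definition half_freq (N : nat) : R := (2 * INR N + 1) * (PI / 2).

Lemma half_freq_pos (N : nat) : 0 < half_freq N.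
Proof. unfold half_freq. generalize PI_RGT_0, (pos_INR N). nra. Qed.

(** The kernel [sin((2N+1) y) / sin y] has integral 1. Splitting [1 / sin y] into [1 / y] and
    [csc_defect] leaves [Si] and a term that vanishes in the limit. *)
Lemma Si_half_freq (N : nat) :
  Si (half_freq N) = PI / 2 - PI / 2 * J (fun x => csc_defect x * half_sine N x).
Proof.
  generalize PI_RGT_0, (half_freq_pos N); intros Hpi Hc.
  set (c := half_freq N) in *.
  assert (H1 := is_J_scaled sinc (2 / PI) c continuous_sinc). fold (Si c) in H1.
  assert (H2 := tame_is_RInt_gen _ (root_tame_mult _ _ root_tame_csc_defect (root_tame_half_sine N))).
  assert (H3 := is_RInt_gen_plus _ _ _ _ H1 H2).
  assert (H4 : J (fun x => 1 + psum (fun k => 2 * cos (2 * INR (S k) * (PI / 2 * x))) N)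
     = 2 / PI * Si c + J (fun x => csc_defect x * half_sine N x)).
  { apply J_unique. revert H3. apply is_J_ext. intros x Hx.
    destruct (half_angle_bounds x Hx) as [Hy Hs].
    change (2 / PI * (c * sinc (c * x)) + csc_defect x * half_sine N x =
      1 + psum (fun k => 2 * cos (2 * INR (S k) * (PI / 2 * x))) N).
    apply (Rmult_eq_reg_l (sin (PI / 2 * x))); [| lra].
    rewrite <- dirichlet_kernel, sinc_neq by nra.
    unfold csc_defect, half_sine.
    replace ((2 * INR N + 1) * (PI / 2 * x)) with (c * x) by (unfold c, half_freq; ring).
    replace ((2 * INR N + 1) * (PI / 2) * x) with (c * x) by (unfold c, half_freq; ring).
    field. repeat split; lra. }
  rewrite J_half_dirichlet_kernel in H4.
  apply (Rmult_eq_reg_l (2 / PI)).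
  - rewrite Rmult_minus_distr_l, <- Rmult_assoc.
    replace (2 / PI * (PI / 2)) with 1 by (field; lra). lra.
  - apply Rgt_not_eq, Rdiv_lt_0_compat; lra.
Qed.

(** With [y = pi x / 2], a primitive is [(2 / pi) ln (sin y / y)], which [sinc] extends continuously
    to both ends; at [x = 1] the argument of the logarithm is [2 / pi]. *)
Lemma is_J_cot_defect :
  is_RInt_gen (fun x => cos (PI / 2 * x) / sin (PI / 2 * x) - / (PI / 2 * x))
    (at_right 0) (at_left 1) (2 / PI * ln (2 / PI)).
Proof.
  generalize PI_RGT_0; intros Hpi.
  assert (Hlim : forall a, 0 < sinc (PI / 2 * a) ->
     continuous (fun x => 2 / PI * ln (sinc (PI / 2 * x))) a).
  { intros a Ha. apply (continuous_scal_r (2 / PI) (fun x => ln (sinc (PI / 2 * x)))).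
    apply (continuous_comp (fun x => sinc (PI / 2 * x)) ln).
    - apply (continuous_comp (fun x => PI / 2 * x) sinc); [| apply continuous_sinc].
      apply ex_derive_continuous_R. auto_derive. auto.
    - apply ex_derive_continuous_R. auto_derive. auto. }
  assert (E0 : sinc (PI / 2 * 0) = 1) by (rewrite Rmult_0_r; apply sinc_0).
  assert (E1 : sinc (PI / 2 * 1) = 2 / PI).
  { rewrite Rmult_1_r, sinc_neq by lra. rewrite sin_PI2. field. lra. }
  replace (2 / PI * ln (2 / PI))
    with (2 / PI * ln (sinc (PI / 2 * 1)) - 2 / PI * ln (sinc (PI / 2 * 0)))
    by (rewrite E0, E1, ln_1; ring).
  apply (is_J_primitive _ (fun x => 2 / PI * ln (sinc (PI / 2 * x)))).
  - intros x Hx. destruct (half_angle_bounds x Hx) as [Hy Hs].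
    apply (is_derive_ext_loc (fun x => 2 / PI * ln (sin (PI / 2 * x) / (PI / 2 * x)))).
    + exists (mkposreal x (proj1 Hx)). intros y Hy'.
      change (Rabs (y - x) < x) in Hy'. apply Rabs_def2 in Hy'.
      rewrite sinc_neq; [reflexivity | nra].
    + auto_derive.
      * repeat split; [nra |]. apply Rdiv_lt_0_compat; lra.
      * field. repeat split; try lra; nra.
  - intros x Hx. destruct (half_angle_bounds x Hx) as [Hy Hs].
    apply ex_derive_continuous_R. auto_derive. repeat split; lra.
  - apply (continuous_filterlim_at_right (fun x => 2 / PI * ln (sinc (PI / 2 * x)))).
    apply Hlim. rewrite E0. lra.
  - apply (continuous_filterlim_at_left (fun x => 2 / PI * ln (sinc (PI / 2 * x)))).
    apply Hlim. rewrite E1. apply Rdiv_lt_0_compat; lra.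
Qed.

(** With [c = half_freq N] and [y = pi x / 2], the conjugate kernel is [(1 - cos(c x)) / y], plus
    [cot y - 1 / y], minus [csc_defect x * cos(c x)]. The left side is the same kernel integrated
    term by term. *)
Lemma Cin_half_freq (N : nat) :
  psum (fun k => 2 * (1 - cos (PI * INR (S k))) / (PI * INR (S k))) N
  = 2 / PI * Cin (half_freq N) + 2 / PI * ln (2 / PI) - J (fun x => csc_defect x * half_cosine N x).
Proof.
  generalize PI_RGT_0, (half_freq_pos N); intros Hpi Hc.
  set (c := half_freq N) in *.
  assert (H1 := is_J_scaled cosc (2 / PI) c continuous_cosc). fold (Cin c) in H1.
  assert (H2 := tame_is_RInt_gen _ (root_tame_mult _ _ root_tame_csc_defect (root_tame_half_cosine N))).
  assert (H3 := is_RInt_gen_minus _ _ _ _ (is_RInt_gen_plus _ _ _ _ H1 is_J_cot_defect) H2).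
  assert (Hw : forall k, root_tame (fun x => 2 * sin (2 * INR (S k) * (PI / 2 * x))))
    by (intros; apply root_tame_scal, root_tame_half_sin).
  transitivity (J (fun x => psum (fun k => 2 * sin (2 * INR (S k) * (PI / 2 * x))) N)).
  - rewrite (J_psum (fun k x => 2 * sin (2 * INR (S k) * (PI / 2 * x)))) by exact Hw.
    apply psum_ext. intros k _. generalize (lt_0_INR (S k) ltac:(lia)); intros Hk.
    rewrite J_scal by apply root_tame_tame, root_tame_half_sin.
    rewrite (J_ext _ (fun x => sin (PI * INR (S k) * x + 0))).
    + rewrite J_sin_lin by nra. rewrite cos_0, Rplus_0_r. field. lra.
    + apply root_tame_tame, root_tame_half_sin.
    + intros x _. f_equal. field.
  - apply J_unique. revert H3. apply is_J_ext. intros x Hx.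
    destruct (half_angle_bounds x Hx) as [Hy Hs].
    change (2 / PI * (c * cosc (c * x)) + (cos (PI / 2 * x) / sin (PI / 2 * x) - / (PI / 2 * x))
       - csc_defect x * half_cosine N x = psum (fun k => 2 * sin (2 * INR (S k) * (PI / 2 * x))) N).
    apply (Rmult_eq_reg_l (sin (PI / 2 * x))); [| lra].
    rewrite <- conjugate_dirichlet_kernel, cosc_neq by nra.
    unfold csc_defect, half_cosine.
    replace ((2 * INR N + 1) * (PI / 2 * x)) with (c * x) by (unfold c, half_freq; ring).
    replace ((2 * INR N + 1) * (PI / 2) * x) with (c * x) by (unfold c, half_freq; ring).
    field. repeat split; lra.
Qed.

(** Only odd indices survive, each contributing [4 / (pi k)], and the odd reciprocals up to [2M] sum
    to [H_{2M} - H_M / 2]. *)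
Lemma psum_odd_harmonic (M : nat) :
  psum (fun k => 2 * (1 - cos (PI * INR (S k))) / (PI * INR (S k))) (2 * M)
  = 2 / PI * (2 * harmonic (2 * M) - harmonic M).
Proof.
  generalize PI_RGT_0; intros Hpi.
  induction M as [|M IH]; [unfold harmonic; simpl; ring |].
  replace (2 * S M)%nat with (S (S (2 * M))) by lia.
  unfold harmonic in *. rewrite !psum_S. rewrite IH.
  assert (E1 : cos (PI * INR (S (2 * M))) = -1).
  { rewrite S_INR, mult_INR.
    replace (PI * (INR 2 * INR M + 1)) with (2 * PI * IZR (Z.of_nat M) + PI)
      by (rewrite <- INR_IZR_INZ; simpl; ring).
    rewrite cos_plus_2PI_IZR. apply cos_PI. }
  assert (E2 : cos (PI * INR (S (S (2 * M)))) = 1).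
  { replace (S (S (2 * M))) with (2 * S M)%nat by lia. rewrite mult_INR.
    replace (PI * (INR 2 * INR (S M))) with (2 * PI * INR (S M)) by (simpl; ring).
    apply cos_2PI_INR. }
  rewrite E1, E2.
  replace (S (S (2 * M))) with (2 * S M)%nat by lia.
  rewrite mult_INR.
  generalize (lt_0_INR (S (2 * M)) ltac:(lia)), (lt_0_INR (S M) ltac:(lia)); intros.
  replace (INR 2) with 2 by (simpl; ring). field. repeat split; lra.
Qed.

Lemma RInt_0_diff (f : R -> R) (a b : R) :
  (forall t, continuous f t) -> RInt f 0 b - RInt f 0 a = RInt f a b.
Proof.
  intros Hf.
  assert (Hex : forall u v, ex_RInt f u v) by (intros; apply (ex_RInt_continuous f); auto).
  rewrite <- (RInt_Chasles f 0 a b) by auto.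
  assert (E : forall u v : R, u + v - u = v) by (intros; ring). apply E.
Qed.

(** [half_freq (2M)] exceeds [2 pi M] by only a quarter period, on which the integrand is
    [O(1/M)]. *)
Lemma RInt_quarter_period_bound (f : R -> R) (M : nat) :
  (forall t, continuous f t) -> (forall t, 0 < t -> Rabs (f t) <= 2 / t) -> (1 <= M)%nat ->
  Rabs (RInt f 0 (half_freq (2 * M)) - RInt f 0 (2 * PI * INR M)) <= / INR M.
Proof.
  intros Hf Hb HM. rewrite RInt_0_diff by auto.
  generalize PI_RGT_0 (lt_0_INR M ltac:(lia)); intros Hpi HM0.
  assert (E : half_freq (2 * M) = 2 * PI * INR M + PI / 2)
    by (unfold half_freq; rewrite mult_INR; simpl; field).
  rewrite E.
  assert (H0 : 0 < 2 * PI * INR M) by nra.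
  eapply Rle_trans.
  - apply (abs_RInt_le_const f _ _ (2 / (2 * PI * INR M))); [lra | |].
    + apply (ex_RInt_continuous f). auto.
    + intros t Ht. eapply Rle_trans; [apply Hb; lra |].
      apply Rmult_le_compat_l; [lra |]. apply Rinv_le_contravar; lra.
  - replace ((2 * PI * INR M + PI / 2 - 2 * PI * INR M) * (2 / (2 * PI * INR M)))
      with (/ 2 * / INR M) by (field; lra).
    assert (0 < / INR M) by (apply Rinv_0_lt_compat; auto). lra.
Qed.

Lemma is_lim_seq_inv_INR : is_lim_seq (fun n => / INR n) 0.
Proof.
  replace (Finite 0) with (Rbar_inv p_infty) by reflexivity.
  apply is_lim_seq_inv; [apply is_lim_seq_INR | discriminate].
Qed.

Lemma is_lim_seq_rate (u : nat -> R) (l C : R) :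
  (forall n, (1 <= n)%nat -> Rabs (u n - l) <= C * / INR n) -> is_lim_seq u l.
Proof.
  intros H. apply (is_lim_seq_ext (fun n => l + (u n - l))); [intros; ring |].
  replace (Finite l) with (Finite (l + 0)) by (f_equal; ring).
  apply is_lim_seq_plus'; [apply is_lim_seq_const |].
  apply is_lim_seq_abs_0.
  apply (is_lim_seq_le_le_loc (fun _ => 0) _ (fun n => C * / INR n)).
  - exists 1%nat. intros n Hn. split; [apply Rabs_pos | auto].
  - apply is_lim_seq_const.
  - replace (Finite 0) with (Finite (C * 0)) by (f_equal; ring).
    apply (is_lim_seq_scal_l _ C 0), is_lim_seq_inv_INR.
Qed.

Lemma is_lim_seq_close (u v : nat -> R) (l : R) :
  is_lim_seq u l -> (forall n, (1 <= n)%nat -> Rabs (u n - v n) <= / INR n) -> is_lim_seq v l.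
Proof.
  intros Hu Huv.
  apply (is_lim_seq_ext (fun n => u n - (u n - v n))); [intros; ring |].
  replace (Finite l) with (Finite (l - 0)) by (f_equal; ring).
  apply is_lim_seq_minus'; [exact Hu |].
  apply (is_lim_seq_rate _ _ 1). intros n Hn. rewrite Rminus_0_r, Rmult_1_l. auto.
Qed.

Lemma is_lim_seq_double (u : nat -> R) (l : R) :
  is_lim_seq u l -> is_lim_seq (fun n => u (2 * n)%nat) l.
Proof.
  intros H. apply (is_lim_seq_subseq u l (fun n => (2 * n)%nat)); [| exact H].
  apply eventually_subseq. intros; lia.
Qed.

Lemma is_lim_seq_Si : is_lim_seq (fun M => Si (2 * PI * INR M)) (PI / 2).
Proof.
  generalize PI_RGT_0; intros Hpi.
  apply (is_lim_seq_close (fun M => Si (half_freq (2 * M)))).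
  - apply (is_lim_seq_double (fun M => Si (half_freq M))).
    apply (is_lim_seq_ext (fun N => PI / 2 - PI / 2 * J (fun x => csc_defect x * half_sine N x)));
      [intros; now rewrite Si_half_freq |].
    replace (Finite (PI / 2)) with (Finite (PI / 2 - PI / 2 * 0)) by (f_equal; ring).
    apply is_lim_seq_minus'; [apply is_lim_seq_const |].
    apply (is_lim_seq_scal_l _ (PI / 2) 0).
    apply riemann_lebesgue_eqb.
    + apply root_tame_csc_defect.
    + apply root_tame_half_sine.
    + apply J_half_sine_product.
  - intros n Hn. apply RInt_quarter_period_bound; auto; [apply continuous_sinc |].
    intros t Ht. rewrite sinc_neq by lra. unfold Rdiv.
    rewrite Rabs_mult, (Rabs_right (/ t)) by (apply Rle_ge, Rlt_le, Rinv_0_lt_compat, Ht).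
    apply Rmult_le_compat_r; [apply Rlt_le, Rinv_0_lt_compat, Ht |].
    generalize (Rabs_sin_le t); lra.
Qed.

Lemma is_lim_seq_Cin :
  is_lim_seq (fun M => Cin (2 * PI * INR M) - ln (2 * PI * INR M)) Euler_gamma.
Proof.
  generalize PI_RGT_0; intros Hpi.
  apply (is_lim_seq_close (fun M => Cin (half_freq (2 * M)) - ln (2 * PI * INR M))).
  - pose (g := fun n => harmonic n - ln (INR n)).
    pose (e := fun N => J (fun x => csc_defect x * half_cosine N x)).
    (* The combination subtracts [2 ln(2M) - ln M = ln(4M)], which is also [ln(2/pi) + ln(2 pi M)];
       the two logarithms of [pi] cancel and one [gamma] remains. *)
    apply (is_lim_seq_ext_loc (fun M => (2 * g (2 * M)%nat - g M) + PI / 2 * e (2 * M)%nat)).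
    + exists 1%nat. intros M HM. generalize (lt_0_INR M ltac:(lia)); intros HM0.
      generalize (Cin_half_freq (2 * M)). rewrite psum_odd_harmonic. fold (e (2 * M)%nat). intros H.
      assert (H' : 2 * harmonic (2 * M) - harmonic M
                   = Cin (half_freq (2 * M)) + ln (2 / PI) - PI / 2 * e (2 * M)%nat).
      { apply (Rmult_eq_reg_l (2 / PI)); [rewrite H; field; lra |].
        apply Rgt_not_eq, Rdiv_lt_0_compat; lra. }
      rewrite ln_div in H' by lra.
      unfold g. rewrite mult_INR, !ln_mult by (try nra; simpl; nra).
      replace (INR 2) with 2 by (simpl; ring). lra.
    + replace (Finite Euler_gamma) with (Finite ((2 * Euler_gamma - Euler_gamma) + PI / 2 * 0))
        by (f_equal; ring).
      apply is_lim_seq_plus'; [apply is_lim_seq_minus' |].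
      * apply (is_lim_seq_scal_l _ 2 Euler_gamma).
        apply (is_lim_seq_double g), is_lim_seq_harmonic_ln.
      * apply is_lim_seq_harmonic_ln.
      * apply (is_lim_seq_scal_l _ (PI / 2) 0). apply (is_lim_seq_double e).
        apply riemann_lebesgue_eqb.
        -- apply root_tame_csc_defect.
        -- apply root_tame_half_cosine.
        -- apply J_half_cosine_product.
  - intros n Hn.
    replace (Cin (half_freq (2 * n)) - ln (2 * PI * INR n) - (Cin (2 * PI * INR n) - ln (2 * PI * INR n)))
      with (Cin (half_freq (2 * n)) - Cin (2 * PI * INR n)) by ring.
    apply RInt_quarter_period_bound; auto; [apply continuous_cosc |].
    intros t Ht. rewrite cosc_neq by lra. unfold Rdiv.
    rewrite Rabs_mult, (Rabs_right (/ t)) by (apply Rle_ge, Rlt_le, Rinv_0_lt_compat, Ht).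
    apply Rmult_le_compat_r; [apply Rlt_le, Rinv_0_lt_compat, Ht |].
    generalize (COS_bound t). intros. rewrite Rabs_right; lra.
Qed.

(** * The gamma function *)

Definition gamma_integrand (x t : R) : R := Rpower t (x - 1) * exp (- t).

Definition is_half_line_integral (F : R -> R) (l : R) : Prop :=
  is_RInt_gen F (at_right 0) (Rbar_locally p_infty) l.

Lemma half_line_convex (u v w : R) : 0 < u -> 0 < w -> u <= v <= w -> 0 < v.
Proof. lra. Qed.

Lemma at_right_0_pos : at_right 0 (fun x => 0 < x).
Proof. exists (mkposreal 1 Rlt_0_1). intros y _ H. exact H. Qed.

Lemma at_infty_pos : Rbar_locally p_infty (fun x => 0 < x).
Proof. exists 0. auto. Qed.

Lemma filter_prod_half_line_le :
  filter_prod (at_right 0) (Rbar_locally p_infty) (fun ab => fst ab <= snd ab).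
Proof.
  apply (Filter_prod _ _ _ (fun x => 0 < x < 1) (fun x => 1 < x) at_right_0_in).
  - exists 1. auto.
  - simpl; intros; lra.
Qed.

Lemma continuous_gamma_integrand (x t : R) : 0 < t -> continuous (gamma_integrand x) t.
Proof.
  intros Ht. apply ex_derive_continuous_R. unfold gamma_integrand, Rpower. auto_derive. auto.
Qed.

Lemma filterlim_Rpower_0 (x : R) : 0 < x ->
  filterlim (fun t => Rpower t x) (at_right 0) (locally 0).
Proof.
  intros Hx. unfold Rpower.
  apply (filterlim_comp _ _ _ (fun t => x * ln t) exp _ (Rbar_locally m_infty)).
  - eapply filterlim_comp; [apply is_lim_ln_0 |].
    generalize (filterlim_Rbar_mult_l x m_infty). simpl.
    destruct (Rle_dec 0 x) as [H|H]; [| lra].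
    destruct (Rle_lt_or_eq_dec 0 x H); [auto | lra].
  - exact is_lim_exp_m.
Qed.

Lemma filterlim_inv_infty : filterlim Rinv (Rbar_locally p_infty) (locally 0).
Proof.
  apply (filterlim_Rbar_inv p_infty). discriminate.
Qed.

Lemma ln_le_scaled (a y : R) : 0 < a -> 0 < y -> ln y <= y / a - 1 + ln a.
Proof.
  intros Ha Hy. assert (0 < y / a) by (apply Rdiv_lt_0_compat; auto).
  generalize (ln_le_minus_1 (y / a) ltac:(auto)). rewrite ln_div by auto. lra.
Qed.

Lemma ex_gamma_integral (x : R) : 0 < x ->
  ex_RInt_gen (gamma_integrand x) (at_right 0) (Rbar_locally p_infty).
Proof.
  intros Hx.
  (* [C * x] is the maximum of [exp(-t) (1 + t)^(x+1)], attained at [t = x]. Hence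
     [C x t^(x-1) (1 + t)^(-x-1)] is a majorant on the whole half-line, with no splitting at 1. *)
  pose (C := exp ((x + 1) * ln (x + 1) - x) / x).
  (* [P] is [C (t / (1 + t))^x], which increases from [0] to [C]. *)
  pose (P := fun t => C * exp (x * (ln t - ln (1 + t)))).
  assert (HC : 0 < C) by (apply Rdiv_lt_0_compat; [apply exp_pos | auto]).
  apply (ex_RInt_gen_dominated _ _ (fun t => 0 < t) _
           (fun t => C * (x * (/ t - / (1 + t)) * exp (x * (ln t - ln (1 + t))))) P 0 C).
  - exact half_line_convex.
  - exact at_right_0_pos.
  - exact at_infty_pos.
  - intros t Ht. apply continuous_gamma_integrand, Ht.
  - intros t Ht. apply ex_derive_continuous_R. auto_derive. repeat split; lra.
  - intros t Ht. unfold P. auto_derive; [repeat split; lra |]. unfold Rminus. field. lra.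
  - intros t Ht. unfold gamma_integrand.
    rewrite Rabs_right by (apply Rle_ge, Rlt_le, Rmult_lt_0_compat; apply exp_pos).
    unfold Rpower. rewrite <- exp_plus.
    replace (/ t - / (1 + t)) with (exp (- ln t - ln (1 + t))).
    2:{ replace (- ln t - ln (1 + t)) with (- ln t + - ln (1 + t)) by ring.
      rewrite exp_plus, !exp_Ropp, !exp_ln by lra. field. lra. }
    replace (C * (x * exp (- ln t - ln (1 + t)) * exp (x * (ln t - ln (1 + t)))))
      with (exp ((x + 1) * ln (x + 1) - x + (- ln t - ln (1 + t)) + x * (ln t - ln (1 + t))))
      by (rewrite !exp_plus; unfold C; field; lra).
    assert (H : (x - 1) * ln t + - t
      <= (x + 1) * ln (x + 1) - x + (- ln t - ln (1 + t)) + x * (ln t - ln (1 + t))).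
    { generalize (ln_le_scaled (x + 1) (1 + t) ltac:(lra) ltac:(lra)). intros H.
      apply (Rmult_le_compat_l (x + 1)) in H; [| lra].
      replace ((x + 1) * ((1 + t) / (x + 1) - 1 + ln (x + 1)))
        with (1 + t - (x + 1) + (x + 1) * ln (x + 1)) in H by (field; lra). nra. }
    destruct H as [H|H]; [left; apply exp_increasing, H | right; f_equal; exact H].
  - unfold P.
    apply (filterlim_ext_loc (fun t => Rpower t x * (C * exp (- x * ln (1 + t))))).
    + apply (filter_imp (fun t => 0 < t)); [| exact at_right_0_pos].
      intros t Ht. unfold Rpower.
      replace (x * (ln t - ln (1 + t))) with (x * ln t + - x * ln (1 + t)) by ring.
      rewrite exp_plus. ring.
    + replace 0 with (0 * (C * exp (- x * ln (1 + 0)))) at 2 by ring.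
      refine (filterlim_comp_2 _ _ mult (filterlim_Rpower_0 x Hx) _
                (filterlim_mult (K := R_AbsRing) 0 (C * exp (- x * ln (1 + 0))))).
      apply (continuous_filterlim_at_right (fun t => C * exp (- x * ln (1 + t)))).
      apply ex_derive_continuous_R. auto_derive. lra.
  - unfold P.
    apply (filterlim_ext_loc (fun t => C * exp (- x * ln (1 + / t)))).
    + apply (filter_imp (fun t => 0 < t)); [| exact at_infty_pos].
      intros t Ht. do 2 f_equal.
      replace (1 + / t) with ((1 + t) / t) by (field; lra). rewrite ln_div by lra. ring.
    + assert (E : C * exp (- x * ln (1 + 0)) = C)
        by (rewrite Rplus_0_r, ln_1, Rmult_0_r, exp_0; ring).
      enough (H : filterlim (fun t => C * exp (- x * ln (1 + / t))) (Rbar_locally p_infty)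
                    (locally (C * exp (- x * ln (1 + 0))))) by (rewrite E in H; exact H).
      eapply (filterlim_comp _ _ _ Rinv (fun u => C * exp (- x * ln (1 + u)))).
      * apply filterlim_inv_infty.
      * apply (ex_derive_continuous_R (fun u => C * exp (- x * ln (1 + u)))).
        auto_derive. lra.
Qed.

Lemma Gamma_correct (x : R) : 0 < x -> is_half_line_integral (gamma_integrand x) (Gamma x).
Proof.
  intros Hx. apply (RInt_gen_correct (V := R_CompleteNormedModule)), ex_gamma_integral, Hx.
Qed.

Lemma half_line_integral_unique (F : R -> R) (l l' : R) :
  is_half_line_integral F l -> is_half_line_integral F l' -> l = l'.
Proof.
  intros H H'. rewrite <- (is_RInt_gen_unique (V := R_CompleteNormedModule) _ _ H).
  apply (is_RInt_gen_unique (V := R_CompleteNormedModule) _ _ H').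
Qed.

Lemma half_line_integral_ext (F G : R -> R) (l : R) :
  (forall t, 0 < t -> F t = G t) -> is_half_line_integral F l -> is_half_line_integral G l.
Proof.
  intros H. apply is_RInt_gen_ext.
  apply (Filter_prod _ _ _ _ _ at_right_0_pos at_infty_pos). simpl. intros x y Hx Hy z Hz.
  apply H. revert Hz. unfold Rmin, Rmax. destruct (Rle_dec x y); lra.
Qed.

Lemma half_line_integral_le (F G : R -> R) (l l' : R) :
  is_half_line_integral F l -> is_half_line_integral G l' ->
  (forall t, 0 < t -> F t <= G t) -> l <= l'.
Proof.
  intros HF HG H. enough (0 <= l' - l) by lra.
  apply (is_RInt_gen_nonneg (at_right 0) (Rbar_locally p_infty) (fun x => 0 < x)
           (fun t => G t - F t)).
  - exact filter_prod_half_line_le.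
  - exact half_line_convex.
  - exact at_right_0_pos.
  - exact at_infty_pos.
  - intros t Ht. generalize (H t Ht); lra.
  - exact (is_RInt_gen_minus _ _ _ _ HG HF).
Qed.

Lemma half_line_integral_lincomb (F G : R -> R) (a b l l' : R) :
  is_half_line_integral F l -> is_half_line_integral G l' ->
  is_half_line_integral (fun t => a * F t + b * G t) (a * l + b * l').
Proof.
  intros HF HG.
  exact (is_RInt_gen_plus _ _ _ _ (is_RInt_gen_scal _ a _ HF) (is_RInt_gen_scal _ b _ HG)).
Qed.

Lemma filterlim_exp_neg_infty (c : R) : 0 < c ->
  filterlim (fun t => exp (- (c * t))) (Rbar_locally p_infty) (locally 0).
Proof.
  intros Hc. apply (filterlim_comp _ _ _ (fun t => - (c * t)) exp _ (Rbar_locally m_infty)).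
  - intros Q [M HM]. exists (- M / c). intros t Ht. apply HM.
    assert (- M < c * t).
    { apply (Rmult_lt_compat_l c) in Ht; [| auto]. replace (c * (- M / c)) with (- M) in Ht by (field; lra). lra. }
    lra.
  - exact is_lim_exp_m.
Qed.

Lemma filterlim_Rpower_exp_infty (x : R) : 0 < x ->
  filterlim (fun t => Rpower t x * exp (- t)) (Rbar_locally p_infty) (locally 0).
Proof.
  intros Hx.
  assert (Hle : forall t, 0 < t ->
    0 <= Rpower t x * exp (- t) <= exp (x * ln (2 * x)) * exp (- (1 / 2 * t))).
  { intros t Ht. unfold Rpower. rewrite <- !exp_plus. split; [left; apply exp_pos |].
    assert (H : x * ln t + - t <= x * ln (2 * x) + - (1 / 2 * t)).
    { generalize (ln_le_scaled (2 * x) t ltac:(lra) Ht). intros H.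
      apply (Rmult_le_compat_l x) in H; [| lra].
      replace (x * (t / (2 * x) - 1 + ln (2 * x))) with (1 / 2 * t - x + x * ln (2 * x)) in H
        by (field; lra). lra. }
    destruct H as [H|H]; [left; apply exp_increasing, H | right; f_equal; exact H]. }
  apply (filterlim_le_le (F := Rbar_locally p_infty) (fun _ => 0) _ (fun t => exp (x * ln (2 * x)) * exp (- (1 / 2 * t))) 0).
  - apply (filter_imp (fun t => 0 < t)); [exact Hle | exact at_infty_pos].
  - apply filterlim_const.
  - enough (H : filterlim (fun t => exp (x * ln (2 * x)) * exp (- (1 / 2 * t)))
                  (Rbar_locally p_infty) (locally (exp (x * ln (2 * x)) * 0)))
      by (rewrite Rmult_0_r in H; exact H).
    eapply filterlim_comp; [apply (filterlim_exp_neg_infty (1 / 2)); lra |].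
    apply (filterlim_scal_r (V := R_NormedModule) (exp (x * ln (2 * x))) 0).
Qed.

Lemma Gamma_plus_1 (x : R) : 0 < x -> Gamma (x + 1) = x * Gamma x.
Proof.
  intros Hx.
  assert (H : is_half_line_integral
    (fun t => 1 * gamma_integrand (x + 1) t + - x * gamma_integrand x t) (- 0 - - 0)).
  { apply (is_RInt_gen_primitive _ _ (fun t => 0 < t) _ (fun t => - (Rpower t x * exp (- t)))).
    - exact half_line_convex.
    - exact at_right_0_pos.
    - exact at_infty_pos.
    - intros t Ht. unfold gamma_integrand.
      replace (x + 1 - 1) with x by ring.
      replace (Rpower t (x - 1)) with (Rpower t x / t)
        by (unfold Rminus; rewrite Rpower_plus, Rpower_Ropp, Rpower_1 by auto; reflexivity).
      unfold Rpower. auto_derive; [auto |]. field. lra.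
    - intros t Ht. apply (continuous_plus (fun t => 1 * gamma_integrand (x + 1) t) (fun t => - x * gamma_integrand x t)).
      + apply (continuous_scal_r 1 (gamma_integrand (x + 1))), continuous_gamma_integrand, Ht.
      + apply (continuous_scal_r (- x) (gamma_integrand x)), continuous_gamma_integrand, Ht.
    - eapply filterlim_comp; [| apply (filterlim_opp (V := R_NormedModule))].
      replace 0 with (0 * exp (- 0)) at 2 by ring.
      refine (filterlim_comp_2 _ _ mult (filterlim_Rpower_0 x Hx) _ (filterlim_mult (K := R_AbsRing) 0 (exp (- 0)))).
      apply (continuous_filterlim_at_right (fun t => exp (- t))), ex_derive_continuous_R.
      auto_derive. auto.
    - eapply filterlim_comp; [| apply (filterlim_opp (V := R_NormedModule))].
      apply filterlim_Rpower_exp_infty, Hx. }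
  assert (H' := half_line_integral_lincomb _ _ 1 (- x) _ _ (Gamma_correct (x + 1) ltac:(lra)) (Gamma_correct x Hx)).
  generalize (half_line_integral_unique _ _ _ H H'). lra.
Qed.

Lemma Gamma_1 : Gamma 1 = 1.
Proof.
  apply (half_line_integral_unique (gamma_integrand 1)); [apply Gamma_correct; lra |].
  apply (half_line_integral_ext (fun t => exp (- t))).
  - intros t Ht. unfold gamma_integrand. replace (1 - 1) with 0 by ring.
    rewrite Rpower_O by auto. ring.
  - replace 1 with (- 0 - - exp (- 0)) by (rewrite Ropp_0, exp_0; ring).
    apply (is_RInt_gen_primitive _ _ (fun t => 0 < t) _ (fun t => - exp (- t))).
    + exact half_line_convex.
    + exact at_right_0_pos.
    + exact at_infty_pos.
    + intros t Ht. auto_derive; [auto | ring].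
    + intros t Ht. apply ex_derive_continuous_R. auto_derive. auto.
    + apply (continuous_filterlim_at_right (fun t => - exp (- t))), ex_derive_continuous_R.
      auto_derive. auto.
    + eapply filterlim_comp; [| apply (filterlim_opp (V := R_NormedModule))].
      apply (filterlim_ext (fun t => exp (- (1 * t)))); [intros; do 2 f_equal; ring |].
      apply filterlim_exp_neg_infty. lra.
Qed.

Lemma Gamma_fact (n : nat) : Gamma (INR n + 1) = INR (Factorial.fact n).
Proof.
  induction n as [|n IH].
  - simpl. rewrite Rplus_0_l. apply Gamma_1.
  - rewrite S_INR, Gamma_plus_1, IH by (generalize (pos_INR n); lra).
    rewrite fact_simpl, mult_INR, S_INR. reflexivity.
Qed.

(** Weighted AM-GM for [u] and 1 with mean [A]: the bound [ln z <= z - 1] is applied to [u / A] with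
    weight [x] and to [1 / A] with weight [1 - x], and the two right sides cancel. *)
Lemma Rpower_le_tangent (x u : R) : 0 <= x <= 1 -> 0 < u -> Rpower u x <= 1 + x * (u - 1).
Proof.
  intros Hx Hu. set (A := 1 + x * (u - 1)).
  assert (HA : 0 < A) by (unfold A; nra).
  rewrite <- (exp_ln A) by auto. unfold Rpower.
  assert (H : x * ln u <= ln A).
  { assert (0 < u / A) by (apply Rdiv_lt_0_compat; auto).
    assert (0 < / A) by (apply Rinv_0_lt_compat; auto).
    generalize (ln_le_minus_1 (u / A) ltac:(auto)), (ln_le_minus_1 (/ A) ltac:(auto)).
    rewrite ln_div, ln_Rinv by auto. intros H1 H2.
    assert (E : x * (u / A - 1) + (1 - x) * (/ A - 1) = 0) by (unfold A; field; fold A; lra).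
    nra. }
  destruct H as [H|H]; [left; apply exp_increasing, H | right; f_equal; exact H].
Qed.

Lemma Rpower_ge_tangent (x u : R) : x <= 0 -> 0 < u -> 1 + x * (u - 1) <= Rpower u x.
Proof.
  intros Hx Hu. unfold Rpower. generalize (exp_ineq1_le (x * ln u)), (ln_le_minus_1 u Hu). nra.
Qed.

Lemma gamma_integrand_plus (y x t : R) : gamma_integrand (y + x) t = Rpower t x * gamma_integrand y t.
Proof.
  unfold gamma_integrand. replace (y + x - 1) with (x + (y - 1)) by ring.
  rewrite Rpower_plus. ring.
Qed.

Lemma gamma_integrand_pos (x t : R) : 0 < gamma_integrand x t.
Proof. apply Rmult_lt_0_compat; apply exp_pos. Qed.

Lemma Rpower_scale (c t x : R) : 0 < c -> 0 < t -> Rpower t x = Rpower c x * Rpower (t / c) x.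
Proof.
  intros Hc Ht. unfold Rpower. rewrite <- exp_plus, ln_div by auto. f_equal. ring.
Qed.

(** Jensen's inequality for the gamma density with parameter [y]: its mean is [y], so after bounding
    [t^x] by its tangent at [t = y] the linear term integrates to 0. *)
Lemma Gamma_plus_le (y x : R) : 0 < y -> 0 <= x <= 1 -> Gamma (y + x) <= Rpower y x * Gamma y.
Proof.
  intros Hy Hx.
  apply (half_line_integral_le (gamma_integrand (y + x))
    (fun t => (Rpower y x * (1 - x)) * gamma_integrand y t + (Rpower y x * (x / y)) * gamma_integrand (y + 1) t)).
  - apply Gamma_correct. lra.
  - replace (Rpower y x * Gamma y)
      with ((Rpower y x * (1 - x)) * Gamma y + (Rpower y x * (x / y)) * Gamma (y + 1))
      by (rewrite Gamma_plus_1 by auto; field; lra).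
    apply half_line_integral_lincomb; apply Gamma_correct; lra.
  - intros t Ht. rewrite !gamma_integrand_plus, Rpower_1 by auto.
    replace (Rpower y x * (1 - x) * gamma_integrand y t + Rpower y x * (x / y) * (t * gamma_integrand y t))
      with (Rpower y x * (1 + x * (t / y - 1)) * gamma_integrand y t) by (field; lra).
    apply Rmult_le_compat_r; [left; apply gamma_integrand_pos |].
    rewrite (Rpower_scale y t x) by auto.
    apply Rmult_le_compat_l; [left; apply exp_pos |].
    apply Rpower_le_tangent; auto. apply Rdiv_lt_0_compat; auto.
Qed.

(** The exponent [x - 1] is at most 0, so the power is convex and lies above its tangent at [t = y];
    the linear term again integrates to 0. *)
Lemma Gamma_minus_ge (y x : R) : 1 - x < y -> 0 < x <= 1 ->
  Rpower y (x - 1) * Gamma y <= Gamma (y + (x - 1)).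
Proof.
  intros H Hx. assert (Hy : 0 < y) by lra.
  apply (half_line_integral_le
    (fun t => (Rpower y (x - 1) * (2 - x)) * gamma_integrand y t + (Rpower y (x - 1) * ((x - 1) / y)) * gamma_integrand (y + 1) t)
    (gamma_integrand (y + (x - 1)))).
  - replace (Rpower y (x - 1) * Gamma y)
      with ((Rpower y (x - 1) * (2 - x)) * Gamma y + (Rpower y (x - 1) * ((x - 1) / y)) * Gamma (y + 1))
      by (rewrite Gamma_plus_1 by auto; field; lra).
    apply half_line_integral_lincomb; apply Gamma_correct; lra.
  - apply Gamma_correct. lra.
  - intros t Ht. rewrite !gamma_integrand_plus, Rpower_1 by auto.
    replace (Rpower y (x - 1) * (2 - x) * gamma_integrand y t + Rpower y (x - 1) * ((x - 1) / y) * (t * gamma_integrand y t))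
      with (Rpower y (x - 1) * (1 + (x - 1) * (t / y - 1)) * gamma_integrand y t) by (field; lra).
    apply Rmult_le_compat_r; [left; apply gamma_integrand_pos |].
    rewrite (Rpower_scale y t (x - 1)) by auto.
    apply Rmult_le_compat_l; [left; apply exp_pos |].
    apply Rpower_ge_tangent; [lra |]. apply Rdiv_lt_0_compat; auto.
Qed.

(** Logarithm of Gauss's product [N! N^(x-1) / (x (x+1) ... (x+N-1))]. *)
Definition log_gauss (N : nat) (x : R) : R :=
  (x - 1) * ln (INR N) + ln (INR (Factorial.fact N)) - psum (fun k => ln (x + INR k)) N.

(** Positivity is read off the convexity bound at [y = 2], namely
    [Gamma (x + 1) >= 2^(x-1) * Gamma 2]. *)
Lemma Gamma_pos (x : R) : 0 < x <= 1 -> 0 < Gamma x.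
Proof.
  intros Hx. assert (H : 0 < Gamma (x + 1)).
  { generalize (Gamma_minus_ge 2 x ltac:(lra) Hx).
    replace (2 + (x - 1)) with (x + 1) by ring.
    replace 2 with (1 + 1) at 2 by ring. rewrite Gamma_plus_1, Gamma_1 by lra.
    intros. eapply Rlt_le_trans; [| eassumption].
    rewrite !Rmult_1_r. apply exp_pos. }
  rewrite Gamma_plus_1 in H by lra. nra.
Qed.

Lemma ln_Gamma_plus_INR (x : R) (N : nat) : 0 < x <= 1 ->
  0 < Gamma (x + INR N) /\ ln (Gamma (x + INR N)) = ln (Gamma x) + psum (fun k => ln (x + INR k)) N.
Proof.
  intros Hx. induction N as [|N [IH1 IH2]].
  - simpl. rewrite !Rplus_0_r. split; [apply Gamma_pos, Hx | reflexivity].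
  - rewrite psum_S, S_INR, <- Rplus_assoc.
    generalize (pos_INR N); intros HN.
    rewrite Gamma_plus_1 by lra. split; [apply Rmult_lt_0_compat; lra |].
    rewrite ln_mult by lra. rewrite IH2. ring.
Qed.

Lemma ln_Rpower (a x : R) : ln (Rpower a x) = x * ln a.
Proof. apply ln_exp. Qed.

(** [Gamma (x + N)] lies between [N! (N+1)^(x-1)], from the tangent at [N + 1], and [N! N^(x-1)],
    from the tangent at [N]. In logarithms the gap is [(1 - x) (ln(N+1) - ln N)]. *)
Lemma log_gauss_bounds (N : nat) (x : R) : (1 <= N)%nat -> 0 < x <= 1 ->
  0 <= log_gauss N x - ln (Gamma x) <= / INR N.
Proof.
  intros HN Hx. generalize (lt_0_INR N ltac:(lia)); intros HN0.
  destruct (ln_Gamma_plus_INR x N Hx) as [Hpos Hln].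
  assert (Hf : 0 < INR (Factorial.fact N)) by (apply INR_fact_lt_0).
  assert (Hup : ln (Gamma (x + INR N)) <= (x - 1) * ln (INR N) + ln (INR (Factorial.fact N))).
  { generalize (Gamma_plus_le (INR N) x HN0 ltac:(lra)). rewrite Rplus_comm. intros H.
    apply ln_le in H; [| exact Hpos].
    assert (E : Gamma (INR N) = INR (Factorial.fact N) / INR N).
    { rewrite <- Gamma_fact, Gamma_plus_1 by auto. field. lra. }
    rewrite E, ln_mult, ln_Rpower, ln_div in H by (try apply exp_pos; try apply Rdiv_lt_0_compat; auto).
    lra. }
  assert (Hlow : (x - 1) * ln (INR N + 1) + ln (INR (Factorial.fact N)) <= ln (Gamma (x + INR N))).
  { generalize (Gamma_minus_ge (INR N + 1) x ltac:(lra) Hx).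
    replace (INR N + 1 + (x - 1)) with (x + INR N) by ring. rewrite Gamma_fact. intros H.
    apply ln_le in H; [| apply Rmult_lt_0_compat; [apply exp_pos | exact Hf]].
    rewrite ln_mult, ln_Rpower in H by (auto; apply exp_pos). exact H. }
  generalize (ln_step_bounds (INR N) HN0); intros Hstep.
  assert (0 < / (INR N + 1)) by (apply Rinv_0_lt_compat; lra).
  unfold log_gauss. split; [lra |]. nra.
Qed.

(** * Stirling's formula from Wallis integrals *)

Lemma nonneg_derivative_nonneg (f df : R -> R) (u : R) :
  0 <= u -> (forall x, 0 <= x <= u -> is_derive f x (df x)) ->
  (forall x, 0 <= x <= u -> 0 <= df x) -> f 0 = 0 -> 0 <= f u.
Proof.
  intros Hu Hf Hd H0.
  destruct (MVT_gen f 0 u df) as [c [Hc E]].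
  - intros x Hx. rewrite Rmin_left, Rmax_right in Hx by lra. apply Hf; lra.
  - intros x Hx. rewrite Rmin_left, Rmax_right in Hx by lra.
    apply continuity_pt_filterlim. apply ex_derive_continuous_R. eexists. apply Hf; lra.
  - rewrite Rmin_left, Rmax_right in Hc by lra. generalize (Hd c Hc). nra.
Qed.

(** The midpoint and trapezoidal rules for the convex function [1/t] on [[1, 1 + u]]. *)
Lemma ln_1_plus_bounds (u : R) : 0 <= u -> 2 * u / (2 + u) <= ln (1 + u) <= (u + u / (1 + u)) / 2.
Proof.
  intros Hu. split.
  - enough (0 <= ln (1 + u) - 2 * u / (2 + u)) by lra.
    apply (nonneg_derivative_nonneg (fun u => ln (1 + u) - 2 * u / (2 + u))
             (fun u => u ^ 2 / ((1 + u) * (2 + u) ^ 2)) u Hu).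
    + intros x Hx. auto_derive; [repeat split; lra |]. field. lra.
    + intros x Hx. apply Rdiv_le_0_compat; [apply pow2_ge_0 |].
      apply Rmult_lt_0_compat; [lra | apply pow_lt; lra].
    + rewrite Rplus_0_r, ln_1. field.
  - enough (0 <= (u + u / (1 + u)) / 2 - ln (1 + u)) by lra.
    apply (nonneg_derivative_nonneg (fun u => (u + u / (1 + u)) / 2 - ln (1 + u))
             (fun u => (u / (1 + u)) ^ 2 / 2) u Hu).
    + intros x Hx. auto_derive; [repeat split; lra |]. field. lra.
    + intros x Hx. apply Rdiv_le_0_compat; [apply pow2_ge_0 | lra].
    + rewrite Rplus_0_r, ln_1. field.
Qed.

(** The integral of [ln] over [[x, x + 1]] minus its trapezoidal value. It returns as the
    first-order coefficient at [s = 0] of the Euler-Maclaurin terms. *)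
Definition stirling_defect (x : R) : R := (x + 1 / 2) * (ln (x + 1) - ln x) - 1.

(** The upper bound is a difference, so that it telescopes and limits the total decrease of
    [stirling_seq] to [1/4]. *)
Lemma stirling_defect_bounds (x : R) : 0 < x ->
  0 <= stirling_defect x <= / 4 * (/ x - / (x + 1)).
Proof.
  intros Hx. assert (Hi : 0 < / x) by (apply Rinv_0_lt_compat; auto).
  generalize (ln_1_plus_bounds (/ x) ltac:(lra)).
  replace (1 + / x) with ((x + 1) / x) by (field; lra). rewrite ln_div by lra.
  replace (2 * / x / (2 + / x)) with (/ (x + 1 / 2)) by (field; lra).
  replace ((/ x + / x / ((x + 1) / x)) / 2) with ((x + 1 / 2) * / (x * (x + 1))) by (field; lra).
  intros [H1 H2]. unfold stirling_defect.
  apply (Rmult_le_compat_l (x + 1 / 2)) in H1, H2; try lra.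
  rewrite Rinv_r in H1 by lra.
  replace ((x + 1 / 2) * ((x + 1 / 2) * / (x * (x + 1)))) with (1 + / 4 * (/ x - / (x + 1))) in H2
    by (field; lra).
  lra.
Qed.

Definition stirling_seq (N : nat) : R :=
  ln (INR (Factorial.fact N)) - (INR N + 1 / 2) * ln (INR N) + INR N.

Lemma stirling_seq_step (N : nat) : (1 <= N)%nat ->
  stirling_seq N - stirling_seq (S N) = stirling_defect (INR N).
Proof.
  intros HN. generalize (lt_0_INR N ltac:(lia)); intros HN0.
  unfold stirling_seq, stirling_defect. rewrite fact_simpl, mult_INR, S_INR.
  rewrite ln_mult by (try apply INR_fact_lt_0; lra). lra.
Qed.

Definition sine_moment (n : nat) : R := RInt (fun x => sin x ^ n) 0 (PI / 2).

Lemma ex_sine_moment (n : nat) : ex_RInt (fun x => sin x ^ n) 0 (PI / 2).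
Proof.
  apply (ex_RInt_continuous (fun x => sin x ^ n)). intros z _.
  apply ex_derive_continuous_R. auto_derive. auto.
Qed.

Lemma sine_moment_rec (n : nat) :
  INR (n + 2) * sine_moment (n + 2) = INR (n + 1) * sine_moment n.
Proof.
  assert (H : is_RInt (fun x => INR (n + 2) * sin x ^ (n + 2) - INR (n + 1) * sin x ^ n) 0 (PI / 2)
    (minus (- (cos (PI / 2) * sin (PI / 2) ^ (n + 1))) (- (cos 0 * sin 0 ^ (n + 1))))).
  { apply (is_RInt_derive (fun x => - (cos x * sin x ^ (n + 1)))).
    - intros x _. auto_derive; [auto |].
      replace (Init.Nat.pred (n + 1)) with n by lia.
      rewrite !plus_INR, !pow_add. simpl. generalize (sin2_cos2 x). unfold Rsqr. intros E.
      replace (cos x * (- (1))) with (- cos x) by ring.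
      assert (E' : cos x * cos x = 1 - sin x * sin x) by lra.
      ring_simplify. replace (cos x ^ 2) with (1 - sin x * sin x) by (rewrite <- E'; ring). ring.
    - intros x _. apply ex_derive_continuous_R. auto_derive. auto. }
  assert (H' : is_RInt (fun x => INR (n + 2) * sin x ^ (n + 2) - INR (n + 1) * sin x ^ n) 0 (PI / 2)
    (INR (n + 2) * sine_moment (n + 2) - INR (n + 1) * sine_moment n)).
  { apply (is_RInt_minus (fun x => INR (n + 2) * sin x ^ (n + 2)) (fun x => INR (n + 1) * sin x ^ n)).
    - apply (is_RInt_scal (fun x => sin x ^ (n + 2))). apply (RInt_correct (fun x => sin x ^ (n + 2))), ex_sine_moment.
    - apply (is_RInt_scal (fun x => sin x ^ n)). apply (RInt_correct (fun x => sin x ^ n)), ex_sine_moment. }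
  apply (is_RInt_unique (V := R_CompleteNormedModule)) in H. apply (is_RInt_unique (V := R_CompleteNormedModule)) in H'. rewrite H in H'.
  change (- (cos (PI / 2) * sin (PI / 2) ^ (n + 1)) - - (cos 0 * sin 0 ^ (n + 1))
    = INR (n + 2) * sine_moment (n + 2) - INR (n + 1) * sine_moment n) in H'.
  rewrite cos_PI2, sin_0, pow_i in H' by lia. lra.
Qed.

Lemma sine_moment_decr (n : nat) : sine_moment (S n) <= sine_moment n.
Proof.
  generalize PI_RGT_0; intros Hpi.
  apply RInt_le; [lra | apply ex_sine_moment | apply ex_sine_moment |].
  intros x Hx. assert (0 <= sin x) by (apply sin_ge_0; lra).
  assert (0 <= sin x ^ n) by (apply pow_le; auto).
  generalize (SIN_bound x). simpl. nra.
Qed.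

(** [4^N] divided by the central binomial coefficient. *)
Definition wallis (N : nat) : R :=
  INR (Factorial.fact N) ^ 2 * 4 ^ N / INR (Factorial.fact (2 * N)).

Lemma wallis_S (N : nat) : wallis (S N) = wallis N * ((2 * INR N + 2) / (2 * INR N + 1)).
Proof.
  unfold wallis. replace (2 * S N)%nat with (S (S (2 * N))) by lia.
  rewrite !fact_simpl, !mult_INR, !S_INR, mult_INR. simpl pow.
  replace (INR 2) with 2 by (simpl; ring).
  generalize (pos_INR N), (INR_fact_neq_0 (2 * N)). intros. field. split; lra.
Qed.

Lemma wallis_pos (N : nat) : 0 < wallis N.
Proof.
  apply Rdiv_lt_0_compat; [apply Rmult_lt_0_compat; apply pow_lt; [| lra] |];
    apply INR_fact_lt_0.
Qed.

Lemma sine_moment_wallis (N : nat) :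
  sine_moment (2 * N) = PI / 2 / wallis N /\ sine_moment (2 * N + 1) = wallis N / (2 * INR N + 1).
Proof.
  induction N as [|N [IH1 IH2]].
  - unfold sine_moment, wallis. simpl. split.
    + assert (E : is_RInt (fun _ : R => 1) 0 (PI / 2) (scal (PI / 2 - 0) 1)) by apply (is_RInt_const 0 (PI / 2) 1).
      apply (is_RInt_unique (V := R_CompleteNormedModule)) in E. rewrite E. change ((PI / 2 - 0) * 1 = PI / 2 / (1 * (1 * 1) * 1 / 1)). field.
    + assert (E : is_RInt (fun x => sin x * 1) 0 (PI / 2) (minus (- cos (PI / 2)) (- cos 0))).
      { apply (is_RInt_derive (fun x => - cos x)).
        - intros x _. auto_derive; [auto | ring].
        - intros x _. apply ex_derive_continuous_R. auto_derive. auto. }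
      apply (is_RInt_unique (V := R_CompleteNormedModule)) in E. rewrite E.
      change (- cos (PI / 2) - - cos 0 = 1 * (1 * 1) * 1 / 1 / (2 * 0 + 1)).
      rewrite cos_PI2, cos_0. field.
  - rewrite wallis_S, S_INR. generalize (wallis_pos N), (pos_INR N). intros Hw HN.
    replace (2 * S N)%nat with (2 * N + 2)%nat by lia.
    replace (2 * N + 2 + 1)%nat with (2 * N + 1 + 2)%nat by lia.
    generalize (sine_moment_rec (2 * N)), (sine_moment_rec (2 * N + 1)).
    rewrite IH1, IH2, !plus_INR, !mult_INR. replace (INR 2) with 2 by (simpl; ring).
    replace (INR 1) with 1 by reflexivity. intros E1 E2. split.
    + apply (Rmult_eq_reg_l (2 * INR N + 2)); [rewrite E1; field; lra | lra].
    + apply (Rmult_eq_reg_l (2 * INR N + 1 + 2)); [rewrite E2; field; lra | lra].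
Qed.

(** The moments of orders [2N - 1], [2N], [2N + 1] decrease, which puts [wallis N ^ 2] between
    [pi N] and [pi (N + 1/2)]; the upper bound is loosened to [pi (N + 1)]. *)
Lemma wallis_bounds (N : nat) : (1 <= N)%nat ->
  ln PI <= 2 * ln (wallis N) - ln (INR N) <= ln PI + / INR N.
Proof.
  intros HN. generalize (lt_0_INR N ltac:(lia)), (wallis_pos N), PI_RGT_0. intros HN0 Hw Hpi.
  destruct (sine_moment_wallis N) as [E0 E1].
  assert (Hup : PI * INR N <= wallis N ^ 2).
  { destruct N as [|M]; [lia |].
    destruct (sine_moment_wallis M) as [_ E2]. rewrite S_INR in *. generalize (pos_INR M); intros HM.
    assert (Hm : wallis M = wallis (S M) * ((2 * INR M + 1) / (2 * INR M + 2)))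
      by (rewrite wallis_S; field; lra).
    generalize (sine_moment_decr (2 * M + 1)).
    replace (S (2 * M + 1)) with (2 * S M)%nat by lia. rewrite E0, E2, Hm. intros H.
    apply (Rmult_le_compat_r (wallis (S M) * (2 * INR M + 2))) in H; [| nra].
    field_simplify in H; lra. }
  assert (Hlow : wallis N ^ 2 <= PI * INR N * (1 + / INR N)).
  { generalize (sine_moment_decr (2 * N)). replace (S (2 * N)) with (2 * N + 1)%nat by lia.
    rewrite E0, E1. intros H.
    apply (Rmult_le_compat_r (wallis N * (2 * INR N + 1))) in H; [| nra].
    replace (PI * INR N * (1 + / INR N)) with (PI * INR N + PI) by (field; lra).
    field_simplify in H; lra. }
  assert (Hi : 0 < / INR N) by (apply Rinv_0_lt_compat; auto).
  apply ln_le in Hup; [| nra]. apply ln_le in Hlow; [| apply pow_lt, Hw].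
  rewrite ln_pow in Hup, Hlow by auto. rewrite ln_mult in Hup, Hlow by nra.
  rewrite ln_mult in Hlow by lra.
  generalize (ln_le_minus_1 (1 + / INR N) ltac:(lra)). simpl INR in Hup, Hlow. lra.
Qed.

Lemma is_lim_seq_stirling : is_lim_seq stirling_seq (ln (2 * PI) / 2).
Proof.
  generalize PI_RGT_0; intros Hpi.
  assert (H : ex_finite_lim_seq (fun N => stirling_seq (S N))).
  { apply (ex_finite_lim_seq_decr _ (stirling_seq 1 - / 4)).
    - intros n. generalize (stirling_seq_step (S n) ltac:(lia)).
      generalize (stirling_defect_bounds (INR (S n)) (lt_0_INR (S n) ltac:(lia))). lra.
    - intros n. enough (stirling_seq 1 - / 4 * (1 - / INR (S n)) <= stirling_seq (S n)).
      { assert (0 < / INR (S n)) by (apply Rinv_0_lt_compat, lt_0_INR; lia). lra. }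
      induction n as [|n IH]; [simpl INR; rewrite Rinv_1; lra |].
      generalize (stirling_seq_step (S n) ltac:(lia)).
      generalize (stirling_defect_bounds (INR (S n)) (lt_0_INR (S n) ltac:(lia))).
      rewrite <- (S_INR (S n)). lra. }
  destruct H as [L HL]. apply (is_lim_seq_incr_1 stirling_seq) in HL.
  (* The limit [L] is identified as [2L - L]: in [2 * stirling_seq N - stirling_seq (2 * N)]
     everything cancels except [ln (wallis N) - ln N / 2 + ln 2 / 2]. *)
  assert (H2 : is_lim_seq (fun N => 2 * stirling_seq N - stirling_seq (2 * N)) (2 * L - L)).
  { apply is_lim_seq_minus'; [apply (is_lim_seq_scal_l _ 2 L), HL | apply is_lim_seq_double, HL]. }
  assert (H3 : is_lim_seq (fun N => 2 * stirling_seq N - stirling_seq (2 * N)) (ln (2 * PI) / 2)).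
  { apply (is_lim_seq_close (fun _ => ln (2 * PI) / 2)); [apply is_lim_seq_const |].
    intros N HN. generalize (lt_0_INR N ltac:(lia)); intros HN0.
    assert (Hi : 0 < / INR N) by (apply Rinv_0_lt_compat; auto).
    generalize (wallis_bounds N HN). unfold wallis.
    assert (Hf : 0 < INR (Factorial.fact N)) by (apply INR_fact_lt_0).
    assert (Hf2 : 0 < INR (Factorial.fact (2 * N))) by (apply INR_fact_lt_0).
    assert (H4 : 0 < 4 ^ N) by (apply pow_lt; lra).
    assert (Hfp : 0 < INR (Factorial.fact N) ^ 2) by (apply pow_lt; auto).
    rewrite ln_div, ln_mult, !ln_pow by (try apply Rmult_lt_0_compat; lra).
    replace 4 with (2 * 2) by ring. rewrite (ln_mult 2 2) by lra.
    unfold stirling_seq. rewrite mult_INR. replace (INR 2) with 2 by (simpl; ring).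
    rewrite !ln_mult by lra. intros Hw. apply Rabs_le. lra. }
  assert (E : 2 * L - L = ln (2 * PI) / 2).
  { apply is_lim_seq_unique in H2. apply is_lim_seq_unique in H3. congruence. }
  replace (ln (2 * PI) / 2) with L by lra. exact HL.
Qed.

(** * Fourier coefficients of log-gamma *)

Definition log_gamma_normalized (x : R) : R := ln (Gamma x / sqrt (2 * PI)).

Definition gauss_approx (N : nat) (x : R) : R := log_gauss N x - ln (2 * PI) / 2.

Lemma log_gamma_normalized_eq (x : R) : 0 < x <= 1 ->
  log_gamma_normalized x = ln (Gamma x) - ln (2 * PI) / 2.
Proof.
  intros Hx. generalize PI_RGT_0; intros Hpi. unfold log_gamma_normalized.
  assert (0 < sqrt (2 * PI)) by (apply sqrt_lt_R0; lra).
  rewrite ln_div by (auto; apply Gamma_pos, Hx).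
  rewrite (ln_sqrt (2 * PI)) by lra. field.
Qed.

Lemma gauss_approx_close (N : nat) (x : R) : (1 <= N)%nat -> 0 < x <= 1 ->
  Rabs (gauss_approx N x - log_gamma_normalized x) <= / INR N.
Proof.
  intros HN Hx. rewrite log_gamma_normalized_eq by auto. unfold gauss_approx.
  generalize (log_gauss_bounds N x HN Hx). intros H. rewrite Rabs_right; lra.
Qed.

Lemma is_derive_psum_ln (N : nat) (x : R) : 0 < x ->
  is_derive (fun y => psum (fun k => ln (y + INR k)) N) x (psum (fun k => / (x + INR k)) N).
Proof.
  intros Hx. induction N as [|N IH]; simpl.
  - apply is_derive_Reals, derivable_pt_lim_const.
  - apply (is_derive_plus (fun y => psum (fun k => ln (y + INR k)) N) (fun y => ln (y + INR N))); [exact IH |].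
    generalize (pos_INR N); intros. auto_derive; [lra |]. field. lra.
Qed.

Lemma is_derive_gauss_approx (N : nat) (x : R) : 0 < x ->
  is_derive (gauss_approx N) x (ln (INR N) - psum (fun k => / (x + INR k)) N).
Proof.
  intros Hx.
  apply (is_derive_ext (fun y => ((y - 1) * ln (INR N) + ln (INR (Factorial.fact N)) - ln (2 * PI) / 2)
           - psum (fun k => ln (y + INR k)) N)).
  { intros t. unfold gauss_approx, log_gauss. set (p := psum _ _). clearbody p. simpl in *. lra. }
  apply (is_derive_minus (fun y => (y - 1) * ln (INR N) + ln (INR (Factorial.fact N)) - ln (2 * PI) / 2)).
  - auto_derive; [auto | ring].
  - apply is_derive_psum_ln, Hx.
Qed.

Lemma gauss_approx_derivative_bound (N : nat) (x : R) : (1 <= N)%nat -> 0 < x <= 1 ->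
  Rabs (ln (INR N) - psum (fun k => / (x + INR k)) N) <= / x + 1.
Proof.
  intros HN Hx. assert (Hi : 0 < / x) by (apply Rinv_0_lt_compat; lra).
  (* The singular term [k = 0] is removed, and the sharper bound [1 - 1/N] makes the induction
     close: the step from [N] to [N + 1] changes the expression by at most [1/N - 1/(N+1)]. *)
  enough (H : Rabs (ln (INR N) - psum (fun k => / (x + INR k)) N + / x) <= 1 - / INR N).
  { assert (0 < / INR N) by (apply Rinv_0_lt_compat, lt_0_INR; lia).
    apply Rabs_le. apply Rabs_le_between in H. lra. }
  induction HN as [|N HN IH].
  - simpl. rewrite ln_1, Rplus_0_r, Rinv_1. rewrite Rabs_right; lra.
  - generalize (lt_0_INR N ltac:(lia)); intros HN0.
    rewrite psum_S, S_INR. generalize (ln_step_bounds (INR N) HN0); intros H1.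
    assert (H2 : / (INR N + 1) <= / (x + INR N)) by (apply Rinv_le_contravar; lra).
    assert (H3 : / (x + INR N) <= / INR N) by (apply Rinv_le_contravar; lra).
    apply Rabs_le. apply Rabs_le_between in IH. lra.
Qed.

Lemma gauss_approx_lipschitz (N : nat) (d u v : R) :
  (1 <= N)%nat -> 0 < d -> d <= u <= 1 -> d <= v <= 1 ->
  Rabs (gauss_approx N u - gauss_approx N v) <= (/ d + 1) * Rabs (u - v).
Proof.
  intros HN Hd Hu Hv.
  destruct (MVT_gen (gauss_approx N) v u (fun x => ln (INR N) - psum (fun k => / (x + INR k)) N))
    as [c [Hc E]].
  - intros x Hx. apply is_derive_gauss_approx.
    revert Hx; unfold Rmin, Rmax; destruct (Rle_dec v u); lra.
  - intros x Hx. apply continuity_pt_filterlim, ex_derive_continuous_R.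
    eexists. apply is_derive_gauss_approx.
    revert Hx; unfold Rmin, Rmax; destruct (Rle_dec v u); lra.
  - assert (d <= c <= 1) by (revert Hc; unfold Rmin, Rmax; destruct (Rle_dec v u); lra).
    rewrite E, Rabs_mult. apply Rmult_le_compat_r; [apply Rabs_pos |].
    eapply Rle_trans; [apply gauss_approx_derivative_bound; auto; lra |].
    assert (/ c <= / d) by (apply Rinv_le_contravar; lra). lra.
Qed.

Lemma Rle_of_inv_INR_error (a b : R) :
  (forall N, (1 <= N)%nat -> a <= b + 2 * / INR N) -> a <= b.
Proof.
  intros H. replace b with (b + 2 * 0) by ring.
  apply (is_lim_seq_le_loc (fun _ => a) (fun N => b + 2 * / INR N) a (b + 2 * 0)).
  - exists 1%nat. exact H.
  - apply is_lim_seq_const.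
  - apply is_lim_seq_plus'; [apply is_lim_seq_const |].
    apply (is_lim_seq_scal_l _ 2 0), is_lim_seq_inv_INR.
Qed.

(** The Lipschitz constant of the approximations does not depend on [N], and replacing both values
    by their limits costs [2/N]. Continuity of log-gamma is obtained from this. *)
Lemma log_gamma_normalized_lipschitz (d u v : R) :
  0 < d -> d <= u <= 1 -> d <= v <= 1 ->
  Rabs (log_gamma_normalized u - log_gamma_normalized v) <= (/ d + 1) * Rabs (u - v).
Proof.
  intros Hd Hu Hv. apply Rle_of_inv_INR_error. intros N HN.
  generalize (gauss_approx_lipschitz N d u v HN Hd Hu Hv),
    (gauss_approx_close N u HN ltac:(lra)), (gauss_approx_close N v HN ltac:(lra)).
  intros H1 H2 H3. apply Rabs_le_between in H1, H2, H3. apply Rabs_le. lra.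
Qed.

Lemma cont01_log_gamma_normalized : cont01 log_gamma_normalized.
Proof.
  intros x Hx. apply filterlim_locally. intros eps.
  set (d := Rmin (x / 2) (1 - x)).
  assert (Hd : 0 < d) by (apply Rmin_glb_lt; lra).
  assert (Hd1 : d <= x / 2) by apply Rmin_l. assert (Hd2 : d <= 1 - x) by apply Rmin_r.
  assert (HL : 0 < / d + 1) by (assert (0 < / d) by (apply Rinv_0_lt_compat; auto); lra).
  assert (He : 0 < Rmin d (eps / (/ d + 1))).
  { apply Rmin_glb_lt; [auto | apply Rdiv_lt_0_compat; [apply eps | auto]]. }
  exists (mkposreal _ He). intros y Hy. change (Rabs (y - x) < Rmin d (eps / (/ d + 1))) in Hy.
  assert (Hy1 : Rabs (y - x) < d) by (eapply Rlt_le_trans; [exact Hy | apply Rmin_l]).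
  assert (Hy2 : Rabs (y - x) < eps / (/ d + 1)) by (eapply Rlt_le_trans; [exact Hy | apply Rmin_r]).
  apply Rabs_lt_between in Hy1.
  change (Rabs (log_gamma_normalized y - log_gamma_normalized x) < eps).
  eapply Rle_lt_trans; [apply (log_gamma_normalized_lipschitz d); lra |].
  apply (Rmult_lt_compat_l (/ d + 1)) in Hy2; [| auto].
  replace ((/ d + 1) * (eps / (/ d + 1))) with (pos eps) in Hy2 by (field; lra). exact Hy2.
Qed.

Lemma root_tame_gauss_approx (N : nat) : root_tame (gauss_approx N).
Proof.
  apply (root_tame_eq (fun x => ((ln (INR N) * x
      + (ln (INR (Factorial.fact N)) - ln (INR N) - ln (2 * PI) / 2)))
      + -1 * psum (fun k => ln (x + INR k)) N)).
  - apply root_tame_plus.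
    + apply root_tame_plus; [| apply root_tame_const].
      apply root_tame_scal. apply (bounded_root_tame _ 1).
      * intros x _. apply continuous_id.
      * intros x Hx. rewrite Rabs_right; lra.
    + apply root_tame_scal, (root_tame_psum (fun k x => ln (x + INR k))).
      intros; apply root_tame_ln_shift.
  - intros x. unfold gauss_approx, log_gauss. ring.
Qed.

Lemma gauss_approx_uniform_bound : exists B, 0 <= B /\
  forall N x, (1 <= N)%nat -> 0 < x < 1 -> Rabs (gauss_approx N x) <= B * / sqrt (sqrt x).
Proof.
  destruct (root_tame_bound _ (root_tame_gauss_approx 1)) as [B [HB0 HB]].
  (* One unit pays for passing from the [N]-th approximation to the limit, another for passing from
     the limit to the first approximation. *)
  exists (B + 2). split; [lra |]. intros N x HN Hx.
  generalize (HB x Hx), (gauss_approx_close 1 x (le_n 1) ltac:(lra)), (gauss_approx_close N x HN ltac:(lra)).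
  assert (/ INR N <= 1).
  { rewrite <- Rinv_1. apply Rinv_le_contravar; [lra |]. apply (le_INR 1), HN. }
  simpl INR. rewrite Rinv_1. intros H1 H2 H3.
  generalize (sqrt_inv_ge_1 _ (sqrt_unit x Hx)); intros H4.
  apply Rabs_le. apply Rabs_le_between in H1, H2, H3. lra.
Qed.

Lemma root_tame_log_gamma_normalized : root_tame log_gamma_normalized.
Proof.
  split; [apply cont01_log_gamma_normalized |].
  destruct gauss_approx_uniform_bound as [B [HB0 HB]]. exists (B + 1). intros x Hx.
  generalize (HB 1%nat x (le_n 1) Hx), (gauss_approx_close 1 x (le_n 1) ltac:(lra)).
  simpl INR. rewrite Rinv_1. intros H1 H2.
  generalize (sqrt_inv_ge_1 _ (sqrt_unit x Hx)); intros H4. unfold Rdiv.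
  apply Rabs_le. apply Rabs_le_between in H1, H2. lra.
Qed.

Lemma J_gauss_approx_mult_close (N : nat) (G : R -> R) (L : R) :
  (1 <= N)%nat -> cont01 G -> (forall x, 0 < x < 1 -> Rabs (G x) <= L) ->
  Rabs (J (fun x => gauss_approx N x * G x) - J (fun x => log_gamma_normalized x * G x)) <= L * / INR N.
Proof.
  intros HN HG HL. assert (HGt : root_tame G) by (apply (bounded_root_tame _ L); auto).
  generalize (root_tame_gauss_approx N) root_tame_log_gamma_normalized; intros H1 H2.
  rewrite <- J_minus by (apply root_tame_mult; auto).
  apply J_abs_le_const.
  - apply tame_minus; apply root_tame_mult; auto.
  - intros x Hx. replace (gauss_approx N x * G x - log_gamma_normalized x * G x)
      with (G x * (gauss_approx N x - log_gamma_normalized x)) by ring.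
    rewrite Rabs_mult. apply Rmult_le_compat; try apply Rabs_pos; auto.
    apply gauss_approx_close; auto. lra.
Qed.

Lemma J_log_gamma_mult_limit (G : R -> R) (l : R) :
  cont01 G -> (forall x, 0 < x < 1 -> Rabs (G x) <= 1) ->
  is_lim_seq (fun N => J (fun x => gauss_approx N x * G x)) l ->
  J (fun x => log_gamma_normalized x * G x) = l.
Proof.
  intros HG HL Hl.
  assert (H : is_lim_seq (fun _ : nat => J (fun x => log_gamma_normalized x * G x)) l).
  { apply (is_lim_seq_close (fun N => J (fun x => gauss_approx N x * G x))); [exact Hl |].
    intros N HN. rewrite <- (Rmult_1_l (/ INR N)). apply J_gauss_approx_mult_close; auto. }
  apply is_lim_seq_unique in H. rewrite Lim_seq_const in H. injection H. auto.
Qed.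

(** For [G] of period 1, [A (S k) - A k] is the integral of [ln y * G y] over [[k, k + 1]], so the
    shifted logarithms assemble to one integral over [[0, N]]. *)
Lemma J_gauss_approx_mult (N : nat) (G : R -> R) (A : nat -> R) :
  root_tame G -> (forall k, J (fun x => ln (x + INR k) * G x) = A (S k) - A k) ->
  J (fun x => gauss_approx N x * G x)
  = ln (INR N) * J (fun x => x * G x)
    + (ln (INR (Factorial.fact N)) - ln (INR N) - ln (2 * PI) / 2) * J G - (A N - A 0%nat).
Proof.
  intros HG HA.
  assert (Hid : root_tame (fun x => x)).
  { apply (bounded_root_tame _ 1); [intros x _; apply continuous_id |].
    intros x Hx. rewrite Rabs_right; lra. }
  set (c := ln (INR (Factorial.fact N)) - ln (INR N) - ln (2 * PI) / 2).
  assert (HP : root_tame (fun x => psum (fun k => ln (x + INR k)) N))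
    by (apply (root_tame_psum (fun k x => ln (x + INR k))); intros; apply root_tame_ln_shift).
  rewrite (J_ext _ (fun x => (ln (INR N) * (x * G x) + c * G x)
                    - G x * psum (fun k => ln (x + INR k)) N)).
  - rewrite J_minus, J_lincomb; auto using root_tame_mult, root_tame_tame.
    + f_equal. rewrite (J_mult_psum G (fun k x => ln (x + INR k)));
        [| exact HG | intros; apply root_tame_ln_shift].
      rewrite (psum_ext _ (fun k => - (A k - A (S k)))).
      * assert (E : forall u m, psum (fun k => - u k) m = - psum u m)
          by (intros u m; induction m; simpl; lra).
        rewrite E, psum_telescope. ring.
      * intros k _. rewrite (J_ext _ (fun x => ln (x + INR k) * G x)).
        -- rewrite HA. ring.
        -- apply root_tame_mult; auto. apply root_tame_ln_shift.
        -- intros; ring.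
    + apply tame_plus; apply tame_scal; auto using root_tame_mult, root_tame_tame.
  - apply root_tame_mult; [apply root_tame_gauss_approx | exact HG].
  - intros x _. unfold gauss_approx, log_gauss, c. ring.
Qed.

(** Raabe's integral. For [N >= 1] the mean of the approximation is exactly
    [stirling_seq N - ln (2 pi) / 2], so Stirling's constant makes the limit 0. *)
Lemma J_log_gamma_normalized : J log_gamma_normalized = 0.
Proof.
  rewrite (J_ext _ (fun x => log_gamma_normalized x * 1));
    [| apply root_tame_tame, root_tame_log_gamma_normalized | intros; ring].
  apply (J_log_gamma_mult_limit (fun _ => 1)).
  - intros x _. apply continuous_const.
  - intros x _. rewrite Rabs_R1. lra.
  - pose (A := fun k => INR k * ln (INR k) - INR k).
    apply (is_lim_seq_ext_loc (fun N => stirling_seq N - ln (2 * PI) / 2)).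
    + exists 1%nat. intros N HN.
      rewrite (J_gauss_approx_mult N (fun _ => 1) A).
      * rewrite J_const. rewrite (J_unique _ (1 / 2)).
        -- unfold stirling_seq, A. simpl INR. rewrite Rmult_0_l. lra.
        -- replace (1 / 2) with (1 ^ 2 / 2 - 0 ^ 2 / 2) by field.
           apply (is_J_primitive_continuous _ (fun x => x ^ 2 / 2)).
           ++ intros x. auto_derive; [auto | field].
           ++ intros x. apply ex_derive_continuous_R. auto_derive. auto.
      * apply root_tame_const.
      * intros k. apply J_unique.
        apply (is_J_ext (fun x => ln (x + INR k))); [intros; ring |].
        replace (A (S k) - A k) with (INR (S k) * ln (INR (S k)) - INR k * ln (INR k) - 1)
          by (unfold A; rewrite S_INR; ring).
        apply is_J_ln_shift.
    + replace (Finite 0) with (Finite (ln (2 * PI) / 2 - ln (2 * PI) / 2)) by (f_equal; ring).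
      apply is_lim_seq_minus'; [apply is_lim_seq_stirling | apply is_lim_seq_const].
Qed.

Lemma is_lim_seq_multiples (u : nat -> R) (l : R) (n : nat) : (1 <= n)%nat ->
  is_lim_seq u l -> is_lim_seq (fun N => u (n * N)%nat) l.
Proof.
  intros Hn H. apply (is_lim_seq_subseq u l (fun N => (n * N)%nat)); [| exact H].
  apply eventually_subseq. intros; nia.
Qed.

Lemma J_cos_2PI (n : nat) : (1 <= n)%nat -> J (fun x => cos (2 * PI * INR n * x)) = 0.
Proof.
  intros Hn. rewrite (J_ext _ (fun x => cos (2 * PI * IZR (Z.of_nat n) * x + 0))).
  - apply J_cos_period. lia.
  - apply root_tame_tame, root_tame_cos_2PI.
  - intros x _. rewrite <- INR_IZR_INZ, Rplus_0_r. reflexivity.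
Qed.

Lemma J_sin_2PI (n : nat) : J (fun x => sin (2 * PI * INR n * x)) = 0.
Proof.
  rewrite (J_ext _ (fun x => sin (2 * PI * IZR (Z.of_nat n) * x + 0))).
  - apply J_sin_period.
  - apply root_tame_tame, root_tame_sin_2PI.
  - intros x _. rewrite <- INR_IZR_INZ, Rplus_0_r. reflexivity.
Qed.

Lemma frequency_pos (n : nat) : (1 <= n)%nat -> 0 < 2 * PI * INR n.
Proof. intros Hn. generalize PI_RGT_0, (lt_0_INR n ltac:(lia)). nra. Qed.

Lemma J_id_cos_2PI (n : nat) : (1 <= n)%nat -> J (fun x => x * cos (2 * PI * INR n * x)) = 0.
Proof.
  intros Hn. apply J_unique. generalize (frequency_pos n Hn), (sin_2PI_INR n), (cos_2PI_INR n).
  set (c := 2 * PI * INR n). intros Hc Hs Hcos.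
  enough (H : is_RInt_gen (fun x => x * cos (c * x)) (at_right 0) (at_left 1)
    ((1 * sin (c * 1) / c + cos (c * 1) / c ^ 2) - (0 * sin (c * 0) / c + cos (c * 0) / c ^ 2))).
  { replace ((1 * sin (c * 1) / c + cos (c * 1) / c ^ 2) - (0 * sin (c * 0) / c + cos (c * 0) / c ^ 2))
      with 0 in H by (rewrite Rmult_1_r, Rmult_0_r, Hs, Hcos, cos_0; field; lra).
    exact H. }
  apply (is_J_primitive_continuous _ (fun x => x * sin (c * x) / c + cos (c * x) / c ^ 2)).
  - intros x. auto_derive; [auto |]. field. lra.
  - intros x. apply ex_derive_continuous_R. auto_derive. auto.
Qed.

Lemma J_id_sin_2PI (n : nat) : (1 <= n)%nat ->
  J (fun x => x * sin (2 * PI * INR n * x)) = - / (2 * PI * INR n).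
Proof.
  intros Hn. apply J_unique. generalize (frequency_pos n Hn), (sin_2PI_INR n), (cos_2PI_INR n).
  set (c := 2 * PI * INR n). intros Hc Hs Hcos.
  replace (- / c) with ((- 1 * cos (c * 1) / c + sin (c * 1) / c ^ 2) - (- 0 * cos (c * 0) / c + sin (c * 0) / c ^ 2))
    by (rewrite Rmult_1_r, Rmult_0_r, Hs, Hcos, sin_0; field; lra).
  apply (is_J_primitive_continuous _ (fun x => - x * cos (c * x) / c + sin (c * x) / c ^ 2)).
  - intros x. auto_derive; [auto |]. field. lra.
  - intros x. apply ex_derive_continuous_R. auto_derive. auto.
Qed.

Lemma J_log_gamma_cos (n : nat) : (1 <= n)%nat ->
  J (fun x => log_gamma_normalized x * cos (2 * PI * INR n * x)) = 1 / (4 * INR n).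
Proof.
  intros Hn. generalize (frequency_pos n Hn), PI_RGT_0; intros Hc Hpi.
  assert (Hn0 : 0 < INR n) by (apply lt_0_INR; lia).
  apply (J_log_gamma_mult_limit (fun x => cos (2 * PI * INR n * x))).
  - apply root_tame_cos_2PI.
  - intros x _. apply Rabs_cos_le.
  - pose (A := fun k => - Si (2 * PI * INR n * INR k) / (2 * PI * INR n)).
    apply (is_lim_seq_ext (fun N => / (2 * PI * INR n) * Si (2 * PI * INR (n * N)))).
    + intros N.
      rewrite (J_gauss_approx_mult N (fun x => cos (2 * PI * INR n * x)) A).
      * rewrite J_cos_2PI, J_id_cos_2PI by auto. unfold A. rewrite mult_INR.
        replace (INR 0) with 0 by reflexivity. rewrite (Rmult_0_r (2 * PI * INR n)), Si_0.
        rewrite <- Rmult_assoc. field. split; lra.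
      * apply root_tame_cos_2PI.
      * intros k. apply J_unique.
        replace (A (S k) - A k) with
          ((Si (2 * PI * INR n * INR k) - Si (2 * PI * INR n * INR (S k))) / (2 * PI * INR n))
          by (unfold A; field; split; lra).
        apply is_J_ln_cos, Hn.
    + replace (1 / (4 * INR n)) with (/ (2 * PI * INR n) * (PI / 2)) by (field; split; lra).
      apply (is_lim_seq_scal_l _ (/ (2 * PI * INR n)) (PI / 2)).
      apply (is_lim_seq_multiples (fun N => Si (2 * PI * INR N))); auto. apply is_lim_seq_Si.
Qed.

(** The linear term of [gauss_approx] contributes [- ln N / (2 pi n)], which cancels the divergence
    of [Cin (2 pi n N) / (2 pi n)]. In the cosine case it integrates to 0, in accordance with the
    finite limit of [Si]. *)
Lemma J_log_gamma_sin (n : nat) : (1 <= n)%nat ->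
  J (fun x => log_gamma_normalized x * sin (2 * PI * INR n * x))
  = (ln (2 * PI * INR n) + Euler_gamma) / (2 * PI * INR n).
Proof.
  intros Hn. generalize (frequency_pos n Hn), PI_RGT_0; intros Hc Hpi.
  assert (Hn0 : 0 < INR n) by (apply lt_0_INR; lia).
  apply (J_log_gamma_mult_limit (fun x => sin (2 * PI * INR n * x))).
  - apply root_tame_sin_2PI.
  - intros x _. apply Rabs_sin_le.
  - pose (A := fun k => - Cin (2 * PI * INR n * INR k) / (2 * PI * INR n)).
    apply (is_lim_seq_ext_loc (fun N => / (2 * PI * INR n)
       * (ln (2 * PI * INR n) + (Cin (2 * PI * INR (n * N)) - ln (2 * PI * INR (n * N)))))).
    + exists 1%nat. intros N HN.
      rewrite (J_gauss_approx_mult N (fun x => sin (2 * PI * INR n * x)) A).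
      * rewrite J_sin_2PI, J_id_sin_2PI by auto. unfold A. rewrite mult_INR.
        replace (INR 0) with 0 by reflexivity. rewrite (Rmult_0_r (2 * PI * INR n)), Cin_0.
        rewrite <- Rmult_assoc. rewrite (ln_mult (2 * PI * INR n)) by (auto; apply lt_0_INR; lia).
        field. split; lra.
      * apply root_tame_sin_2PI.
      * intros k. apply J_unique.
        replace (A (S k) - A k) with
          ((Cin (2 * PI * INR n * INR k) - Cin (2 * PI * INR n * INR (S k))) / (2 * PI * INR n))
          by (unfold A; field; split; lra).
        apply is_J_ln_sin, Hn.
    + replace ((ln (2 * PI * INR n) + Euler_gamma) / (2 * PI * INR n))
        with (/ (2 * PI * INR n) * (ln (2 * PI * INR n) + Euler_gamma)) by (field; split; lra).
      apply (is_lim_seq_scal_l _ (/ (2 * PI * INR n)) (ln (2 * PI * INR n) + Euler_gamma)).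
      apply is_lim_seq_plus'; [apply is_lim_seq_const |].
      apply (is_lim_seq_multiples (fun N => Cin (2 * PI * INR N) - ln (2 * PI * INR N))); auto.
      apply is_lim_seq_Cin.
Qed.

Definition log_gamma_cos_coef (n : nat) : R := 1 / (2 * INR n).

Definition log_gamma_sin_coef (n : nat) : R :=
  1 / (PI * INR n) * (ln (2 * PI * INR n) + Euler_gamma).

Lemma log_gamma_trig_Fourier_series :
  is_trig_Fourier_series log_gamma_normalized 0 log_gamma_cos_coef log_gamma_sin_coef.
Proof.
  generalize PI_RGT_0 root_tame_log_gamma_normalized; intros Hpi Ht. split.
  - generalize (tame_is_RInt_gen _ (root_tame_tame _ Ht)). rewrite J_log_gamma_normalized. auto.
  - intros n Hn. assert (Hn0 : 0 < INR n) by (apply lt_0_INR; lia).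
    assert (Hc : tame (fun x => log_gamma_normalized x * cos (2 * PI * INR n * x)))
      by (apply root_tame_mult; [exact Ht | apply root_tame_cos_2PI]).
    assert (Hs : tame (fun x => log_gamma_normalized x * sin (2 * PI * INR n * x)))
      by (apply root_tame_mult; [exact Ht | apply root_tame_sin_2PI]).
    split.
    + generalize (tame_is_RInt_gen _ (tame_scal 2 _ Hc)).
      rewrite J_scal, J_log_gamma_cos by auto.
      replace (2 * (1 / (4 * INR n))) with (log_gamma_cos_coef n)
        by (unfold log_gamma_cos_coef; field; lra). auto.
    + generalize (tame_is_RInt_gen _ (tame_scal 2 _ Hs)).
      rewrite J_scal, J_log_gamma_sin by auto.
      replace (2 * ((ln (2 * PI * INR n) + Euler_gamma) / (2 * PI * INR n))) with (log_gamma_sin_coef n)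
        by (unfold log_gamma_sin_coef; field; split; lra). auto.
Qed.

(** * Pointwise convergence *)

Definition dirichlet (N : nat) (y : R) : R :=
  1 + psum (fun k => 2 * cos (2 * PI * INR (S k) * y)) N.

Lemma sin_eq_mult_sinc (y : R) : sin y = y * sinc y.
Proof.
  destruct (Req_EM_T y 0) as [->|Hy]; [rewrite sin_0; ring |].
  rewrite sinc_neq by auto. field. auto.
Qed.

Lemma sinc_pos (y : R) : Rabs y < PI -> 0 < sinc y.
Proof.
  intros Hy. unfold sinc. destruct (Req_EM_T y 0) as [->|Hy0]; [lra |].
  apply Rabs_def2 in Hy. destruct (Rlt_dec 0 y) as [H|H].
  - apply Rdiv_lt_0_compat; [apply sin_gt_0; lra | auto].
  - replace (sin y / y) with (sin (- y) / - y) by (rewrite sin_neg; field; auto).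
    apply Rdiv_lt_0_compat; [apply sin_gt_0; lra | lra].
Qed.

Lemma dirichlet_mult_sin (N : nat) (y : R) :
  sin (PI * y) * dirichlet N y = sin ((2 * INR N + 1) * (PI * y)).
Proof.
  rewrite dirichlet_kernel. unfold dirichlet. f_equal. f_equal.
  apply psum_ext. intros k _. f_equal. f_equal. ring.
Qed.

(** The difference quotient with its removable singularity filled, so that it is continuous across
    [alpha]. *)
Definition slope (F : R -> R) (alpha u : R) : R :=
  if Req_EM_T u alpha then Derive F alpha else (F u - F alpha) / (u - alpha).

Lemma slope_mult (F : R -> R) (alpha u : R) : slope F alpha u * (u - alpha) = F u - F alpha.
Proof.
  unfold slope. destruct (Req_EM_T u alpha) as [->|H]; [ring |]. field. lra.
Qed.

Lemma continuous_slope (F : R -> R) (alpha u : R) :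
  ex_derive F alpha -> continuous F u -> continuous (slope F alpha) u.
Proof.
  intros Hd Hc. destruct (Req_EM_T u alpha) as [->|Hu].
  - apply Derive_correct, is_derive_Reals in Hd.
    apply filterlim_locally. intros eps. destruct (Hd eps (cond_pos eps)) as [d H].
    exists d. intros y Hy. change (Rabs (y - alpha) < d) in Hy.
    change (Rabs (slope F alpha y - slope F alpha alpha) < eps).
    unfold slope. destruct (Req_EM_T alpha alpha) as [_|]; [| contradiction].
    destruct (Req_EM_T y alpha) as [->|Hy'].
    + rewrite Rminus_diag_eq, Rabs_R0 by auto. apply cond_pos.
    + generalize (H (y - alpha) ltac:(lra) Hy). now rewrite Rplus_minus.
  - apply (continuous_ext_loc _ (fun u => (F u - F alpha) / (u - alpha))).
    + assert (H0 : 0 < Rabs (u - alpha)) by (apply Rabs_pos_lt; lra).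
      exists (mkposreal _ H0). intros y Hy. change (Rabs (y - u) < Rabs (u - alpha)) in Hy.
      unfold slope. destruct (Req_EM_T y alpha) as [->|_]; [| reflexivity].
      rewrite Rabs_minus_sym in Hy. lra.
    + apply (continuous_mult (fun u => F u - F alpha) (fun u => / (u - alpha))).
      * apply (continuous_minus F (fun _ => F alpha)); [exact Hc | apply continuous_const].
      * apply ex_derive_continuous_R. auto_derive. lra.
Qed.

(** The integrands are [h] times orthogonal waves of square norm 1/2, so the sum is at most
    [J (h * h) / 2]; with [|h u| <= K u^(-1/4)] this is at most [K ^ 2]. *)
Lemma dirichlet_square_sum (F : R -> R) (alpha K : R) (m : nat) :
  0 < alpha < 1 -> cont01 F -> ex_derive F alpha -> 0 <= K -> Rabs (Derive F alpha) <= K ->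
  (forall u, 0 < u < 1 ->
     Rabs (F u - F alpha) <= K * Rabs (sin (PI * (u - alpha))) * / sqrt (sqrt u)) ->
  psum (fun N => J (fun u => (F u - F alpha) * dirichlet N (u - alpha)) ^ 2) m <= K ^ 2.
Proof.
  intros Ha HF Hd HK HK1 HKF. generalize PI_RGT_0; intros Hpi.
  assert (Hsinc : forall u, 0 < u < 1 -> 0 < sinc (PI * (u - alpha))).
  { intros u Hu. apply sinc_pos. rewrite Rabs_mult, (Rabs_right PI) by lra.
    assert (Rabs (u - alpha) < 1) by (apply Rabs_def1; lra). nra. }
  (* Away from [alpha] this is [(F u - F alpha) / sin(pi (u - alpha))]. The factor [u - alpha] is
     moved into [slope], and the remaining [sinc] is positive since [|u - alpha| < 1]. *)
  pose (h := fun u => slope F alpha u * / (PI * sinc (PI * (u - alpha)))).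
  assert (Hhc : cont01 h).
  { intros u Hu. generalize (Hsinc u Hu); intros Hs.
    apply (continuous_mult (slope F alpha) (fun u => / (PI * sinc (PI * (u - alpha))))).
    - apply continuous_slope; auto.
    - apply (continuous_comp (fun u => sinc (PI * (u - alpha))) (fun z => / (PI * z))).
      + apply (continuous_comp (fun u => PI * (u - alpha)) sinc); [| apply continuous_sinc].
        apply ex_derive_continuous_R. auto_derive. auto.
      + apply ex_derive_continuous_R. auto_derive. nra. }
  assert (Hhb : forall u, 0 < u < 1 -> Rabs (h u) <= K * / sqrt (sqrt u)).
  { intros u Hu. generalize (Hsinc u Hu), (sqrt_inv_ge_1 _ (sqrt_unit u Hu)); intros Hs H1.
    unfold h, slope. destruct (Req_EM_T u alpha) as [->|Hne].
    - rewrite Rminus_diag_eq, Rmult_0_r, sinc_0, Rmult_1_r by auto.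
      rewrite Rabs_mult, (Rabs_right (/ PI)) by (apply Rle_ge, Rlt_le, Rinv_0_lt_compat, Hpi).
      assert (/ PI <= 1) by (rewrite <- Rinv_1; apply Rinv_le_contravar; generalize PI2_1; lra).
      assert (0 < / PI) by (apply Rinv_0_lt_compat; auto).
      generalize (Rabs_pos (Derive F alpha)). nra.
    - replace ((F u - F alpha) / (u - alpha) * / (PI * sinc (PI * (u - alpha))))
        with ((F u - F alpha) * / sin (PI * (u - alpha)))
        by (rewrite sin_eq_mult_sinc; field; repeat split; lra).
      assert (Hs0 : sin (PI * (u - alpha)) <> 0).
      { rewrite sin_eq_mult_sinc. apply Rmult_integral_contrapositive_currified; [| lra].
        apply Rmult_integral_contrapositive_currified; [lra | intros H0; apply Hne; lra]. }
      assert (Hs1 := Rabs_pos_lt _ Hs0).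
      rewrite Rabs_mult, Rabs_inv. apply (Rmult_le_reg_r (Rabs (sin (PI * (u - alpha))))); [auto |].
      rewrite Rmult_assoc, Rinv_l, Rmult_1_r by lra.
      generalize (HKF u Hu). lra. }
  assert (Hh : root_tame h) by (split; [exact Hhc | exists K; exact Hhb]).
  rewrite (psum_ext _ (fun N => J (fun u => h u * dirichlet_wave alpha N u) ^ 2)).
  - eapply Rle_trans.
    + apply riemann_lebesgue_square; auto.
      * apply root_tame_dirichlet_wave.
      * intros i j Hij. rewrite J_dirichlet_wave_product. apply Nat.eqb_neq in Hij. now rewrite Hij.
      * intros i. rewrite J_dirichlet_wave_product, Nat.eqb_refl. reflexivity.
    + enough (J (fun u => h u * h u) <= 2 * K ^ 2) by lra.
      apply J_le_inv_sqrt; [apply root_tame_mult; auto |].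
      intros u Hu. generalize (Hhb u Hu), (Rabs_pos (h u)). intros H1 H2.
      assert (H3 : 0 < sqrt u) by (apply sqrt_lt_R0; lra).
      replace (/ sqrt u) with (/ sqrt (sqrt u) * / sqrt (sqrt u))
        by (rewrite <- Rinv_mult, sqrt_sqrt; lra).
      replace (h u * h u) with (Rabs (h u) * Rabs (h u))
        by (rewrite <- Rabs_mult; apply Rabs_right; nra).
      replace (K ^ 2 * (/ sqrt (sqrt u) * / sqrt (sqrt u)))
        with ((K * / sqrt (sqrt u)) * (K * / sqrt (sqrt u))) by ring.
      apply Rmult_le_compat; auto.
  - intros N _. f_equal. symmetry. apply J_ext.
    + apply root_tame_mult; auto. apply root_tame_dirichlet_wave.
    + intros u Hu. generalize (Hsinc u Hu); intros Hs.
      unfold h, dirichlet_wave.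
      replace ((2 * INR N + 1) * PI * (u - alpha)) with ((2 * INR N + 1) * (PI * (u - alpha))) by ring.
      rewrite <- dirichlet_mult_sin, sin_eq_mult_sinc, <- slope_mult. field. split; lra.
Qed.

Definition fourier_partial_sum (N : nat) (x : R) : R :=
  psum (fun k => trig_block log_gamma_cos_coef log_gamma_sin_coef (S k) x) N.

Lemma root_tame_dirichlet_shift (N : nat) (alpha : R) : root_tame (fun u => dirichlet N (u - alpha)).
Proof.
  apply (root_tame_plus (fun _ => 1)); [apply root_tame_const |].
  apply (root_tame_psum (fun k u => 2 * cos (2 * PI * INR (S k) * (u - alpha)))). intros k.
  apply root_tame_scal.
  eapply root_tame_eq; [apply (root_tame_cos_lin (2 * PI * INR (S k)) (- (2 * PI * INR (S k) * alpha))) |].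
  intros x; cbv beta; f_equal; ring.
Qed.

Lemma Rabs_dirichlet_le (N : nat) (y : R) : Rabs (dirichlet N y) <= 1 + 2 * INR N.
Proof.
  unfold dirichlet. induction N as [|N IH].
  - simpl. rewrite Rplus_0_r, Rabs_R1. lra.
  - rewrite psum_S, S_INR, <- Rplus_assoc. eapply Rle_trans; [apply Rabs_triang |].
    rewrite Rabs_mult, (Rabs_right 2) by lra. generalize (Rabs_cos_le (2 * PI * (INR N + 1) * y)).
    lra.
Qed.

Lemma J_mult_dirichlet (h : R -> R) (N : nat) (alpha : R) : root_tame h ->
  J (fun u => h u * dirichlet N (u - alpha))
  = J h + psum (fun k => 2 * (J (fun x => h x * cos (2 * PI * INR (S k) * x)) * cos (2 * PI * INR (S k) * alpha)
                    + J (fun x => h x * sin (2 * PI * INR (S k) * x)) * sin (2 * PI * INR (S k) * alpha))) N.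
Proof.
  intros Hh.
  assert (Hc : forall k, root_tame (fun u => 2 * cos (2 * PI * INR (S k) * (u - alpha)))).
  { intros k. apply root_tame_scal.
    eapply root_tame_eq; [apply (root_tame_cos_lin (2 * PI * INR (S k)) (- (2 * PI * INR (S k) * alpha))) |].
    intros x; cbv beta; f_equal; ring. }
  rewrite (J_ext _ (fun u => h u + h u * psum (fun k => 2 * cos (2 * PI * INR (S k) * (u - alpha))) N)).
  - rewrite J_plus.
    + f_equal. rewrite (J_mult_psum h (fun k u => 2 * cos (2 * PI * INR (S k) * (u - alpha)))) by auto.
      apply psum_ext. intros k _.
      rewrite (J_ext _ (fun x => (2 * cos (2 * PI * INR (S k) * alpha)) * (h x * cos (2 * PI * INR (S k) * x))
          + (2 * sin (2 * PI * INR (S k) * alpha)) * (h x * sin (2 * PI * INR (S k) * x)))).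
      * rewrite J_lincomb; [ring | |]; apply root_tame_mult; auto using root_tame_cos_2PI, root_tame_sin_2PI.
      * apply root_tame_mult; auto.
      * intros x _. rewrite Rmult_minus_distr_l, cos_minus. ring.
    + apply root_tame_tame, Hh.
    + apply root_tame_mult; auto.
      apply (root_tame_psum (fun k u => 2 * cos (2 * PI * INR (S k) * (u - alpha)))), Hc.
  - apply root_tame_mult; auto. apply root_tame_dirichlet_shift.
  - intros x _. unfold dirichlet. ring.
Qed.

Lemma J_dirichlet_shift (N : nat) (alpha : R) : J (fun u => dirichlet N (u - alpha)) = 1.
Proof.
  rewrite (J_ext _ (fun u => 1 * dirichlet N (u - alpha))).
  - rewrite (J_mult_dirichlet (fun _ => 1)) by apply root_tame_const.
    rewrite J_const, psum_zero; [ring |]. intros k _.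
    rewrite (J_scal 1 (fun x => cos (2 * PI * INR (S k) * x))) by apply root_tame_tame, root_tame_cos_2PI.
    rewrite (J_scal 1 (fun x => sin (2 * PI * INR (S k) * x))) by apply root_tame_tame, root_tame_sin_2PI.
    rewrite J_cos_2PI, J_sin_2PI by lia. ring.
  - apply root_tame_tame, root_tame_dirichlet_shift.
  - intros; ring.
Qed.

Lemma fourier_error_J (N : nat) (alpha : R) :
  J (fun u => (log_gamma_normalized u - log_gamma_normalized alpha) * dirichlet N (u - alpha))
  = fourier_partial_sum N alpha - log_gamma_normalized alpha.
Proof.
  generalize PI_RGT_0; intros Hpi.
  rewrite (J_ext _ (fun u => log_gamma_normalized u * dirichlet N (u - alpha)
                       - log_gamma_normalized alpha * dirichlet N (u - alpha))).
  - rewrite J_minus, J_scal, J_dirichlet_shift.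
    + rewrite J_mult_dirichlet, J_log_gamma_normalized by apply root_tame_log_gamma_normalized.
      rewrite Rplus_0_l, Rmult_1_r. f_equal. apply psum_ext. intros k _.
      rewrite J_log_gamma_cos, J_log_gamma_sin by lia.
      unfold trig_block, log_gamma_cos_coef, log_gamma_sin_coef.
      assert (0 < INR (S k)) by (apply lt_0_INR; lia). field. split; lra.
    + apply root_tame_tame, root_tame_dirichlet_shift.
    + apply root_tame_mult; [apply root_tame_log_gamma_normalized | apply root_tame_dirichlet_shift].
    + apply tame_scal, root_tame_tame, root_tame_dirichlet_shift.
  - apply root_tame_mult; [| apply root_tame_dirichlet_shift].
    apply (root_tame_eq (fun u => log_gamma_normalized u + - log_gamma_normalized alpha)); [| intros; ring].
    apply root_tame_plus; [apply root_tame_log_gamma_normalized | apply root_tame_const].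
  - intros; ring.
Qed.

(** [dirichlet_square_sum] asks for a derivative at [alpha], available for the approximations; this
    limit carries its bound over to log-gamma. *)
Lemma fourier_error_limit (N : nat) (alpha : R) : 0 < alpha < 1 ->
  is_lim_seq (fun M => J (fun u => (gauss_approx M u - gauss_approx M alpha) * dirichlet N (u - alpha)))
    (fourier_partial_sum N alpha - log_gamma_normalized alpha).
Proof.
  intros Ha. rewrite <- fourier_error_J.
  assert (HD := root_tame_dirichlet_shift N alpha).
  assert (Hsplit : forall h, root_tame h ->
    J (fun u => (h u - h alpha) * dirichlet N (u - alpha))
    = J (fun u => h u * dirichlet N (u - alpha)) - h alpha).
  { intros h Hh. rewrite (J_ext _ (fun u => h u * dirichlet N (u - alpha) - h alpha * dirichlet N (u - alpha))).
    - rewrite J_minus, J_scal, J_dirichlet_shift; [ring | | |].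
      + apply root_tame_tame, HD.
      + apply root_tame_mult; auto.
      + apply tame_scal, root_tame_tame, HD.
    - apply root_tame_mult; auto.
      apply (root_tame_eq (fun u => h u + - h alpha)); [| intros; ring].
      apply root_tame_plus; [exact Hh | apply root_tame_const].
    - intros; ring. }
  rewrite Hsplit by apply root_tame_log_gamma_normalized.
  apply (is_lim_seq_ext (fun M => J (fun u => gauss_approx M u * dirichlet N (u - alpha)) - gauss_approx M alpha)).
  { intros M. rewrite Hsplit by apply root_tame_gauss_approx. reflexivity. }
  apply is_lim_seq_minus'.
  - apply (is_lim_seq_rate _ _ (1 + 2 * INR N)). intros M HM. apply J_gauss_approx_mult_close; auto.
    + apply HD.
    + intros x _. apply Rabs_dirichlet_le.
  - apply (is_lim_seq_rate _ _ 1). intros M HM. rewrite Rmult_1_l. apply gauss_approx_close; auto. lra.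
Qed.

(* Near the diagonal the Lipschitz bound is used, away from it [sin] is bounded below. *)
Lemma gauss_approx_difference_bound (eps : R) : 0 < eps <= 1 / 2 ->
  exists K, 0 <= K /\ forall M alpha, (1 <= M)%nat -> eps <= alpha <= 1 - eps ->
    Rabs (Derive (gauss_approx M) alpha) <= K /\
    forall u, 0 < u < 1 ->
      Rabs (gauss_approx M u - gauss_approx M alpha)
      <= K * Rabs (sin (PI * (u - alpha))) * / sqrt (sqrt u).
Proof.
  intros He. generalize PI_RGT_0 PI_le_4; intros Hpi Hpi4.
  destruct gauss_approx_uniform_bound as [B [HB0 HB]].
  set (s := sin (PI * (eps / 2))). set (L := / (eps / 2) + 1).
  assert (Hs : 0 < s) by (apply sin_gt_0; nra).
  assert (HL : 1 < L) by (unfold L; assert (0 < / (eps / 2)) by (apply Rinv_0_lt_compat; lra); lra).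
  set (Ba := B * / sqrt (sqrt eps)).
  assert (HBa : 0 <= Ba).
  { apply Rmult_le_pos; [auto |]. apply Rlt_le, Rinv_0_lt_compat, sqrt_lt_R0, sqrt_lt_R0. lra. }
  set (K := L + (B + Ba) / s).
  assert (HK2 : 0 <= (B + Ba) / s) by (apply Rdiv_le_0_compat; lra).
  exists K. split; [unfold K; lra |]. intros M alpha HM Ha. split.
  - rewrite (is_derive_unique _ _ _ (is_derive_gauss_approx M alpha ltac:(lra))).
    eapply Rle_trans; [apply gauss_approx_derivative_bound; auto; lra |].
    assert (/ alpha <= / (eps / 2)) by (apply Rinv_le_contravar; lra). unfold K, L in *. lra.
  - intros u Hu. generalize (sqrt_inv_ge_1 _ (sqrt_unit u Hu)); intros H1.
    assert (Hsin : Rabs (sin (PI * (u - alpha))) = sin (PI * Rabs (u - alpha))).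
    { unfold Rabs at 2. destruct (Rcase_abs (u - alpha)) as [H|H].
      - replace (PI * - (u - alpha)) with (- (PI * (u - alpha))) by ring.
        rewrite sin_neg. apply Rabs_left. apply sin_lt_0_var; nra.
      - apply Rabs_right, Rle_ge, sin_ge_0; nra. }
    rewrite Hsin. set (y := Rabs (u - alpha)) in *.
    assert (Hy0 : 0 <= y) by apply Rabs_pos.
    assert (Hy1 : y <= 1 - eps) by (unfold y, Rabs; destruct (Rcase_abs (u - alpha)); lra).
    destruct (Rle_dec y (eps / 2)) as [Hy|Hy].
    + assert (Hu2 : eps / 2 <= u) by (revert Hy; unfold y, Rabs; destruct (Rcase_abs (u - alpha)); lra).
      generalize (gauss_approx_lipschitz M (eps / 2) u alpha HM ltac:(lra) ltac:(lra) ltac:(lra)).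
      fold L y. intros H2.
      (* Here [z = pi y <= 1], so [sin z >= z - z^3 / 6 >= 5 z / 6], and [z >= 2 y]. *)
      assert (H3 : y <= sin (PI * y)).
      { assert (Hz : 0 <= PI * y <= 1) by (split; nra).
        generalize (sin_cubic_lower_bound (PI * y) ltac:(lra)), PI2_1. intros H3 H4.
        assert (H5 : 2 * y <= PI * y) by nra. set (z := PI * y) in *.
        assert (z ^ 2 <= 1) by nra. assert (z ^ 3 <= z) by (simpl in *; nra). lra. }
      eapply Rle_trans; [exact H2 |].
      assert (L * y <= K * sin (PI * y)) by (apply Rmult_le_compat; unfold K; lra).
      assert (0 <= L * y) by nra. nra.
    (* [y] lies between [eps / 2] and [1 - eps]; beyond [1/2] the reflection [y] to [1 - y] returns
       to the increasing branch of the sine. *)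
    + assert (H3 : s <= sin (PI * y)).
      { unfold s. destruct (Rle_dec y (1 / 2)) as [Hy2|Hy2].
        - apply sin_incr_1; nra.
        - rewrite <- (sin_PI_x (PI * y)). apply sin_incr_1; nra. }
      assert (H4 : Rabs (gauss_approx M u - gauss_approx M alpha) <= (B + Ba) * / sqrt (sqrt u)).
      { generalize (HB M u HM Hu), (HB M alpha HM ltac:(lra)). intros H5 H6.
        assert (H7 : B * / sqrt (sqrt alpha) <= Ba).
        { apply Rmult_le_compat_l; [auto |]. apply Rinv_le_contravar.
          - apply sqrt_lt_R0, sqrt_lt_R0; lra.
          - apply sqrt_le_1_alt, sqrt_le_1_alt; lra. }
        apply Rabs_le. apply Rabs_le_between in H5, H6.
        assert (Ba <= Ba * / sqrt (sqrt u)) by nra. lra. }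
      eapply Rle_trans; [exact H4 |]. apply Rmult_le_compat_r; [lra |].
      assert (H5 : B + Ba = (B + Ba) / s * s) by (field; lra).
      rewrite H5. apply Rmult_le_compat; unfold K; lra.
Qed.

Lemma is_lim_seq_psum (u : nat -> nat -> R) (l : nat -> R) (m : nat) :
  (forall i, is_lim_seq (fun M => u M i) (l i)) -> is_lim_seq (fun M => psum (u M) m) (psum l m).
Proof.
  intros H. induction m as [|m IH]; simpl; [apply is_lim_seq_const |].
  apply is_lim_seq_plus'; auto.
Qed.

(** Only finitely many terms pass to the limit [M -> infinity] at a time; the bound [K ^ 2] is the
    same for all [M], [m] and [alpha]. *)
Lemma fourier_error_square_sum (eps : R) : 0 < eps <= 1 / 2 ->
  exists C, forall m alpha, eps <= alpha <= 1 - eps ->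
    psum (fun N => (fourier_partial_sum N alpha - log_gamma_normalized alpha) ^ 2) m <= C.
Proof.
  intros He. destruct (gauss_approx_difference_bound eps He) as [K [HK0 HK]].
  exists (K ^ 2). intros m alpha Ha.
  apply (is_lim_seq_le_loc
    (fun M => psum (fun N => J (fun u => (gauss_approx M u - gauss_approx M alpha) * dirichlet N (u - alpha)) ^ 2) m)
    (fun _ => K ^ 2)
    (psum (fun N => (fourier_partial_sum N alpha - log_gamma_normalized alpha) ^ 2) m) (K ^ 2)).
  - exists 1%nat. intros M HM. destruct (HK M alpha HM Ha) as [H1 H2].
    apply dirichlet_square_sum; auto; [lra | apply root_tame_gauss_approx |].
    eexists. apply is_derive_gauss_approx. lra.
  - apply is_lim_seq_psum. intros N.
    assert (H := fourier_error_limit N alpha ltac:(lra)). simpl.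
    apply is_lim_seq_mult'; [exact H |]. apply is_lim_seq_mult'; [exact H |]. apply is_lim_seq_const.
  - apply is_lim_seq_const.
Qed.

Lemma is_lim_seq_fourier_partial_sum (alpha : R) : 0 < alpha < 1 ->
  is_lim_seq (fun N => fourier_partial_sum N alpha) (log_gamma_normalized alpha).
Proof.
  intros Ha. set (eps := Rmin (1 / 2) (Rmin alpha (1 - alpha))).
  assert (He : 0 < eps <= 1 / 2).
  { split; [| apply Rmin_l]. repeat apply Rmin_glb_lt; lra. }
  assert (H1 : eps <= alpha) by (eapply Rle_trans; [apply Rmin_r | apply Rmin_l]).
  assert (H2 : eps <= 1 - alpha) by (eapply Rle_trans; [apply Rmin_r | apply Rmin_r]).
  destruct (fourier_error_square_sum eps He) as [C HC].
  apply (is_lim_seq_ext (fun N => (fourier_partial_sum N alpha - log_gamma_normalized alpha) + log_gamma_normalized alpha));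
    [intros; ring |].
  replace (Finite (log_gamma_normalized alpha)) with (Finite (0 + log_gamma_normalized alpha)) by (f_equal; ring).
  apply is_lim_seq_plus'; [| apply is_lim_seq_const].
  apply is_lim_seq_0_square, ex_series_lim_0.
  apply (ex_series_psum_bounded _ C).
  - intros; apply pow2_ge_0.
  - intros m. apply HC. lra.
Qed.

(** * Parseval's equation *)

Definition log_gamma_sin_term (alpha : R) (n : nat) : R :=
  sin (2 * PI * INR n * alpha) / (PI * INR n) * (ln (2 * PI * INR n) + Euler_gamma).

Definition log_gamma_cos_term (alpha : R) (n : nat) : R :=
  cos (2 * PI * INR n * alpha) / (2 * INR n).

Definition log_gamma_parseval_term (n : nat) : R :=
  1 / INR n ^ 2 * (((ln (2 * PI * INR n) + Euler_gamma) / PI) ^ 2 + 1 / 4).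

Lemma fourier_partial_sum_split (N : nat) (alpha : R) :
  fourier_partial_sum N alpha
  = psum (fun k => log_gamma_cos_term alpha (S k)) N + psum (fun k => log_gamma_sin_term alpha (S k)) N.
Proof.
  generalize PI_RGT_0; intros Hpi.
  unfold fourier_partial_sum. rewrite <- psum_plus. apply psum_ext. intros k _.
  assert (0 < INR (S k)) by (apply lt_0_INR; lia).
  unfold trig_block, log_gamma_cos_term, log_gamma_sin_term, log_gamma_cos_coef, log_gamma_sin_coef.
  field. split; lra.
Qed.

Lemma fourier_partial_sum_reflect (N : nat) (alpha : R) :
  fourier_partial_sum N (1 - alpha)
  = psum (fun k => log_gamma_cos_term alpha (S k)) N - psum (fun k => log_gamma_sin_term alpha (S k)) N.
Proof.
  rewrite fourier_partial_sum_split.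
  assert (E : forall k, 2 * PI * INR (S k) * (1 - alpha)
                        = 2 * PI * IZR (Z.of_nat (S k)) + - (2 * PI * INR (S k) * alpha))
    by (intros k; rewrite <- INR_IZR_INZ; ring).
  replace (psum (fun k => log_gamma_cos_term alpha (S k)) N - psum (fun k => log_gamma_sin_term alpha (S k)) N)
    with (psum (fun k => log_gamma_cos_term alpha (S k)) N + psum (fun k => -1 * log_gamma_sin_term alpha (S k)) N)
    by (rewrite psum_scal; ring).
  f_equal; apply psum_ext; intros k _;
    unfold log_gamma_cos_term, log_gamma_sin_term; rewrite E.
  - rewrite cos_plus_2PI_IZR, cos_neg. reflexivity.
  - rewrite sin_plus_2PI_IZR, sin_neg. unfold Rdiv. ring.
Qed.

(** Partial sums converge at [alpha] and at [1 - alpha]. The reflection flips the sines and keeps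
    the cosines, so half the difference and half the sum give separate convergence of the two
    series. *)
Lemma log_gamma_fourier_expansion (alpha : R) : 0 < alpha < 1 ->
  ex_series (fun k => log_gamma_sin_term alpha (S k)) /\
  ex_series (fun k => log_gamma_cos_term alpha (S k)) /\
  log_gamma_normalized alpha
  = Series (fun k => log_gamma_sin_term alpha (S k)) + Series (fun k => log_gamma_cos_term alpha (S k)).
Proof.
  intros Ha. set (f := log_gamma_normalized alpha). set (g := log_gamma_normalized (1 - alpha)).
  assert (Hf := is_lim_seq_fourier_partial_sum alpha Ha).
  assert (Hg := is_lim_seq_fourier_partial_sum (1 - alpha) ltac:(lra)).
  fold f in Hf. fold g in Hg.
  assert (Hs : is_series (fun k => log_gamma_sin_term alpha (S k)) (1 / 2 * (f - g))).
  { apply is_series_psum.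
    apply (is_lim_seq_ext (fun N => 1 / 2 * (fourier_partial_sum N alpha - fourier_partial_sum N (1 - alpha)))).
    - intros N. rewrite fourier_partial_sum_reflect, fourier_partial_sum_split. field.
    - apply (is_lim_seq_scal_l _ (1 / 2) (f - g)). apply is_lim_seq_minus'; auto. }
  assert (Hc : is_series (fun k => log_gamma_cos_term alpha (S k)) (1 / 2 * (f + g))).
  { apply is_series_psum.
    apply (is_lim_seq_ext (fun N => 1 / 2 * (fourier_partial_sum N alpha + fourier_partial_sum N (1 - alpha)))).
    - intros N. rewrite fourier_partial_sum_reflect, fourier_partial_sum_split. field.
    - apply (is_lim_seq_scal_l _ (1 / 2) (f + g)). apply is_lim_seq_plus'; auto. }
  split; [eexists; exact Hs |]. split; [eexists; exact Hc |].
  rewrite (is_series_unique _ _ Hs), (is_series_unique _ _ Hc). field.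
Qed.

(** The improper integral is a limit over two independent endpoints; symmetric truncations, as small
    as wished, already approximate it. *)
Lemma J_approx (F : R -> R) (d e0 : R) : tame F -> 0 < d -> 0 < e0 ->
  exists e, 0 < e <= e0 /\ e <= 1 / 4 /\ Rabs (RInt F e (1 - e) - J F) < d.
Proof.
  intros HF Hd He0.
  generalize (proj1 (filterlimi_locally _ _) (tame_is_RInt_gen F HF) (mkposreal d Hd)).
  intros [Q P [dQ HQ] [dP HP] HQP].
  set (m := Rmin (Rmin dQ dP) (Rmin e0 (1 / 4))).
  assert (Hm : 0 < m) by (repeat apply Rmin_glb_lt; try apply cond_pos; lra).
  assert (Hm1 : m <= dQ) by (eapply Rle_trans; [apply Rmin_l | apply Rmin_l]).
  assert (Hm2 : m <= dP) by (eapply Rle_trans; [apply Rmin_l | apply Rmin_r]).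
  assert (Hm3 : m <= e0) by (eapply Rle_trans; [apply Rmin_r | apply Rmin_l]).
  assert (Hm4 : m <= 1 / 4) by (eapply Rle_trans; [apply Rmin_r | apply Rmin_r]).
  exists (m / 2). split; [lra |]. split; [lra |].
  destruct (HQP (m / 2) (1 - m / 2)) as [z [Hz1 Hz2]].
  - apply HQ; [| lra]. change (Rabs (m / 2 - 0) < dQ). rewrite Rabs_right; lra.
  - apply HP; [| lra]. change (Rabs (1 - m / 2 - 1) < dP). rewrite Rabs_left; lra.
  - simpl in Hz1. apply (is_RInt_unique (V := R_CompleteNormedModule)) in Hz1. rewrite Hz1.
    exact Hz2.
Qed.

Lemma ex_RInt_cont01 (F : R -> R) (a b : R) : cont01 F -> 0 < a < 1 -> 0 < b < 1 -> ex_RInt F a b.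
Proof.
  intros HF Ha Hb. apply (ex_RInt_continuous F). intros z Hz. apply HF.
  revert Hz. unfold Rmin, Rmax. destruct (Rle_dec a b); lra.
Qed.

(** An excess of the proper integral would contradict a truncation that contains [[a, b]] and
    approximates [J F] more closely than that excess. *)
Lemma RInt_le_J (F : R -> R) (a b : R) :
  tame F -> (forall x, 0 < x < 1 -> 0 <= F x) -> 0 < a -> a <= b -> b < 1 -> RInt F a b <= J F.
Proof.
  intros HF Hpos Ha Hab Hb. destruct (Rle_lt_dec (RInt F a b) (J F)) as [H|H]; [exact H |].
  destruct (J_approx F (RInt F a b - J F) (Rmin a (1 - b)) HF) as [e [He1 [He2 He3]]];
    [lra | apply Rmin_glb_lt; lra |].
  assert (Hea : e <= a) by (eapply Rle_trans; [apply He1 | apply Rmin_l]).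
  assert (Heb : e <= 1 - b) by (eapply Rle_trans; [apply He1 | apply Rmin_r]).
  assert (Hex : forall u v, 0 < u < 1 -> 0 < v < 1 -> ex_RInt F u v)
    by (intros; apply ex_RInt_cont01; auto; apply HF).
  assert (H1 : 0 <= RInt F e a) by (apply RInt_ge_0; [auto | apply Hex; lra | intros; apply Hpos; lra]).
  assert (H2 : 0 <= RInt F b (1 - e)) by (apply RInt_ge_0; [lra | apply Hex; lra | intros; apply Hpos; lra]).
  assert (E1 : RInt F e (1 - e) = plus (RInt F e a) (RInt F a (1 - e)))
    by (symmetry; apply (RInt_Chasles F); apply Hex; lra).
  assert (E2 : RInt F a (1 - e) = plus (RInt F a b) (RInt F b (1 - e)))
    by (symmetry; apply (RInt_Chasles F); apply Hex; lra).
  rewrite E1, E2 in He3.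
  change (Rabs (RInt F e a + (RInt F a b + RInt F b (1 - e)) - J F) < RInt F a b - J F) in He3.
  apply Rabs_def2 in He3. lra.
Qed.

Lemma root_tame_fourier_partial_sum (N : nat) : root_tame (fourier_partial_sum N).
Proof.
  apply (root_tame_psum (fun k => trig_block log_gamma_cos_coef log_gamma_sin_coef (S k))).
  intros; apply root_tame_trig_block.
Qed.

Lemma log_gamma_block_norm (k : nat) :
  1 / 2 * (log_gamma_cos_coef (S k) ^ 2 + log_gamma_sin_coef (S k) ^ 2)
  = 1 / 2 * log_gamma_parseval_term (S k).
Proof.
  generalize PI_RGT_0; intros Hpi. assert (0 < INR (S k)) by (apply lt_0_INR; lia).
  unfold log_gamma_cos_coef, log_gamma_sin_coef, log_gamma_parseval_term. field. split; lra.
Qed.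

Lemma J_log_gamma_block_product (i j : nat) :
  J (fun x => trig_block log_gamma_cos_coef log_gamma_sin_coef (S i) x
            * trig_block log_gamma_cos_coef log_gamma_sin_coef (S j) x)
  = if Nat.eqb i j then 1 / 2 * log_gamma_parseval_term (S i) else 0.
Proof.
  rewrite J_trig_block_product by lia. simpl Nat.eqb. rewrite log_gamma_block_norm. reflexivity.
Qed.

Lemma J_fourier_partial_sum_square (N : nat) :
  J (fun x => fourier_partial_sum N x * fourier_partial_sum N x)
  = psum (fun k => 1 / 2 * log_gamma_parseval_term (S k)) N.
Proof.
  apply (J_psum_square (fun k => trig_block log_gamma_cos_coef log_gamma_sin_coef (S k))).
  - intros; apply root_tame_trig_block.
  - intros i j Hij. rewrite J_log_gamma_block_product. apply Nat.eqb_neq in Hij. now rewrite Hij.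
  - intros i. rewrite J_log_gamma_block_product, Nat.eqb_refl. reflexivity.
Qed.

Lemma J_log_gamma_block (k : nat) :
  J (fun x => log_gamma_normalized x * trig_block log_gamma_cos_coef log_gamma_sin_coef (S k) x)
  = 1 / 2 * log_gamma_parseval_term (S k).
Proof.
  generalize PI_RGT_0; intros Hpi. assert (0 < INR (S k)) by (apply lt_0_INR; lia).
  assert (Hf := root_tame_log_gamma_normalized).
  rewrite (J_ext _ (fun x =>
     log_gamma_cos_coef (S k) * (log_gamma_normalized x * cos (2 * PI * INR (S k) * x))
     + log_gamma_sin_coef (S k) * (log_gamma_normalized x * sin (2 * PI * INR (S k) * x)))).
  - rewrite J_lincomb, J_log_gamma_cos, J_log_gamma_sin
      by (try lia; apply root_tame_mult; auto using root_tame_cos_2PI, root_tame_sin_2PI).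
    rewrite <- log_gamma_block_norm. unfold log_gamma_cos_coef, log_gamma_sin_coef. field. split; lra.
  - apply root_tame_mult; auto. apply root_tame_trig_block.
  - intros x _. unfold trig_block. ring.
Qed.

Lemma log_gamma_parseval_term_nonneg (k : nat) : 0 <= log_gamma_parseval_term (S k).
Proof.
  generalize (log_gamma_block_norm k), (pow2_ge_0 (log_gamma_cos_coef (S k))),
    (pow2_ge_0 (log_gamma_sin_coef (S k))). lra.
Qed.

Lemma log_gamma_bessel (m : nat) :
  psum (fun k => 1 / 2 * log_gamma_parseval_term (S k)) m
  <= J (fun x => log_gamma_normalized x * log_gamma_normalized x).
Proof.
  apply (bessel_inequality _ (fun k => trig_block log_gamma_cos_coef log_gamma_sin_coef (S k))).
  - apply root_tame_log_gamma_normalized.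
  - intros; apply root_tame_trig_block.
  - intros i j Hij. rewrite J_log_gamma_block_product. apply Nat.eqb_neq in Hij. now rewrite Hij.
  - intros i. rewrite J_log_gamma_block_product, Nat.eqb_refl. reflexivity.
  - apply J_log_gamma_block.
Qed.

Lemma RInt_psum_cont01 (w : nat -> R -> R) (a b : R) (m : nat) :
  (forall i, cont01 (w i)) -> 0 < a < 1 -> 0 < b < 1 ->
  is_RInt (fun x => psum (fun i => w i x) m) a b (psum (fun i => RInt (w i) a b) m).
Proof.
  intros Hw Ha Hb. induction m as [|m IH]; simpl.
  - generalize (is_RInt_const a b (0 : R)). change (scal (b - a) 0) with ((b - a) * 0).
    rewrite Rmult_0_r. auto.
  - apply (is_RInt_plus (fun x => psum (fun i => w i x) m) (w m)); [exact IH |].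
    apply (RInt_correct (w m)). apply ex_RInt_cont01; auto.
Qed.

Lemma cont01_fourier_error_square (N : nat) :
  cont01 (fun x => (fourier_partial_sum N x - log_gamma_normalized x) ^ 2).
Proof.
  intros x Hx.
  apply (continuous_comp (fun x => fourier_partial_sum N x - log_gamma_normalized x) (fun y => y ^ 2)).
  - apply cont01_minus; auto; [apply root_tame_fourier_partial_sum | apply cont01_log_gamma_normalized].
  - apply ex_derive_continuous_R. auto_derive. auto.
Qed.

Lemma fourier_error_RInt_limit (eps : R) : 0 < eps <= 1 / 4 ->
  is_lim_seq (fun N => RInt (fun x => (fourier_partial_sum N x - log_gamma_normalized x) ^ 2) eps (1 - eps)) 0.
Proof.
  intros He. destruct (fourier_error_square_sum eps ltac:(lra)) as [C HC].
  assert (Hc := cont01_fourier_error_square).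
  apply ex_series_lim_0. apply (ex_series_psum_bounded _ C).
  - intros n. apply RInt_ge_0; [lra | apply ex_RInt_cont01; auto; lra |].
    intros; apply pow2_ge_0.
  - intros m.
    assert (E := RInt_psum_cont01 _ eps (1 - eps) m Hc ltac:(lra) ltac:(lra)).
    assert (HC0 : 0 <= C).
    { eapply Rle_trans; [| apply (HC 0%nat eps); lra]. simpl. lra. }
    rewrite <- (is_RInt_unique _ _ _ _ E).
    eapply Rle_trans.
    + apply (RInt_le _ (fun _ => C)); [lra | eexists; exact E | eexists; apply is_RInt_const |].
      intros x Hx. apply HC. lra.
    + rewrite RInt_const. change ((1 - eps - eps) * C <= C). nra.
Qed.

Lemma log_gamma_RInt_square_le (eps Q : R) : 0 < eps <= 1 / 4 ->
  (forall N, psum (fun k => 1 / 2 * log_gamma_parseval_term (S k)) N <= Q) ->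
  RInt (fun x => log_gamma_normalized x * log_gamma_normalized x) eps (1 - eps) <= Q.
Proof.
  intros He HQ.
  set (A := RInt (fun x => log_gamma_normalized x * log_gamma_normalized x) eps (1 - eps)).
  assert (HQ0 : 0 <= Q) by (generalize (HQ 0%nat); simpl; lra).
  pose (r := fun N => RInt (fun x => (fourier_partial_sum N x - log_gamma_normalized x) ^ 2) eps (1 - eps)).
  assert (Hr : is_lim_seq r 0) by (apply fourier_error_RInt_limit, He).
  assert (Hf2 : ex_RInt (fun x => log_gamma_normalized x * log_gamma_normalized x) eps (1 - eps)).
  { apply ex_RInt_cont01; try lra. apply cont01_mult; apply cont01_log_gamma_normalized. }
  (* Young's inequality [f^2 <= (1 + eta) S^2 + (1 + 1/eta) (S - f)^2] is applied with [eta] fixed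
     while [N] grows, and [eta] is chosen last. *)
  assert (H1 : forall eta, 0 < eta -> A <= (1 + eta) * Q).
  { intros eta Heta.
    apply (is_lim_seq_le (fun _ => A) (fun N => (1 + eta) * Q + (1 + / eta) * r N) A ((1 + eta) * Q)).
    - intros N.
      assert (HS2 : ex_RInt (fun x => fourier_partial_sum N x * fourier_partial_sum N x) eps (1 - eps)).
      { apply ex_RInt_cont01; try lra. apply cont01_mult; apply root_tame_fourier_partial_sum. }
      assert (HE2 : ex_RInt (fun x => (fourier_partial_sum N x - log_gamma_normalized x) ^ 2) eps (1 - eps)).
      { apply ex_RInt_cont01; try lra. apply cont01_fourier_error_square. }
      assert (H : is_RInt (fun x => (1 + eta) * (fourier_partial_sum N x * fourier_partial_sum N x)
          + (1 + / eta) * (fourier_partial_sum N x - log_gamma_normalized x) ^ 2) eps (1 - eps)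
        ((1 + eta) * RInt (fun x => fourier_partial_sum N x * fourier_partial_sum N x) eps (1 - eps)
          + (1 + / eta) * r N)).
      { apply (is_RInt_plus (fun x => (1 + eta) * (fourier_partial_sum N x * fourier_partial_sum N x))).
        - apply (is_RInt_scal (fun x => fourier_partial_sum N x * fourier_partial_sum N x)).
          apply (RInt_correct (fun x => fourier_partial_sum N x * fourier_partial_sum N x)), HS2.
        - apply (is_RInt_scal (fun x => (fourier_partial_sum N x - log_gamma_normalized x) ^ 2)).
          apply (RInt_correct (fun x => (fourier_partial_sum N x - log_gamma_normalized x) ^ 2)), HE2. }
      assert (H2 : A <= (1 + eta) * RInt (fun x => fourier_partial_sum N x * fourier_partial_sum N x) eps (1 - eps)
          + (1 + / eta) * r N).
      { rewrite <- (is_RInt_unique _ _ _ _ H). apply RInt_le; [lra | exact Hf2 | eexists; exact H |].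
        intros x Hx. set (s := fourier_partial_sum N x). set (f := log_gamma_normalized x).
        assert (Hi : 0 < / eta) by (apply Rinv_0_lt_compat; auto).
        assert (E : (1 + eta) * (s * s) + (1 + / eta) * (s - f) ^ 2 - f * f
                    = / eta * (eta * s + (s - f)) ^ 2) by (field; lra).
        assert (0 <= / eta * (eta * s + (s - f)) ^ 2)
          by (apply Rmult_le_pos; [lra | apply pow2_ge_0]). lra. }
      assert (H3 : RInt (fun x => fourier_partial_sum N x * fourier_partial_sum N x) eps (1 - eps) <= Q).
      { eapply Rle_trans; [| apply (HQ N)]. rewrite <- J_fourier_partial_sum_square.
        apply RInt_le_J; try lra.
        - apply root_tame_mult; apply root_tame_fourier_partial_sum.
        - intros x _. nra. }
      nra.
    - apply is_lim_seq_const.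
    - replace (Finite ((1 + eta) * Q)) with (Finite ((1 + eta) * Q + (1 + / eta) * 0)) by (f_equal; ring).
      apply is_lim_seq_plus'; [apply is_lim_seq_const |].
      apply (is_lim_seq_scal_l _ (1 + / eta) 0), Hr. }
  (* This [eta] makes [eta * Q] at most half of the supposed excess [A - Q]; the denominator [Q + 1]
     admits [Q = 0]. *)
  apply Rnot_lt_le. intros H. generalize (H1 ((A - Q) / (2 * (Q + 1))) ltac:(apply Rdiv_lt_0_compat; lra)).
  intros H2. assert (H3 : (A - Q) / (2 * (Q + 1)) * Q <= (A - Q) / 2).
  { replace ((A - Q) / (2 * (Q + 1)) * Q) with ((A - Q) / 2 * (Q / (Q + 1))) by (field; lra).
    assert (Q / (Q + 1) <= 1).
    { apply (Rmult_le_reg_r (Q + 1)); [lra |]. unfold Rdiv. rewrite Rmult_assoc, Rinv_l; lra. }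
    nra. }
  lra.
Qed.

Lemma log_gamma_parseval :
  ex_series (fun k => log_gamma_parseval_term (S k)) /\
  J (fun x => log_gamma_normalized x * log_gamma_normalized x)
  = 1 / 2 * Series (fun k => log_gamma_parseval_term (S k)).
Proof.
  set (I := J (fun x => log_gamma_normalized x * log_gamma_normalized x)).
  destruct (ex_series_psum_bounded (fun k => 1 / 2 * log_gamma_parseval_term (S k)) I) as [Hex Hle].
  - intros n. generalize (log_gamma_parseval_term_nonneg n). lra.
  - apply log_gamma_bessel.
  - assert (Hex' : ex_series (fun k => log_gamma_parseval_term (S k))).
    { apply (ex_series_ext (fun k => 2 * (1 / 2 * log_gamma_parseval_term (S k)))).
      - intros n. change (2 * (1 / 2 * log_gamma_parseval_term (S n)) = log_gamma_parseval_term (S n) :> R).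
        field.
      - apply (ex_series_scal_l 2 (fun k => 1 / 2 * log_gamma_parseval_term (S k))), Hex. }
    split; [exact Hex' |]. rewrite Series_scal_l in Hle.
    apply Rle_antisym; [| exact Hle].
    apply Rnot_lt_le. intros H.
    set (Q := 1 / 2 * Series (fun k => log_gamma_parseval_term (S k))) in *.
    assert (Ht : tame (fun x => log_gamma_normalized x * log_gamma_normalized x))
      by (apply root_tame_mult; apply root_tame_log_gamma_normalized).
    destruct (J_approx _ (I - Q) 1 Ht ltac:(lra) Rlt_0_1) as [e [He1 [He2 He3]]].
    generalize (log_gamma_RInt_square_le e Q ltac:(lra)). intros H1.
    fold I in He3. apply Rabs_def2 in He3.
    enough (RInt (fun x => log_gamma_normalized x * log_gamma_normalized x) e (1 - e) <= Q) by lra.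
    apply H1. intros N. unfold Q. rewrite <- Series_scal_l.
    apply (psum_le_Series (fun k => 1 / 2 * log_gamma_parseval_term (S k))); [| exact Hex].
    intros n. generalize (log_gamma_parseval_term_nonneg n). lra.
Qed.

(** * Real integrals as complex-valued integrals *)

Lemma is_RInt_RtoC (f : R -> R) (a b l : R) :
  is_RInt f a b l -> is_RInt (V := C_R_NormedModule) (fun x => RtoC (f x)) a b (RtoC l).
Proof.
  intros H. apply (is_RInt_fct_extend_pair (U := R_NormedModule) (V := R_NormedModule) (fun x => RtoC (f x)) a b l 0).
  - exact H.
  - generalize (is_RInt_const a b (0 : R)). change (scal (b - a) 0) with ((b - a) * 0).
    rewrite Rmult_0_r. auto.
Qed.

Lemma is_RInt_gen_RtoC (f : R -> R) (Fa Fb : (R -> Prop) -> Prop) {HFa : Filter Fa} {HFb : Filter Fb} (l : R) :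
  is_RInt_gen f Fa Fb l -> is_RInt_gen (V := C_R_NormedModule) (fun x => RtoC (f x)) Fa Fb (RtoC l).
Proof.
  intros H. apply filterlimi_locally. intros eps.
  generalize (proj1 (filterlimi_locally _ _) H eps). apply filter_imp.
  intros ab [z [Hz1 Hz2]]. exists (RtoC z). split; [apply is_RInt_RtoC, Hz1 |].
  split; [exact Hz2 | apply ball_center].
Qed.

(** * Complex power series *)

Definition c_series (u : nat -> C) (l : C) : Prop :=
  is_series (K := C_AbsRing) (V := C_NormedModule) u l.

Definition c_pseries (a : nat -> C) (h l : C) : Prop :=
  is_pseries (K := C_AbsRing) (V := C_NormedModule) a h l.

Fixpoint csum (u : nat -> C) (m : nat) : C :=
  match m with O => RtoC 0 | S k => (csum u k + u k)%C end.

Lemma csum_S (u : nat -> C) (m : nat) : csum u (S m) = (csum u m + u m)%C.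
Proof. reflexivity. Qed.

Lemma sum_n_csum (u : nat -> C) (n : nat) : sum_n (G := C_NormedModule) u n = csum u (S n).
Proof.
  induction n as [|n IH].
  - rewrite sum_O. simpl. ring.
  - rewrite sum_Sn, IH. reflexivity.
Qed.

Lemma Cmod_minus_sym (x y : C) : Cmod (x - y) = Cmod (y - x).
Proof. rewrite <- Cmod_opp. f_equal. ring. Qed.

Lemma c_series_csum (u : nat -> C) (l : C) :
  c_series u l <-> is_lim_seq (fun N => Cmod (csum u N - l)) 0.
Proof.
  assert (H1 : c_series u l <-> is_lim_seq (fun n => Cmod (csum u (S n) - l)) 0).
  { unfold c_series, is_series. split; intros H.
    - apply is_lim_seq_spec. intros eps.
      generalize (proj1 (filterlim_locally_ball_norm _ _) H eps). apply filter_imp.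
      intros n Hn. rewrite sum_n_csum in Hn. change (Cmod (csum u (S n) - l) < eps) in Hn.
      rewrite Rminus_0_r, Rabs_right; [exact Hn | apply Rle_ge, Cmod_ge_0].
    - apply (filterlim_locally_ball_norm (U := C_NormedModule)). intros eps.
      apply is_lim_seq_spec in H. generalize (H eps). apply filter_imp.
      intros n Hn. rewrite Rminus_0_r, Rabs_right in Hn by apply Rle_ge, Cmod_ge_0.
      rewrite sum_n_csum. exact Hn. }
  rewrite H1. split; intros H.
  - now apply is_lim_seq_incr_1.
  - apply (is_lim_seq_incr_1 (fun n => Cmod (csum u n - l))), H.
Qed.

Lemma is_lim_seq_0_squeeze (u v : nat -> R) :
  (forall n, 0 <= u n <= v n) -> is_lim_seq v 0 -> is_lim_seq u 0.
Proof.
  intros H Hv. apply (is_lim_seq_le_le (fun _ => 0) _ v); [exact H | apply is_lim_seq_const | exact Hv].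
Qed.

Lemma c_series_unique (u : nat -> C) (l l' : C) : c_series u l -> c_series u l' -> l = l'.
Proof.
  intros H H'. apply c_series_csum in H. apply c_series_csum in H'.
  assert (E : is_lim_seq (fun _ : nat => Cmod (l' - l)) 0).
  { apply (is_lim_seq_0_squeeze _ (fun N => Cmod (csum u N - l) + Cmod (csum u N - l'))).
    - intros n. split; [apply Cmod_ge_0 |].
      rewrite (Cmod_minus_sym (csum u n) l').
      replace (l' - l)%C with ((csum u n - l) + (l' - csum u n))%C by ring. apply Cmod_triangle.
    - replace (Finite 0) with (Finite (0 + 0)) by (f_equal; ring). apply is_lim_seq_plus'; auto. }
  apply is_lim_seq_unique in E. rewrite Lim_seq_const in E. injection E. intros E'.
  apply Cmod_eq_0 in E'. replace l' with ((l' - l) + l)%C by ring. rewrite E'. ring.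
Qed.

Lemma c_series_ext (u v : nat -> C) (l : C) : (forall n, u n = v n) -> c_series u l -> c_series v l.
Proof. apply is_series_ext. Qed.

Lemma c_pseries_series (a : nat -> C) (h l : C) :
  c_pseries a h l <-> c_series (fun k => (h ^ k * a k)%C) l.
Proof.
  assert (E : forall k, pow_n (K := C_Ring) h k = (h ^ k)%C).
  { induction k as [|k IH]; [reflexivity |]. simpl. rewrite IH. reflexivity. }
  split; apply is_series_ext; intros k; rewrite <- E; reflexivity.
Qed.

(** The factor [1 - r ^ j] is the exact finite geometric sum, which is what the induction on [j]
    reproduces. *)
Lemma csum_geometric_bound (u : nat -> C) (M r : R) :
  0 <= r < 1 -> (forall k, Cmod (u k) <= M * r ^ k) ->
  forall K j, Cmod (csum u (K + j) - csum u K) <= M * r ^ K / (1 - r) * (1 - r ^ j).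
Proof.
  intros Hr Hu K j. induction j as [|j IH].
  - rewrite Nat.add_0_r. replace (csum u K - csum u K)%C with (RtoC 0) by ring.
    rewrite Cmod_0. simpl. lra.
  - rewrite Nat.add_succ_r, csum_S.
    replace (csum u (K + j) + u (K + j)%nat - csum u K)%C
      with ((csum u (K + j) - csum u K) + u (K + j)%nat)%C by ring.
    eapply Rle_trans; [apply Cmod_triangle |].
    eapply Rle_trans; [apply Rplus_le_compat; [exact IH | apply Hu] |].
    rewrite pow_add. simpl. right. field. lra.
Qed.

Lemma c_series_tail (u : nat -> C) (l : C) (M r : R) (K : nat) :
  0 <= r < 1 -> (forall k, Cmod (u k) <= M * r ^ k) -> c_series u l ->
  Cmod (l - csum u K) <= M * r ^ K / (1 - r).
Proof.
  intros Hr Hu Hl. apply c_series_csum in Hl.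
  assert (HM : 0 <= M) by (generalize (Hu 0%nat), (Cmod_ge_0 (u 0%nat)); simpl; lra).
  assert (Hb : 0 <= M * r ^ K / (1 - r)).
  { apply Rdiv_le_0_compat; [apply Rmult_le_pos; [auto | apply pow_le; lra] | lra]. }
  apply (is_lim_seq_le (fun _ => Cmod (l - csum u K))
    (fun j => Cmod (csum u (j + K) - l) + M * r ^ K / (1 - r)) (Cmod (l - csum u K)) (M * r ^ K / (1 - r))).
  - intros j. rewrite (Cmod_minus_sym (csum u (j + K))).
    replace (l - csum u K)%C with ((l - csum u (j + K)) + (csum u (j + K) - csum u K))%C by ring.
    eapply Rle_trans; [apply Cmod_triangle |]. apply Rplus_le_compat_l.
    rewrite Nat.add_comm. eapply Rle_trans; [apply (csum_geometric_bound u M r Hr Hu) |].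
    assert (0 <= r ^ j) by (apply pow_le; lra). nra.
  - apply is_lim_seq_const.
  - replace (Finite (M * r ^ K / (1 - r))) with (Finite (0 + M * r ^ K / (1 - r))) by (f_equal; ring).
    apply is_lim_seq_plus'; [| apply is_lim_seq_const].
    apply (is_lim_seq_incr_n (fun j => Cmod (csum u j - l)) K), Hl.
Qed.

Lemma csum_norm_le (u : nat -> C) (b : nat -> R) (m : nat) :
  (forall n, Cmod (u n) <= b n) -> Cmod (csum u m) <= psum b m.
Proof.
  intros H. induction m as [|m IH]; simpl; [rewrite Cmod_0; lra |].
  eapply Rle_trans; [apply Cmod_triangle |]. generalize (H m). lra.
Qed.

Lemma c_series_norm_le (u : nat -> C) (l : C) (b : nat -> R) :
  (forall n, Cmod (u n) <= b n) -> ex_series b -> c_series u l -> Cmod l <= Series b.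
Proof.
  intros H Hb Hl. apply c_series_csum in Hl.
  apply (is_lim_seq_le (fun _ => Cmod l) (fun N => Cmod (csum u N - l) + Series b) (Cmod l) (Series b)).
  - intros N. replace l with ((l - csum u N) + csum u N)%C at 1 by ring.
    eapply Rle_trans; [apply Cmod_triangle |]. rewrite (Cmod_minus_sym l).
    apply Rplus_le_compat_l. eapply Rle_trans; [apply csum_norm_le, H |].
    apply psum_le_Series; [| exact Hb]. intros n.
    generalize (H n), (Cmod_ge_0 (u n)). lra.
  - apply is_lim_seq_const.
  - replace (Finite (Series b)) with (Finite (0 + Series b)) by (f_equal; ring).
    apply is_lim_seq_plus'; [exact Hl | apply is_lim_seq_const].
Qed.

(** A total, componentwise sum, meaningful when the series converges; it lets the coefficients of a
    sum of expansions be named before convergence is proved. *)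
Definition csum_value (u : nat -> C) : C :=
  (Series (fun n => Re (u n)), Series (fun n => Im (u n))).

Lemma psum_Re (u : nat -> C) (m : nat) : psum (fun n => Re (u n)) m = Re (csum u m).
Proof. induction m as [|m IH]; [reflexivity | simpl; rewrite IH; reflexivity]. Qed.

Lemma psum_Im (u : nat -> C) (m : nat) : psum (fun n => Im (u n)) m = Im (csum u m).
Proof. induction m as [|m IH]; [reflexivity | simpl; rewrite IH; reflexivity]. Qed.

Lemma im_le_Cmod (c : C) : Rabs (Im c) <= Cmod c.
Proof. eapply Rle_trans; [apply Rmax_r | apply (Rmax_Cmod c)]. Qed.

Lemma is_lim_seq_of_error (u : nat -> R) (l : R) (e : nat -> R) :
  (forall n, Rabs (u n - l) <= e n) -> is_lim_seq e 0 -> is_lim_seq u l.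
Proof.
  intros H He. apply (is_lim_seq_ext (fun n => l + (u n - l))); [intros; ring |].
  replace (Finite l) with (Finite (l + 0)) by (f_equal; ring).
  apply is_lim_seq_plus'; [apply is_lim_seq_const |]. apply is_lim_seq_abs_0.
  apply (is_lim_seq_0_squeeze _ e); [| exact He]. intros n. split; [apply Rabs_pos | apply H].
Qed.

Lemma c_series_value (u : nat -> C) (l : C) : c_series u l -> csum_value u = l.
Proof.
  intros H. apply c_series_csum in H. unfold csum_value.
  rewrite (surjective_pairing l). f_equal; apply is_series_unique, is_series_psum.
  - apply (is_lim_seq_of_error _ _ (fun N => Cmod (csum u N - l))); [| exact H].
    intros n. rewrite psum_Re. apply (re_le_Cmod (csum u n - l)).
  - apply (is_lim_seq_of_error _ _ (fun N => Cmod (csum u N - l))); [| exact H].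
    intros n. rewrite psum_Im. apply (im_le_Cmod (csum u n - l)).
Qed.

Lemma ex_c_series (u : nat -> C) (b : nat -> R) :
  (forall n, Cmod (u n) <= b n) -> ex_series b -> c_series u (csum_value u).
Proof.
  intros H Hb.
  destruct (ex_series_le (K := C_AbsRing) (V := C_CompleteNormedModule) u b H Hb) as [l Hl].
  rewrite (c_series_value u l Hl). exact Hl.
Qed.

(* The coefficient bound takes the place of Cauchy's estimates when a series of such functions
   is expanded term by term. *)
Definition expands (f : C -> C) (s0 : C) (rho M : R) (c : nat -> C) : Prop :=
  (forall k, Cmod (c k) * rho ^ k <= M) /\
  (forall h, Cmod h < rho -> c_pseries c h (f (s0 + h)%C)).

Lemma expands_term_bound (c : nat -> C) (rho M : R) (h : C) (k : nat) :
  0 < rho -> Cmod (c k) * rho ^ k <= M -> Cmod (h ^ k * c k) <= M * (Cmod h / rho) ^ k.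
Proof.
  intros Hr H. rewrite Cmod_mult, Cmod_pow.
  assert (Hp : 0 < rho ^ k) by (apply pow_lt, Hr).
  replace (Cmod h ^ k * Cmod (c k)) with ((Cmod (c k) * rho ^ k) * (Cmod h / rho) ^ k).
  - apply Rmult_le_compat_r; [| exact H]. apply pow_le, Rdiv_le_0_compat; [apply Cmod_ge_0 | auto].
  - unfold Rdiv. rewrite Rpow_mult_distr, pow_inv. field. lra.
Qed.

Lemma ratio_bound (h : C) (rho : R) : Cmod h < rho -> 0 <= Cmod h / rho < 1.
Proof.
  intros H. generalize (Cmod_ge_0 h). intros H0. split; [apply Rdiv_le_0_compat; lra |].
  apply (Rmult_lt_reg_r rho); [lra |]. unfold Rdiv. rewrite Rmult_assoc, Rinv_l; lra.
Qed.

Lemma expands_tail (f : C -> C) (s0 : C) (rho M : R) (c : nat -> C) (h : C) (K : nat) :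
  expands f s0 rho M c -> Cmod h < rho ->
  Cmod (f (s0 + h)%C - csum (fun k => h ^ k * c k)%C K) <= M * (Cmod h / rho) ^ K / (1 - Cmod h / rho).
Proof.
  intros [Hc Hf] Hh.
  assert (Hr : 0 < rho) by (generalize (Cmod_ge_0 h); lra).
  apply c_series_tail; [apply ratio_bound, Hh | | apply c_pseries_series, Hf, Hh].
  intros k. apply expands_term_bound; auto.
Qed.

Lemma csum_exchange (a : nat -> nat -> C) (h : C) (N K : nat) :
  csum (fun k => h ^ k * csum (fun n => a n k) N)%C K
  = csum (fun n => csum (fun k => h ^ k * a n k)%C K) N.
Proof.
  induction N as [|N IH]; simpl.
  - induction K as [|K IHK]; simpl; [reflexivity | rewrite IHK; ring].
  - rewrite <- IH. clear IH. induction K as [|K IHK]; simpl; [ring | rewrite IHK; ring].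
Qed.

Lemma csum_minus (u v : nat -> C) (m : nat) :
  csum (fun n => u n - v n)%C m = (csum u m - csum v m)%C.
Proof. induction m as [|m IH]; simpl; [ring | rewrite IH; ring]. Qed.

Lemma csum_limit (u : nat -> nat -> C) (l : nat -> C) (h : C) (K : nat) :
  (forall k, is_lim_seq (fun N => Cmod (u N k - l k)) 0) ->
  is_lim_seq (fun N => Cmod (csum (fun k => h ^ k * u N k)%C K - csum (fun k => h ^ k * l k)%C K)) 0.
Proof.
  intros H. induction K as [|K IH]; simpl.
  - apply (is_lim_seq_ext (fun _ => 0)); [| apply is_lim_seq_const].
    intros _. replace (0 - 0)%C with (RtoC 0) by ring. now rewrite Cmod_0.
  - apply (is_lim_seq_0_squeeze _ (fun N =>
      Cmod (csum (fun k => h ^ k * u N k)%C K - csum (fun k => h ^ k * l k)%C K)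
      + Cmod (h ^ K) * Cmod (u N K - l K))).
    + intros N. split; [apply Cmod_ge_0 |]. rewrite <- Cmod_mult.
      eapply Rle_trans; [| apply Cmod_triangle]. right. f_equal. ring.
    + replace (Finite 0) with (Finite (0 + Cmod (h ^ K) * 0)) by (f_equal; ring).
      apply is_lim_seq_plus'; [exact IH |]. apply (is_lim_seq_scal_l _ (Cmod (h ^ K)) 0), H.
Qed.

(* Interchange of the two summations: the tail of order [K] of every [f n] is at most
   [M n] times a fixed geometric tail. *)
Lemma expands_series (f : nat -> C -> C) (F : C -> C) (s0 : C) (rho : R) (M : nat -> R)
  (c : nat -> nat -> C) :
  0 < rho -> (forall n, expands (f n) s0 rho (M n) (c n)) -> ex_series M ->
  (forall h, Cmod h < rho -> c_series (fun n => f n (s0 + h)%C) (F (s0 + h)%C)) ->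
  expands F s0 rho (Series M) (fun k => csum_value (fun n => c n k)) /\
  (forall k, c_series (fun n => c n k) (csum_value (fun n => c n k))).
Proof.
  intros Hr Hf HM HF.
  assert (Hck : forall n k, Cmod (c n k) <= M n * / rho ^ k).
  { intros n k. assert (Hp : 0 < rho ^ k) by (apply pow_lt, Hr).
    apply (Rmult_le_reg_r (rho ^ k)); [auto |]. rewrite Rmult_assoc, Rinv_l, Rmult_1_r by lra.
    apply (Hf n). }
  assert (HMk : forall k, ex_series (fun n => M n * / rho ^ k)) by (intros; apply ex_series_scal_r, HM).
  assert (HC : forall k, c_series (fun n => c n k) (csum_value (fun n => c n k)))
    by (intros k; apply (ex_c_series _ (fun n => M n * / rho ^ k)); auto).
  split; [| exact HC]. split.
  - intros k. assert (Hp : 0 < rho ^ k) by (apply pow_lt, Hr).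
    generalize (c_series_norm_le _ _ (fun n => M n * / rho ^ k) (fun n => Hck n k) (HMk k) (HC k)).
    rewrite Series_scal_r. intros H. apply (Rmult_le_compat_r (rho ^ k)) in H; [| lra].
    rewrite Rmult_assoc, Rinv_l, Rmult_1_r in H by lra. exact H.
  - intros h Hh. apply c_pseries_series, c_series_csum.
    set (r := Cmod h / rho). assert (Hr1 : 0 <= r < 1) by apply (ratio_bound h rho Hh).
    apply (is_lim_seq_0_squeeze _ (fun K => Series M * (r ^ K / (1 - r)))).
    + intros K. split; [apply Cmod_ge_0 |].
      rewrite Cmod_minus_sym. rewrite <- Series_scal_r.
      assert (Hpos : 0 <= r ^ K / (1 - r)) by (apply Rdiv_le_0_compat; [apply pow_le; lra | lra]).
      apply (c_series_norm_le (fun n => f n (s0 + h)%C - csum (fun k => h ^ k * c n k)%C K)%C).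
      * intros n. eapply Rle_trans; [apply (expands_tail _ _ _ _ _ _ K (Hf n) Hh) |].
        fold r. right. unfold Rdiv. ring.
      * apply ex_series_scal_r, HM.
      * apply c_series_csum. specialize (HF h Hh). apply c_series_csum in HF.
        apply (is_lim_seq_0_squeeze _ (fun N => Cmod (csum (fun n => f n (s0 + h)%C) N - F (s0 + h)%C)
          + Cmod (csum (fun k => h ^ k * csum (fun n => c n k) N)%C K
                  - csum (fun k => h ^ k * csum_value (fun n => c n k))%C K))).
        -- intros N. split; [apply Cmod_ge_0 |].
           rewrite csum_minus, <- csum_exchange.
           rewrite (Cmod_minus_sym (csum (fun k => h ^ k * csum (fun n => c n k) N)%C K)).
           eapply Rle_trans; [| apply Cmod_triangle]. right. f_equal. ring.
        -- replace (Finite 0) with (Finite (0 + 0)) by (f_equal; ring).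
           apply is_lim_seq_plus'; [exact HF |].
           apply (csum_limit (fun N k => csum (fun n => c n k) N)).
           intros k. apply c_series_csum, HC.
    + replace (Finite 0) with (Finite (Series M * (0 * / (1 - r)))) by (f_equal; ring).
      apply (is_lim_seq_scal_l _ (Series M) (0 * / (1 - r))).
      apply (is_lim_seq_scal_r _ (/ (1 - r)) 0). apply is_lim_seq_geom. rewrite Rabs_right; lra.
Qed.

Lemma expands_weaken (f : C -> C) (s0 : C) (rho M M' : R) (c : nat -> C) :
  M <= M' -> expands f s0 rho M c -> expands f s0 rho M' c.
Proof. intros HM [H1 H2]. split; [intros k; generalize (H1 k); lra | exact H2]. Qed.

(** Coefficients at [s0] of [s * f s], with [s = s0 + h]. *)
Definition shift_coef (s0 : C) (c : nat -> C) (k : nat) : C :=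
  (s0 * c k + match k with O => 0 | S j => c j end)%C.

Lemma expands_mult_id (f : C -> C) (s0 : C) (rho M : R) (c : nat -> C) :
  0 < rho -> expands f s0 rho M c ->
  expands (fun s => s * f s)%C s0 rho ((Cmod s0 + rho) * M) (shift_coef s0 c).
Proof.
  intros Hr [Hc Hf].
  assert (HM : 0 <= M).
  { generalize (Hc 0%nat), (Cmod_ge_0 (c 0%nat)). simpl. lra. }
  split.
  - intros k. unfold shift_coef. assert (0 <= rho ^ k) by (apply pow_le; lra).
    eapply Rle_trans; [apply Rmult_le_compat_r; [auto | apply Cmod_triangle] |].
    rewrite Cmod_mult, Rmult_plus_distr_r, Rmult_plus_distr_r. apply Rplus_le_compat.
    + rewrite Rmult_assoc. apply Rmult_le_compat_l; [apply Cmod_ge_0 | apply Hc].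
    + destruct k as [|j].
      * rewrite Cmod_0. nra.
      * simpl. replace (Cmod (c j) * (rho * rho ^ j)) with (rho * (Cmod (c j) * rho ^ j)) by ring.
        apply Rmult_le_compat_l; [lra | apply Hc].
  - intros h Hh.
    generalize (is_pseries_plus _ _ _ _ _
      (is_pseries_scal s0 c h _ (Cmult_comm h s0) (Hf h Hh)) (is_pseries_incr_1 c h _ (Hf h Hh))).
    intros H. replace ((s0 + h) * f (s0 + h))%C with (s0 * f (s0 + h) + h * f (s0 + h))%C by ring.
    revert H. apply is_series_ext. intros k. destruct k as [|k]; reflexivity.
Qed.

Lemma expands_scal (a : C) (f : C -> C) (s0 : C) (rho M : R) (c : nat -> C) :
  expands f s0 rho M c -> expands (fun s => a * f s)%C s0 rho (Cmod a * M) (fun k => a * c k)%C.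
Proof.
  intros [Hc Hf]. split.
  - intros k. rewrite Cmod_mult, Rmult_assoc. apply Rmult_le_compat_l; [apply Cmod_ge_0 | apply Hc].
  - intros h Hh. exact (is_pseries_scal a c h _ (Cmult_comm h a) (Hf h Hh)).
Qed.

(** Plain convergence yields a coefficient bound on half the radius: the terms at [h = r0 / 2] are
    eventually at most 2, both neighbouring partial sums being within 1 of the limit, and finitely
    many terms precede. *)
Lemma pseries_expands (f : C -> C) (s0 : C) (r0 : R) (c : nat -> C) :
  0 < r0 -> (forall h, Cmod h < r0 -> c_pseries c h (f (s0 + h)%C)) ->
  exists M, expands f s0 (r0 / 2) M c.
Proof.
  intros Hr0 Hf. set (rho := r0 / 2). assert (Hrho : 0 < rho < r0) by (unfold rho; lra).
  assert (Hs : c_series (fun k => (RtoC rho ^ k * c k)%C) (f (s0 + RtoC rho)%C)).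
  { apply c_pseries_series, Hf. rewrite Cmod_R, Rabs_right; lra. }
  apply c_series_csum in Hs. apply is_lim_seq_spec in Hs.
  destruct (Hs (mkposreal 1 Rlt_0_1)) as [N HN]. simpl in HN.
  exists (psum (fun k => Cmod (c k) * rho ^ k) N + 2). split; [| intros h Hh; apply Hf; lra].
  assert (Hnn : forall k, 0 <= Cmod (c k) * rho ^ k)
    by (intros; apply Rmult_le_pos; [apply Cmod_ge_0 | apply pow_le; lra]).
  assert (Hps : forall m k, (k < m)%nat -> Cmod (c k) * rho ^ k <= psum (fun k => Cmod (c k) * rho ^ k) m).
  { assert (Hp0 : forall m, 0 <= psum (fun k => Cmod (c k) * rho ^ k) m)
      by (intros m; induction m; simpl; [lra | generalize (Hnn m); lra]).
    intros m k Hk. induction m as [|m IHm]; [lia |]. rewrite psum_S.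
    destruct (Nat.eq_dec k m) as [->|Hne]; [generalize (Hp0 m); lra |].
    generalize (IHm ltac:(lia)), (Hnn m); lra. }
  intros k. destruct (Nat.lt_ge_cases k N) as [Hk|Hk]; [generalize (Hps N k Hk); lra |].
  assert (H1 := HN k Hk). assert (H2 := HN (S k) ltac:(lia)).
  rewrite Rminus_0_r, Rabs_right in H1, H2 by apply Rle_ge, Cmod_ge_0.
  assert (E : Cmod (c k) * rho ^ k = Cmod (RtoC rho ^ k * c k)%C).
  { rewrite Cmod_mult, Cmod_pow, Cmod_R, (Rabs_right rho) by lra. ring. }
  set (l := f (s0 + RtoC rho)%C) in *. rewrite csum_S in H2.
  assert (H3 : Cmod (RtoC rho ^ k * c k)%C <= 2).
  { set (S1 := csum (fun k => (RtoC rho ^ k * c k)%C) k) in *.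
    replace (RtoC rho ^ k * c k)%C with ((S1 + RtoC rho ^ k * c k - l) + (l - S1))%C by ring.
    eapply Rle_trans; [apply Cmod_triangle |]. rewrite (Cmod_minus_sym l S1). lra. }
  assert (Hp0 : 0 <= psum (fun k => Cmod (c k) * rho ^ k) N)
    by (clear - Hnn; induction N; simpl; [lra | generalize (Hnn N); lra]).
  lra.
Qed.

(* A non-vanishing leading coefficient would dominate the tail near [0]. *)
Lemma pseries_accumulating_zeros (f : C -> C) (s0 : C) (r0 : R) (c : nat -> C) :
  0 < r0 -> (forall h, Cmod h < r0 -> c_pseries c h (f (s0 + h)%C)) ->
  (forall eps, 0 < eps -> exists h : C, h <> RtoC 0 /\ Cmod h < eps /\ f (s0 + h)%C = RtoC 0) ->
  forall k, c k = RtoC 0.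
Proof.
  intros Hr0 Hf Hz. set (rho := r0 / 2). assert (Hrho : 0 < rho < r0) by (unfold rho; lra).
  destruct (pseries_expands f s0 r0 c Hr0 Hf) as [M HM]. fold rho in HM.
  assert (HM0 : 0 <= M).
  { destruct HM as [HM _]. generalize (HM 0%nat), (Cmod_ge_0 (c 0%nat)). simpl. lra. }
  intros k. induction k as [k IH] using Wf_nat.lt_wf_ind.
  assert (Hsum : forall h, csum (fun k => h ^ k * c k)%C k = 0).
  { intros h. assert (G : forall m, (m <= k)%nat -> csum (fun k => h ^ k * c k)%C m = 0).
    { induction m as [|m IHm]; intros Hm; [reflexivity |].
      rewrite csum_S, IHm, IH by lia. ring. }
    apply G. lia. }
  apply Cmod_eq_0. apply Rle_antisym; [| apply Cmod_ge_0].
  apply Rnot_lt_le. intros Hpos.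
  assert (Hp : 0 < rho ^ k) by (apply pow_lt; lra).
  (* The first bound makes [1 / (1 - x / rho)] at most 2, so that a zero at distance [x] forces
     [|c k| * rho^(k+1) <= 2 * M * x]; the second excludes this. [M + 1] covers [M = 0]. *)
  set (e := Rmin (rho / 2) (Cmod (c k) * rho ^ k * rho / (4 * (M + 1)))).
  assert (He : 0 < e).
  { apply Rmin_glb_lt; [lra |]. apply Rdiv_lt_0_compat; [| lra].
    repeat apply Rmult_lt_0_compat; lra. }
  destruct (Hz e He) as [h [Hh0 [Hhe Hfh]]].
  apply (proj1 (Cmod_gt_0 h)) in Hh0.
  assert (He1 : e <= rho / 2) by apply Rmin_l.
  assert (He2 : e <= Cmod (c k) * rho ^ k * rho / (4 * (M + 1))) by apply Rmin_r.
  generalize (expands_tail f s0 rho M c h (S k) HM ltac:(lra)).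
  rewrite csum_S, Hsum, Hfh. replace (0 - (0 + h ^ k * c k))%C with (- (h ^ k * c k))%C by ring.
  rewrite Cmod_opp, Cmod_mult, Cmod_pow. intros H.
  set (x := Cmod h) in *. set (a := Cmod (c k)) in *.
  assert (Hx : x / rho <= 1 / 2).
  { apply (Rmult_le_reg_r rho); [lra |]. unfold Rdiv at 1. rewrite Rmult_assoc, Rinv_l; lra. }
  assert (Hxk : 0 < x ^ k) by (apply pow_lt, Hh0).
  assert (H1 : M * (x / rho) ^ S k / (1 - x / rho) <= 2 * (M * (x / rho) ^ S k)).
  { assert (0 <= M * (x / rho) ^ S k)
      by (apply Rmult_le_pos; [auto | apply pow_le, Rdiv_le_0_compat; lra]).
    apply (Rmult_le_reg_r (1 - x / rho)); [lra |]. unfold Rdiv at 1.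
    rewrite Rmult_assoc, Rinv_l; nra. }
  assert (H2 : x ^ k * a <= 2 * (M * (x / rho) ^ S k)) by lra.
  replace ((x / rho) ^ S k) with (x ^ k * (x / (rho ^ k * rho))) in H2
    by (simpl; unfold Rdiv; rewrite Rpow_mult_distr, pow_inv; field; lra).
  assert (H3 : a <= 2 * M * (x / (rho ^ k * rho))).
  { apply (Rmult_le_reg_l (x ^ k)); [auto |]. lra. }
  apply (Rmult_le_compat_r (rho ^ k * rho)) in H3; [| nra].
  replace (2 * M * (x / (rho ^ k * rho)) * (rho ^ k * rho)) with (2 * M * x) in H3 by (field; lra).
  apply (Rmult_le_compat_r (4 * (M + 1))) in He2; [| lra].
  replace (a * rho ^ k * rho / (4 * (M + 1)) * (4 * (M + 1))) with (a * rho ^ k * rho) in He2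
    by (field; lra).
  assert (0 < a * (rho ^ k * rho)) by (repeat apply Rmult_lt_0_compat; lra).
  assert (x * (4 * (M + 1)) < e * (4 * (M + 1))) by (apply Rmult_lt_compat_r; lra).
  nra.
Qed.

(** * Euler-Maclaurin continuation *)

Lemma Cexp_plus (z w : C) : Cexp (z + w) = (Cexp z * Cexp w)%C.
Proof.
  unfold Cexp. destruct z as [a b], w as [c d]. simpl.
  rewrite exp_plus, cos_plus, sin_plus. unfold Cmult. simpl. f_equal; ring.
Qed.

Lemma Cmod_Cexp (z : C) : Cmod (Cexp z) = exp (Re z).
Proof.
  unfold Cexp, Cmod. simpl.
  replace (exp (Re z) * cos (Im z) * (exp (Re z) * cos (Im z) * 1)
     + exp (Re z) * sin (Im z) * (exp (Re z) * sin (Im z) * 1)) with (exp (Re z) ^ 2)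
    by (generalize (sin2_cos2 (Im z)); unfold Rsqr; intros E;
        replace (exp (Re z) ^ 2) with (exp (Re z) ^ 2 * (sin (Im z) * sin (Im z) + cos (Im z) * cos (Im z)))
          by (rewrite E; ring); ring).
  rewrite <- Rsqr_pow2. apply sqrt_Rsqr. left. apply exp_pos.
Qed.

Lemma Cexp_0 : Cexp 0 = 1.
Proof. unfold Cexp. simpl. rewrite exp_0, cos_0, sin_0. apply injective_projections; simpl; ring. Qed.

Lemma derivative_power_bound (f df : R -> R) (B t : R) (n : nat) :
  0 <= t -> f 0 = 0 -> (forall s, 0 <= s <= t -> is_derive f s (df s)) ->
  (forall s, 0 <= s <= t -> Rabs (df s) <= B * s ^ n) ->
  Rabs (f t) <= B / INR (S n) * t ^ S n.
Proof.
  intros Ht H0 Hf Hd. assert (Hn : 0 < INR (S n)) by (apply lt_0_INR; lia).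
  assert (Hp : forall s, is_derive (fun s => B / INR (S n) * s ^ S n) s (B * s ^ n)).
  { intros s. auto_derive; [auto |]. rewrite S_INR in *. simpl Init.Nat.pred.
    replace (match n with O => 1 | S _ => INR n + 1 end) with (INR (S n)) by reflexivity.
    rewrite S_INR. field. lra. }
  assert (E0 : B / INR (S n) * 0 ^ S n = 0) by (simpl; ring).
  apply Rabs_le. split.
  - enough (0 <= B / INR (S n) * t ^ S n + f t) by lra.
    apply (nonneg_derivative_nonneg (fun s => B / INR (S n) * s ^ S n + f s) (fun s => B * s ^ n + df s) t Ht).
    + intros s Hs. apply (is_derive_plus (fun s => B / INR (S n) * s ^ S n) f); auto.
    + intros s Hs. generalize (Hd s Hs). intros H. apply Rabs_le_between in H. lra.
    + rewrite E0, H0. ring.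
  - enough (0 <= B / INR (S n) * t ^ S n - f t) by lra.
    apply (nonneg_derivative_nonneg (fun s => B / INR (S n) * s ^ S n - f s) (fun s => B * s ^ n - df s) t Ht).
    + intros s Hs. apply (is_derive_minus (fun s => B / INR (S n) * s ^ S n) f); auto.
    + intros s Hs. generalize (Hd s Hs). intros H. apply Rabs_le_between in H. lra.
    + rewrite E0, H0. ring.
Qed.

(** Taylor polynomial of [exp(t z)] in the real variable [t], so that remainders can be estimated by
    real calculus on real and imaginary parts. *)
Definition exp_taylor (z : C) (n : nat) (t : R) : C :=
  csum (fun k => RtoC (t ^ k / INR (Factorial.fact k)) * z ^ k)%C n.

Lemma exp_taylor_S (z : C) (n : nat) (t : R) :
  exp_taylor z (S n) t = (exp_taylor z n t + RtoC (t ^ n / INR (Factorial.fact n)) * z ^ n)%C.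
Proof. reflexivity. Qed.

Lemma is_derive_exp_taylor (z : C) (n : nat) (t : R) :
  is_derive (fun t => Re (exp_taylor z (S n) t)) t (Re (z * exp_taylor z n t)%C) /\
  is_derive (fun t => Im (exp_taylor z (S n) t)) t (Im (z * exp_taylor z n t)%C).
Proof.
  induction n as [|n [IHr IHi]].
  - split.
    + apply (is_derive_ext (fun _ => 1)); [intros s; simpl; field |].
      replace (Re (z * exp_taylor z 0 t)%C) with 0 by (simpl; ring). auto_derive; auto.
    + apply (is_derive_ext (fun _ => 0)); [intros s; simpl; ring |].
      replace (Im (z * exp_taylor z 0 t)%C) with 0 by (simpl; ring). auto_derive; auto.
  - assert (Hm : is_derive (fun t => t ^ S n / INR (Factorial.fact (S n))) t (t ^ n / INR (Factorial.fact n))).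
    { generalize (INR_fact_neq_0 n), (lt_0_INR (S n) ltac:(lia)). intros Hf Hn.
      rewrite fact_simpl, mult_INR. set (m := INR (S n)) in *. set (F := INR (Factorial.fact n)) in *.
      auto_derive; [auto |]. simpl Init.Nat.pred. replace (match n with O => 1 | S _ => INR n + 1 end) with m by reflexivity. field. split; [auto | lra]. }
    split.
    + apply (is_derive_ext (fun t => Re (exp_taylor z (S n) t)
               + t ^ S n / INR (Factorial.fact (S n)) * Re (z ^ S n)%C)).
      { intros s. rewrite (exp_taylor_S z (S n)). unfold Cplus, Cmult. simpl. ring. }
      replace (Re (z * exp_taylor z (S n) t)%C) with
        (Re (z * exp_taylor z n t)%C + t ^ n / INR (Factorial.fact n) * Re (z ^ S n)%C)
        by (rewrite exp_taylor_S; unfold Cplus, Cmult, Re, Im; simpl; ring).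
      apply (is_derive_plus (fun t => Re (exp_taylor z (S n) t))); [exact IHr |].
      apply (is_derive_scal_l (fun t => t ^ S n / INR (Factorial.fact (S n))) t _ (Re (z ^ S n)%C) Hm).
    + apply (is_derive_ext (fun t => Im (exp_taylor z (S n) t)
               + t ^ S n / INR (Factorial.fact (S n)) * Im (z ^ S n)%C)).
      { intros s. rewrite (exp_taylor_S z (S n)). unfold Cplus, Cmult. simpl. ring. }
      replace (Im (z * exp_taylor z (S n) t)%C) with
        (Im (z * exp_taylor z n t)%C + t ^ n / INR (Factorial.fact n) * Im (z ^ S n)%C)
        by (rewrite exp_taylor_S; unfold Cplus, Cmult, Re, Im; simpl; ring).
      apply (is_derive_plus (fun t => Im (exp_taylor z (S n) t))); [exact IHi |].
      apply (is_derive_scal_l (fun t => t ^ S n / INR (Factorial.fact (S n))) t _ (Im (z ^ S n)%C) Hm).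
Qed.

Lemma is_derive_Cexp_line (z : C) (t : R) :
  is_derive (fun t => Re (Cexp (RtoC t * z)%C)) t (Re (z * Cexp (RtoC t * z))%C) /\
  is_derive (fun t => Im (Cexp (RtoC t * z)%C)) t (Im (z * Cexp (RtoC t * z))%C).
Proof.
  destruct z as [a b].
  assert (E : forall t, Cexp (RtoC t * (a, b)) = (exp (t * a) * cos (t * b), exp (t * a) * sin (t * b))).
  { intros u. unfold Cexp, Cmult, Re, Im. simpl.
    replace (u * a - 0 * b) with (u * a) by ring. replace (u * b + 0 * a) with (u * b) by ring.
    reflexivity. }
  rewrite E. split.
  - apply (is_derive_ext (fun t => exp (t * a) * cos (t * b))); [intros; now rewrite E |].
    unfold Cmult, Re. simpl. auto_derive; [auto | ring].
  - apply (is_derive_ext (fun t => exp (t * a) * sin (t * b))); [intros; now rewrite E |].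
    unfold Cmult, Im. simpl. auto_derive; [auto | ring].
Qed.

Lemma exp_taylor_at_0 (z : C) (n : nat) : exp_taylor z (S n) 0 = 1.
Proof.
  induction n as [|n IH].
  - unfold exp_taylor. simpl. replace (1 / 1) with 1 by field. ring.
  - rewrite exp_taylor_S, IH. replace (0 ^ S n / INR (Factorial.fact (S n))) with 0 by (rewrite pow_i by lia; unfold Rdiv; ring).
    ring.
Qed.

(** The derivative of a remainder is [z] times the preceding one. Treating real and imaginary parts
    separately costs a factor 2 at each step, which the factorial absorbs. *)
Lemma exp_taylor_error (z : C) (n : nat) (t : R) : 0 <= t <= 1 ->
  Rabs (Re (Cexp (RtoC t * z) - exp_taylor z n t)%C)
    <= exp (Cmod z) * (2 * Cmod z) ^ n / INR (Factorial.fact n) * t ^ n /\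
  Rabs (Im (Cexp (RtoC t * z) - exp_taylor z n t)%C)
    <= exp (Cmod z) * (2 * Cmod z) ^ n / INR (Factorial.fact n) * t ^ n.
Proof.
  set (E := exp (Cmod z)). revert t. induction n as [|n IH]; intros t Ht.
  - assert (H : Cmod (Cexp (RtoC t * z) - exp_taylor z 0 t)%C <= E).
    { unfold exp_taylor. simpl csum.
      replace (Cexp (RtoC t * z) - 0)%C with (Cexp (RtoC t * z)) by ring. rewrite Cmod_Cexp.
      assert (Hle : Re (RtoC t * z)%C <= Cmod z).
      { replace (Re (RtoC t * z)%C) with (t * Re z) by (simpl; unfold Re; ring).
        generalize (re_le_Cmod z), (Rle_abs (Re z)), (Cmod_ge_0 z). nra. }
      unfold E. destruct Hle as [Hle|Hle]; [left; apply exp_increasing, Hle | right; f_equal; exact Hle]. }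
    simpl (_ ^ 0). simpl (INR _). replace (E * 1 / 1 * 1) with E by field.
    split; eapply Rle_trans; [apply re_le_Cmod | exact H | apply im_le_Cmod | exact H].
  - set (B := E * (2 * Cmod z) ^ n / INR (Factorial.fact n)) in *.
    assert (EB : E * (2 * Cmod z) ^ S n / INR (Factorial.fact (S n)) = (2 * Cmod z * B) / INR (S n)).
    { unfold B. rewrite fact_simpl, mult_INR. simpl (_ ^ S n).
      generalize (INR_fact_neq_0 n), (lt_0_INR (S n) ltac:(lia)). intros. field. split; [auto | lra]. }
    rewrite EB.
    assert (Hz : forall w b, Rabs (Re w) <= b -> Rabs (Im w) <= b ->
      Rabs (Re (z * w)%C) <= 2 * Cmod z * b /\ Rabs (Im (z * w)%C) <= 2 * Cmod z * b).
    { intros w b Hr Hi. generalize (re_le_Cmod z), (im_le_Cmod z). intros Hzr Hzi.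
      assert (Hb : 0 <= b) by (eapply Rle_trans; [apply Rabs_pos | exact Hr]).
      assert (H1 : forall u v, Rabs u <= Cmod z -> Rabs v <= b -> Rabs (u * v) <= Cmod z * b)
        by (intros; rewrite Rabs_mult; apply Rmult_le_compat; auto using Rabs_pos).
      generalize (H1 _ _ Hzr Hr), (H1 _ _ Hzi Hi), (H1 _ _ Hzr Hi), (H1 _ _ Hzi Hr).
      intros G1 G2 G3 G4. apply Rabs_le_between in G1, G2, G3, G4.
      unfold Cmult. unfold Re, Im in *. simpl. split; apply Rabs_le; lra. }
    assert (Hi0 : Cexp (RtoC 0 * z) = 1) by (replace (RtoC 0 * z)%C with (RtoC 0) by ring; apply Cexp_0).
    split.
    + apply (derivative_power_bound (fun t => Re (Cexp (RtoC t * z) - exp_taylor z (S n) t)%C)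
               (fun t => Re (z * (Cexp (RtoC t * z) - exp_taylor z n t))%C)); [lra | | |].
      * rewrite exp_taylor_at_0, Hi0. simpl. ring.
      * intros s Hs. replace (Re (z * (Cexp (RtoC s * z) - exp_taylor z n s))%C)
          with (Re (z * Cexp (RtoC s * z))%C - Re (z * exp_taylor z n s)%C)
          by (unfold Cmult, Cminus, Cplus, Copp, Re, Im; simpl; ring).
        apply (is_derive_minus (fun t => Re (Cexp (RtoC t * z)%C)) (fun t => Re (exp_taylor z (S n) t)));
          [apply is_derive_Cexp_line | apply is_derive_exp_taylor].
      * intros s Hs. destruct (IH s ltac:(lra)) as [Hr Hi].
        rewrite Rmult_assoc. apply Hz; auto.
    + apply (derivative_power_bound (fun t => Im (Cexp (RtoC t * z) - exp_taylor z (S n) t)%C)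
               (fun t => Im (z * (Cexp (RtoC t * z) - exp_taylor z n t))%C)); [lra | | |].
      * rewrite exp_taylor_at_0, Hi0. simpl. ring.
      * intros s Hs. replace (Im (z * (Cexp (RtoC s * z) - exp_taylor z n s))%C)
          with (Im (z * Cexp (RtoC s * z))%C - Im (z * exp_taylor z n s)%C)
          by (unfold Cmult, Cminus, Cplus, Copp, Re, Im; simpl; ring).
        apply (is_derive_minus (fun t => Im (Cexp (RtoC t * z)%C)) (fun t => Im (exp_taylor z (S n) t)));
          [apply is_derive_Cexp_line | apply is_derive_exp_taylor].
      * intros s Hs. destruct (IH s ltac:(lra)) as [Hr Hi].
        rewrite Rmult_assoc. apply Hz; auto.
Qed.

Definition exp_coef (k : nat) : R := / INR (Factorial.fact k).

Lemma Cmod_le_Re_Im (z : C) : Cmod z <= Rabs (Re z) + Rabs (Im z).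
Proof.
  rewrite <- !Cmod_R.
  replace (Cmod (RtoC (Im z))) with (Cmod (Ci * RtoC (Im z))) by (rewrite Cmod_mult, Cmod_Ci; ring).
  replace z with (RtoC (Re z) + Ci * RtoC (Im z))%C at 1; [apply Cmod_triangle |].
  destruct z as [a b]. unfold Cplus, Cmult, Ci. simpl. f_equal; ring.
Qed.

Lemma c_pseries_Cexp (z : C) : c_pseries (fun k => RtoC (exp_coef k)) z (Cexp z).
Proof.
  apply c_pseries_series.
  apply (c_series_ext (fun k => RtoC (1 ^ k / INR (Factorial.fact k)) * z ^ k)%C).
  { intros k. rewrite pow1. unfold exp_coef, Rdiv. rewrite Rmult_1_l. ring. }
  apply c_series_csum.
  apply (is_lim_seq_0_squeeze _ (fun n => 2 * exp (Cmod z) * ((2 * Cmod z) ^ n / INR (Factorial.fact n)))).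
  - intros n. split; [apply Cmod_ge_0 |]. rewrite Cmod_minus_sym.
    destruct (exp_taylor_error z n 1 ltac:(lra)) as [Hr Hi].
    rewrite pow1, Rmult_1_r in Hr, Hi. fold (exp_taylor z n 1).
    replace (Cexp z) with (Cexp (RtoC 1 * z)) by (f_equal; ring).
    eapply Rle_trans; [apply Cmod_le_Re_Im |]. lra.
  - replace (Finite 0) with (Finite (2 * exp (Cmod z) * 0)) by (f_equal; ring).
    apply (is_lim_seq_scal_l _ (2 * exp (Cmod z)) 0).
    apply is_lim_seq_Reals, cv_speed_pow_fact.
Qed.

Lemma pow_fact_le_exp (y : R) (k : nat) : 0 <= y -> y ^ k * exp_coef k <= exp y.
Proof.
  intros Hy. eapply Rle_trans; [| apply (exp_ge_taylor y k Hy)]. unfold exp_coef.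
  assert (Hp : forall k, 0 <= y ^ k / INR (Factorial.fact k)).
  { intros. apply Rdiv_le_0_compat; [apply pow_le, Hy | apply INR_fact_lt_0]. }
  destruct k as [|k]; [right; reflexivity |]. rewrite tech5.
  generalize (cond_pos_sum _ k Hp). unfold Rdiv. lra.
Qed.

(** * Trapezoidal terms and their sum *)

Definition neg_power (x : R) (s : C) : C := Cpow_pos x (- s)%C.

Lemma neg_power_plus (x : R) (s h : C) :
  neg_power x (s + h) = (neg_power x s * Cexp (RtoC (- ln x) * h))%C.
Proof.
  unfold neg_power, Cpow_pos. rewrite <- Cexp_plus. f_equal. rewrite RtoC_opp. ring.
Qed.

Lemma Cmod_neg_power (x : R) (s : C) : Cmod (neg_power x s) = exp (- Re s * ln x).
Proof. unfold neg_power, Cpow_pos. rewrite Cmod_Cexp. f_equal. simpl. unfold Re, Im. ring. Qed.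

Definition neg_power_coef (x : R) (s0 : C) (k : nat) : C :=
  (neg_power x s0 * (RtoC (- ln x) ^ k * RtoC (exp_coef k)))%C.

Lemma expands_neg_power (x : R) (s0 : C) (rho : R) : 0 < rho ->
  expands (neg_power x) s0 rho (exp (- Re s0 * ln x) * exp (Rabs (ln x) * rho)) (neg_power_coef x s0).
Proof.
  intros Hr. split.
  - intros k. unfold neg_power_coef. rewrite !Cmod_mult, Cmod_pow, !Cmod_R, Rabs_Ropp, Cmod_neg_power.
    rewrite (Rabs_right (exp_coef k)) by (apply Rle_ge, Rlt_le, Rinv_0_lt_compat, INR_fact_lt_0).
    rewrite Rmult_assoc. apply Rmult_le_compat_l; [left; apply exp_pos |].
    replace (Rabs (ln x) ^ k * exp_coef k * rho ^ k) with ((Rabs (ln x) * rho) ^ k * exp_coef k)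
      by (rewrite Rpow_mult_distr; ring).
    apply pow_fact_le_exp, Rmult_le_pos; [apply Rabs_pos | lra].
  - intros h _. rewrite neg_power_plus.
    assert (H := proj1 (c_pseries_series _ _ _) (c_pseries_Cexp (RtoC (- ln x) * h)%C)).
    apply c_pseries_series.
    apply (c_series_ext (fun k => neg_power x s0 * ((RtoC (- ln x) * h) ^ k * RtoC (exp_coef k)))%C).
    + intros k. unfold neg_power_coef. rewrite Cpow_mult_l. ring.
    + exact (is_series_scal (V := C_NormedModule) (neg_power x s0) _ _ H).
Qed.

Definition em_poly (x : R) (j : nat) : R :=
  match j with O => x + 1 / 2 | S O => - (1 / 2) | _ => 0 end.

(* Coefficients of the entire function [em_bracket x]; the Euler-Maclaurin cancellation makes
   all of them O(1/x^2). *)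
Definition em_coef (x : R) (j : nat) : R :=
  let d := ln (x + 1) - ln x in
  em_poly x j - (x + 1 / 2) * ((- d) ^ j * exp_coef j)
  - 1 / 2 * match j with O => 0 | S i => (- d) ^ i * exp_coef i end.

Definition em_bracket (x : R) (s : C) : C :=
  (RtoC (x + 1 / 2) - RtoC (1 / 2) * s
   - (RtoC (x + 1 / 2) + RtoC (1 / 2) * s) * Cexp (RtoC (- (ln (x + 1) - ln x)) * s))%C.

Lemma c_series_finite (u : nat -> C) (K : nat) :
  (forall k, (K <= k)%nat -> u k = RtoC 0) -> c_series u (csum u K).
Proof.
  intros H. apply c_series_csum.
  apply (is_lim_seq_ext_loc (fun _ => 0)); [| apply is_lim_seq_const].
  exists K. intros n Hn. assert (E : csum u n = csum u K).
  { induction Hn as [|n Hn IH]; [reflexivity |]. rewrite csum_S, IH, H by exact Hn. ring. }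
  rewrite E. replace (csum u K - csum u K)%C with (RtoC 0) by ring. now rewrite Cmod_0.
Qed.

Lemma c_pseries_em_bracket (x : R) (s : C) :
  c_pseries (fun j => RtoC (em_coef x j)) s (em_bracket x s).
Proof.
  set (d := ln (x + 1) - ln x).
  assert (He : c_pseries (fun j => RtoC ((- d) ^ j * exp_coef j)) s (Cexp (RtoC (- d) * s))).
  { apply c_pseries_series.
    apply (c_series_ext (fun k => (RtoC (- d) * s) ^ k * RtoC (exp_coef k))%C).
    - intros k. rewrite Cpow_mult_l, RtoC_mult, RtoC_pow. ring.
    - apply (proj1 (c_pseries_series _ _ _)), c_pseries_Cexp. }
  assert (Hp : c_pseries (fun j => RtoC (em_poly x j)) s (RtoC (x + 1 / 2) - RtoC (1 / 2) * s)%C).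
  { apply c_pseries_series.
    replace (RtoC (x + 1 / 2) - RtoC (1 / 2) * s)%C
      with (csum (fun k => s ^ k * RtoC (em_poly x k))%C 2).
    - apply c_series_finite. intros [|[|k]] Hk; try lia. simpl. ring.
    - simpl. rewrite RtoC_opp. ring. }
  assert (H1 := is_pseries_scal (V := C_NormedModule) (RtoC (x + 1 / 2)) _ _ _ (Cmult_comm _ _) He).
  assert (H2 := is_pseries_scal (V := C_NormedModule) (RtoC (1 / 2)) _ _ _ (Cmult_comm _ _)
                  (is_pseries_incr_1 _ _ _ He)).
  assert (H := is_pseries_minus _ _ _ _ _ (is_pseries_minus _ _ _ _ _ Hp H1) H2).
  unfold em_bracket. fold d.
  match type of H with is_pseries _ _ ?l =>
    replace (RtoC (x + 1 / 2) - RtoC (1 / 2) * s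
      - (RtoC (x + 1 / 2) + RtoC (1 / 2) * s) * Cexp (RtoC (- d) * s))%C with l end.
  - revert H. apply is_series_ext. intros k. f_equal.
    unfold em_coef. fold d. rewrite !RtoC_minus, !RtoC_mult.
    destruct k as [|k]; simpl.
    + change (RtoC (x + 1 / 2) - RtoC (x + 1 / 2) * RtoC (1 * exp_coef 0) - RtoC (1 / 2) * RtoC 0
       = RtoC (x + 1 / 2) - RtoC (x + 1 / 2) * (RtoC 1 * RtoC (exp_coef 0)) - RtoC (1 / 2) * RtoC 0)%C.
      rewrite RtoC_mult. ring.
    + change (RtoC (em_poly x (S k)) - RtoC (x + 1 / 2) * RtoC (- d * (- d) ^ k * exp_coef (S k))
         - RtoC (1 / 2) * RtoC ((- d) ^ k * exp_coef k)
       = RtoC (em_poly x (S k)) - RtoC (x + 1 / 2) * (RtoC (- d * (- d) ^ k) * RtoC (exp_coef (S k)))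
         - RtoC (1 / 2) * (RtoC ((- d) ^ k * exp_coef k)))%C.
      rewrite !RtoC_mult. ring.
  - change (RtoC (x + 1 / 2) - RtoC (1 / 2) * s + - (RtoC (x + 1 / 2) * Cexp (RtoC (- d) * s))
      + - (RtoC (1 / 2) * (s * Cexp (RtoC (- d) * s)))
      = RtoC (x + 1 / 2) - RtoC (1 / 2) * s
        - (RtoC (x + 1 / 2) + RtoC (1 / 2) * s) * Cexp (RtoC (- d) * s))%C.
    ring.
Qed.

(** Coefficients of [z * exp z]: a majorant summable against every power [A ^ j], with the decay in
    [x] factored out. *)
Definition em_coef_bound (j : nat) : R := match j with O => 0 | S i => exp_coef i end.

Lemma em_coef_0 (x : R) : em_coef x 0 = 0.
Proof. unfold em_coef, em_poly, exp_coef. simpl. field. Qed.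

(** This identity is where Stirling's series enters the derivative of zeta at 0. *)
Lemma em_coef_1 (x : R) : em_coef x 1 = stirling_defect x.
Proof. unfold em_coef, em_poly, exp_coef, stirling_defect. simpl. field. Qed.

Lemma em_coef_le (x : R) (j : nat) : 1 <= x -> Rabs (em_coef x j) <= / x ^ 2 * em_coef_bound j.
Proof.
  intros Hx. assert (Hx2 : 0 < x ^ 2) by (apply pow_lt; lra).
  assert (Hi : 0 < / x <= 1).
  { split; [apply Rinv_0_lt_compat; lra |]. rewrite <- Rinv_1. apply Rinv_le_contravar; lra. }
  assert (Ei : / x ^ 2 = / x * / x) by (field; lra).
  generalize (ln_step_bounds x ltac:(lra)). intros Hstep.
  assert (Hx1 : 0 < / (x + 1)) by (apply Rinv_0_lt_compat; lra).
  set (d := ln (x + 1) - ln x) in *.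
  assert (Hd : 0 < d <= / x) by lra.
  assert (Hs : 0 <= stirling_defect x <= / x ^ 2).
  { generalize (stirling_defect_bounds x ltac:(lra)). intros H. split; [apply H |].
    eapply Rle_trans; [apply H |]. rewrite Ei.
    replace (/ x - / (x + 1)) with (/ x * / (x + 1)) by (field; lra).
    assert (/ (x + 1) <= / x) by (apply Rinv_le_contravar; lra). nra. }
  (* Orders 1 and 2 need the cancellation and reduce to [stirling_defect]; from order 3 on, the
     power [d^(j-1)] alone is at most [1 / x^2]. *)
  destruct j as [|[|[|j]]].
  - rewrite em_coef_0, Rabs_R0. simpl. lra.
  - rewrite em_coef_1. simpl. unfold exp_coef. simpl. rewrite Rinv_1, Rmult_1_r.
    rewrite Rabs_right; simpl in *; lra.
  - replace (em_coef x 2) with (- (d / 2) * stirling_defect x)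
      by (unfold em_coef, em_poly, exp_coef, stirling_defect; fold d; simpl; field).
    unfold em_coef_bound, exp_coef. simpl (INR _). rewrite Rinv_1, Rmult_1_r.
    rewrite Rabs_mult, Rabs_Ropp, !Rabs_right by lra. nra.
  - assert (E : em_coef x (S (S (S j)))
      = (- d) ^ S (S j) * exp_coef (S (S j)) * (d * (x + 1 / 2) / INR (S (S (S j))) - 1 / 2)).
    { unfold em_coef, em_poly. fold d. unfold exp_coef.
      rewrite (fact_simpl (S (S j))), mult_INR.
      generalize (INR_fact_neq_0 (S (S j))), (lt_0_INR (S (S (S j))) ltac:(lia)). intros H1 H2.
      change ((- d) ^ S (S (S j))) with (- d * (- d) ^ S (S j)). field. split; [lra | exact H1]. }
    rewrite E, !Rabs_mult. unfold em_coef_bound.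
    assert (Hc : 0 < exp_coef (S (S j))) by (apply Rinv_0_lt_compat, INR_fact_lt_0).
    rewrite (Rabs_right (exp_coef (S (S j)))) by lra.
    rewrite <- RPow_abs, Rabs_Ropp, (Rabs_right d) by lra.
    assert (H1 : d ^ S (S j) <= / x ^ 2).
    { change (d ^ S (S j)) with (d * (d * d ^ j)).
      assert (0 <= d ^ j <= 1).
      { split; [apply pow_le; lra |]. rewrite <- (pow1 j). apply pow_incr. lra. }
      rewrite Ei. assert (0 <= d * d ^ j <= / x) by nra. nra. }
    assert (H2 : Rabs (d * (x + 1 / 2) / INR (S (S (S j))) - 1 / 2) <= 1).
    { assert (H3 : 3 <= INR (S (S (S j)))) by (rewrite !S_INR; generalize (pos_INR j); lra).
      assert (H4 : 0 <= d * (x + 1 / 2) <= 3 / 2).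
      { split; [nra |]. assert (d * x <= 1).
        { replace 1 with (/ x * x) by (field; lra). apply Rmult_le_compat_r; lra. }
        nra. }
      assert (H5 : 0 <= d * (x + 1 / 2) / INR (S (S (S j))) <= 1 / 2).
      { split; [apply Rdiv_le_0_compat; lra |].
        apply (Rmult_le_reg_r (INR (S (S (S j))))); [lra |].
        unfold Rdiv. rewrite Rmult_assoc, Rinv_l; lra. }
      apply Rabs_le. lra. }
    assert (0 <= d ^ S (S j)) by (apply pow_le; lra).
    replace (/ x ^ 2 * exp_coef (S (S j))) with (/ x ^ 2 * exp_coef (S (S j)) * 1) by ring.
    apply Rmult_le_compat; [apply Rmult_le_pos; lra | apply Rabs_pos | | exact H2].
    apply Rmult_le_compat_r; lra.
Qed.

Lemma ex_series_em_coef_bound (A : R) : ex_series (fun j => em_coef_bound j * A ^ j).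
Proof.
  apply (ex_series_incr_1 (K := R_AbsRing) (V := R_NormedModule) (fun j => em_coef_bound j * A ^ j)).
  apply (ex_series_ext (fun k => A * (A ^ k * exp_coef k))).
  - intros k. simpl. apply Rminus_diag_uniq. ring.
  - apply (ex_series_scal_l A (fun k => A ^ k * exp_coef k)).
    exists (exp A). generalize (is_exp_Reals A). apply is_series_ext.
    intros k. rewrite pow_n_pow. reflexivity.
Qed.

Lemma c_pseries_minus (a b : nat -> C) (h l m : C) :
  c_pseries a h l -> c_pseries b h m -> c_pseries (fun k => a k - b k)%C h (l - m)%C.
Proof. exact (is_pseries_minus a b h l m). Qed.

Lemma c_pseries_plus (a b : nat -> C) (h l m : C) :
  c_pseries a h l -> c_pseries b h m -> c_pseries (fun k => a k + b k)%C h (l + m)%C.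
Proof. exact (is_pseries_plus a b h l m). Qed.

Lemma c_pseries_scal (z : C) (a : nat -> C) (h l : C) :
  c_pseries a h l -> c_pseries (fun k => z * a k)%C h (z * l)%C.
Proof. exact (is_pseries_scal z a h l (Cmult_comm h z)). Qed.

(** Coefficients at [s0] of [(s - 1) * f s]. *)
Definition pred_coef (s0 : C) (c : nat -> C) (k : nat) : C := (shift_coef s0 c k - c k)%C.

Lemma c_pseries_pred_mult (s0 : C) (c : nat -> C) (h l : C) :
  c_pseries c h l -> c_pseries (pred_coef s0 c) h ((s0 + h - 1) * l)%C.
Proof.
  intros H.
  replace ((s0 + h - 1) * l)%C with ((s0 * l + h * l) - l)%C by ring.
  apply c_pseries_minus; [| exact H].
  generalize (is_pseries_plus _ _ _ _ _
      (is_pseries_scal s0 c h _ (Cmult_comm h s0) H) (is_pseries_incr_1 c h _ H)).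
  apply is_series_ext. intros k. destruct k as [|k]; reflexivity.
Qed.

Lemma neg_power_succ (x : R) (s : C) :
  neg_power (x + 1) s = (neg_power x s * Cexp (RtoC (- (ln (x + 1) - ln x)) * s))%C.
Proof.
  unfold neg_power, Cpow_pos. rewrite <- Cexp_plus. f_equal.
  rewrite RtoC_opp, RtoC_minus. ring.
Qed.

(* Up to the factor [1 - s], the error of the trapezoidal rule for [u^{-s}] on [[x, x + 1]]. *)
Definition em_term (x : R) (s : C) : C :=
  (neg_power x s * (RtoC (x + 1 / 2) - RtoC (1 / 2) * s)
   - neg_power (x + 1) s * (RtoC (x + 1 / 2) + RtoC (1 / 2) * s))%C.

(** [em_term] is the sum over [j] of [em_coef x j * s^j * x^(-s)], and each factor [s] acts on
    coefficients at [s0] by one [shift_coef]. *)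
Definition em_term_coef (x : R) (s0 : C) (k : nat) : C :=
  csum_value (fun j => RtoC (em_coef x j) * Nat.iter j (shift_coef s0) (neg_power_coef x s0) k)%C.

Lemma expands_ext (f g : C -> C) (s0 : C) (rho M : R) (c : nat -> C) :
  (forall s, f s = g s) -> expands f s0 rho M c -> expands g s0 rho M c.
Proof. intros H [H1 H2]. split; [exact H1 |]. intros h Hh. rewrite <- H. auto. Qed.

Lemma expands_pow_mult (f : C -> C) (s0 : C) (rho M : R) (c : nat -> C) (j : nat) :
  0 < rho -> expands f s0 rho M c ->
  expands (fun s => s ^ j * f s)%C s0 rho ((Cmod s0 + rho) ^ j * M) (Nat.iter j (shift_coef s0) c).
Proof.
  intros Hr Hf. induction j as [|j IH].
  - simpl. rewrite Rmult_1_l. revert Hf. apply expands_ext. intros; ring.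
  - simpl Nat.iter. simpl (_ ^ S j). rewrite Rmult_assoc.
    apply (expands_ext (fun s => s * (s ^ j * f s))%C); [intros; simpl; ring |].
    apply expands_mult_id; auto.
Qed.

(** [5/2] bounds [|s|] on discs of radius [1/2] with centre of modulus at most 2. *)
Definition em_constant : R := Series (fun j => em_coef_bound j * (5 / 2) ^ j).

(** On a disc of radius [1/2] about [Re s0 >= 0] the powers [x^(-s)] grow at most like [sqrt x].
    Against the [1 / x^2] of [em_coef] this leaves [x^(-3/2)], still summable across the line
    [Re s = 0]. *)
Lemma expands_em_term (x : R) (s0 : C) : 1 <= x -> 0 <= Re s0 -> Cmod s0 <= 2 ->
  expands (em_term x) s0 (1 / 2) (em_constant * / (x * sqrt x)) (em_term_coef x s0) /\
  (forall k, c_series (fun j => RtoC (em_coef x j) * Nat.iter j (shift_coef s0) (neg_power_coef x s0) k)%C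
               (em_term_coef x s0 k)).
Proof.
  intros Hx Hs0 Hs2.
  assert (Hsx : 0 < sqrt x) by (apply sqrt_lt_R0; lra).
  assert (Hlx : 0 <= ln x) by (rewrite <- ln_1; apply ln_le; lra).
  assert (HM : exp (- Re s0 * ln x) * exp (Rabs (ln x) * (1 / 2)) <= sqrt x).
  { rewrite Rabs_right by lra.
    replace (exp (ln x * (1 / 2))) with (sqrt x)
      by (rewrite <- (exp_ln (sqrt x)) by auto; f_equal; rewrite (ln_sqrt x) by lra; field).
    assert (exp (- Re s0 * ln x) <= 1).
    { rewrite <- exp_0. assert (H : - Re s0 * ln x <= 0) by nra.
      destruct H as [H|H]; [left; apply exp_increasing, H | right; f_equal; exact H]. }
    nra. }
  unfold em_constant. rewrite <- Series_scal_r.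
  apply (expands_series (fun j s => RtoC (em_coef x j) * (s ^ j * neg_power x s))%C (em_term x) s0 (1 / 2)
    (fun j => em_coef_bound j * (5 / 2) ^ j * / (x * sqrt x))
    (fun j k => RtoC (em_coef x j) * Nat.iter j (shift_coef s0) (neg_power_coef x s0) k)%C).
  - lra.
  - intros j.
    apply (expands_weaken _ _ _ (Cmod (RtoC (em_coef x j)) * ((Cmod s0 + 1 / 2) ^ j
            * (exp (- Re s0 * ln x) * exp (Rabs (ln x) * (1 / 2)))))).
    + rewrite Cmod_R.
      replace (em_coef_bound j * (5 / 2) ^ j * / (x * sqrt x))
        with ((/ x ^ 2 * em_coef_bound j) * ((5 / 2) ^ j * sqrt x)).
      * apply Rmult_le_compat; [apply Rabs_pos | | apply em_coef_le, Hx |].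
        -- apply Rmult_le_pos; [apply pow_le; generalize (Cmod_ge_0 s0); lra |].
           apply Rmult_le_pos; left; apply exp_pos.
        -- apply Rmult_le_compat; [apply pow_le; generalize (Cmod_ge_0 s0); lra | | | exact HM].
           ++ apply Rmult_le_pos; left; apply exp_pos.
           ++ apply pow_incr. generalize (Cmod_ge_0 s0). lra.
      * replace (x ^ 2) with (x * (sqrt x * sqrt x)) by (rewrite sqrt_sqrt by lra; ring).
        field. split; lra.
    + apply expands_scal, expands_pow_mult; [lra |]. apply expands_neg_power. lra.
  - apply ex_series_scal_r, ex_series_em_coef_bound.
  - intros h _. set (s := (s0 + h)%C).
    replace (em_term x s) with (neg_power x s * em_bracket x s)%C
      by (unfold em_term, em_bracket; rewrite neg_power_succ; ring).
    apply (c_series_ext (fun j => neg_power x s * (s ^ j * RtoC (em_coef x j)))%C); [intros; ring |].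
    exact (is_series_scal (V := C_NormedModule) (neg_power x s) _ _
             (proj1 (c_pseries_series _ _ _) (c_pseries_em_bracket x s))).
Qed.

Lemma iter_shift_coef_0 (c : nat -> C) (j k : nat) :
  Nat.iter j (shift_coef 0) c k = if Nat.ltb k j then RtoC 0 else c (k - j)%nat.
Proof.
  revert k. induction j as [|j IH]; intros k.
  - simpl. now rewrite Nat.sub_0_r.
  - simpl Nat.iter. unfold shift_coef at 1. destruct k as [|k].
    + simpl. ring.
    + rewrite (IH k). change (S k <? S j)%nat with (k <? j)%nat.
      replace (S k - S j)%nat with (k - j)%nat by lia. destruct (k <? j)%nat; ring.
Qed.

Lemma neg_power_coef_0 (x : R) :
  neg_power_coef x 0 0 = RtoC 1 /\ neg_power_coef x 0 1 = RtoC (- ln x).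
Proof.
  assert (E : neg_power x 0 = 1).
  { unfold neg_power, Cpow_pos. replace (- 0 * RtoC (ln x))%C with (RtoC 0) by ring. apply Cexp_0. }
  unfold neg_power_coef. rewrite E. unfold exp_coef. simpl. rewrite Rinv_1. split; ring.
Qed.

(** At the centre 0 multiplication by [s^j] is a pure shift, so only [j <= k] contribute to order
    [k], and [em_coef x 0] vanishes. *)
Lemma em_term_coef_0 (x : R) : 1 <= x ->
  em_term_coef x 0 0 = RtoC 0 /\ em_term_coef x 0 1 = RtoC (stirling_defect x).
Proof.
  intros Hx. destruct (neg_power_coef_0 x) as [E0 E1].
  destruct (expands_em_term x 0 Hx) as [_ H].
  - simpl. lra.
  - rewrite Cmod_0. lra.
  - split.
    + eapply eq_trans; [apply (c_series_unique _ _ _ (H 0%nat)), (c_series_finite _ 1) |].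
      * intros [|j] Hj; [lia |]. rewrite iter_shift_coef_0. simpl. ring.
      * simpl. rewrite em_coef_0. ring.
    + eapply eq_trans; [apply (c_series_unique _ _ _ (H 1%nat)), (c_series_finite _ 2) |].
      * intros [|[|j]] Hj; try lia. rewrite iter_shift_coef_0. simpl. ring.
      * rewrite !csum_S, em_coef_0, em_coef_1, !iter_shift_coef_0. simpl. rewrite E0. ring.
Qed.

(** Integral comparison: the right side is the integral of [t^(-3/2)] over [[x - 1, x]]. *)
Lemma inv_mult_sqrt_telescope (x : R) : 1 < x -> / (x * sqrt x) <= 2 * (/ sqrt (x - 1) - / sqrt x).
Proof.
  intros Hx. set (u := sqrt (x - 1)). set (v := sqrt x).
  assert (Hu : 0 < u) by (apply sqrt_lt_R0; lra). assert (Hv : 0 < v) by (apply sqrt_lt_R0; lra).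
  assert (Eu : u * u = x - 1) by (apply sqrt_sqrt; lra). assert (Ev : v * v = x) by (apply sqrt_sqrt; lra).
  assert (Huv : u < v) by (apply sqrt_lt_1_alt; lra).
  assert (E : / u - / v = / (u * v * (u + v))).
  { apply (Rmult_eq_reg_r (u * v * (u + v))); [| apply Rgt_not_eq; repeat apply Rmult_lt_0_compat; lra].
    rewrite Rinv_l by (apply Rgt_not_eq; repeat apply Rmult_lt_0_compat; lra).
    field_simplify; [nra | lra]. }
  rewrite E. rewrite <- Ev.
  replace (2 * / (u * v * (u + v))) with (/ (u * v * ((u + v) / 2))) by (field; repeat split; lra).
  apply Rinv_le_contravar.
  - apply Rmult_lt_0_compat; [apply Rmult_lt_0_compat; auto | lra].
  - assert (u * v <= v * v) by nra. apply Rmult_le_compat; nra.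
Qed.

Lemma ex_series_inv_mult_sqrt (alpha : R) : 0 < alpha ->
  ex_series (fun n => / ((alpha + 1 + INR n) * sqrt (alpha + 1 + INR n))).
Proof.
  intros Ha.
  apply (ex_series_psum_bounded _ (2 * / sqrt alpha)).
  - intros n. generalize (pos_INR n). intros. left. apply Rinv_0_lt_compat, Rmult_lt_0_compat; [lra |].
    apply sqrt_lt_R0. lra.
  - intros m.
    eapply Rle_trans; [apply (psum_le _ (fun n => 2 * / sqrt (alpha + INR n) - 2 * / sqrt (alpha + INR (S n)))) |].
    + intros i _. generalize (pos_INR i). intros.
      eapply Rle_trans; [apply inv_mult_sqrt_telescope; lra |].
      rewrite S_INR. replace (alpha + 1 + INR i - 1) with (alpha + INR i) by ring.
      replace (alpha + (INR i + 1)) with (alpha + 1 + INR i) by ring. lra.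
    + rewrite (psum_telescope (fun n => 2 * / sqrt (alpha + INR n))). simpl (INR 0). rewrite Rplus_0_r.
      assert (0 < / sqrt (alpha + INR m))
        by (apply Rinv_0_lt_compat, sqrt_lt_R0; generalize (pos_INR m); lra). lra.
Qed.

(** Starting at [alpha + 1] keeps the base points at least 1, as the coefficient bounds require; the
    zeta term at [alpha] is accounted for separately. *)
Definition em_sum (alpha : R) (s : C) : C := csum_value (fun n => em_term (alpha + 1 + INR n) s).

Definition em_sum_coef (alpha : R) (s0 : C) (k : nat) : C :=
  csum_value (fun n => em_term_coef (alpha + 1 + INR n) s0 k).

Lemma expands_em_sum (alpha : R) (s0 : C) : 0 < alpha -> 0 <= Re s0 -> Cmod s0 <= 2 ->
  (exists M, expands (em_sum alpha) s0 (1 / 2) M (em_sum_coef alpha s0)) /\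
  (forall k, c_series (fun n => em_term_coef (alpha + 1 + INR n) s0 k) (em_sum_coef alpha s0 k)) /\
  (forall h, Cmod h < 1 / 2 ->
     c_series (fun n => em_term (alpha + 1 + INR n) (s0 + h)) (em_sum alpha (s0 + h))).
Proof.
  intros Ha Hs0 Hs2.
  pose (M := fun n => em_constant * / ((alpha + 1 + INR n) * sqrt (alpha + 1 + INR n))).
  assert (Hn : forall n, expands (em_term (alpha + 1 + INR n)) s0 (1 / 2) (M n)
                 (em_term_coef (alpha + 1 + INR n) s0)).
  { intros n. generalize (pos_INR n). intros. apply expands_em_term; auto. lra. }
  assert (HM : ex_series M) by exact (ex_series_scal_l em_constant _ (ex_series_inv_mult_sqrt alpha Ha)).
  assert (Hs : forall h, Cmod h < 1 / 2 ->
     c_series (fun n => em_term (alpha + 1 + INR n) (s0 + h)) (em_sum alpha (s0 + h))).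
  { intros h Hh. apply (ex_c_series _ (fun n => M n * (/ (1 - Cmod h / (1 / 2))))).
    (* The tail of order 0 is the term itself, so the expansions already give absolute convergence
       at each point of the disc. *)
    - intros n. generalize (expands_tail _ _ _ _ _ h 0 (Hn n) Hh). simpl.
      replace (em_term (alpha + 1 + INR n) (s0 + h) - 0)%C
        with (em_term (alpha + 1 + INR n) (s0 + h)) by ring.
      rewrite Rmult_1_r. auto.
    - apply ex_series_scal_r, HM. }
  destruct (expands_series (fun n => em_term (alpha + 1 + INR n)) (em_sum alpha) s0 (1 / 2) M
    (fun n => em_term_coef (alpha + 1 + INR n) s0) ltac:(lra) Hn HM Hs) as [H1 H2].
  split; [exists (Series M); exact H1 |]. split; [exact H2 | exact Hs].
Qed.

(** Each term is [x^(1-s) - (x+1)^(1-s)] plus [1 - s] times the mean of [x^(-s)] and [(x+1)^(-s)]: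
    the first part telescopes, the second gives a partial zeta sum with half weights at its ends. *)
Lemma csum_em_term (y : R) (s : C) (N : nat) :
  csum (fun n => em_term (y + INR n) s) N
  = (RtoC y * neg_power y s - RtoC (y + INR N) * neg_power (y + INR N) s
     + (1 - s) * (csum (fun n => neg_power (y + INR n) s) N
                  - RtoC (1 / 2) * neg_power y s + RtoC (1 / 2) * neg_power (y + INR N) s))%C.
Proof.
  induction N as [|N IH].
  - simpl. rewrite Rplus_0_r. ring.
  - rewrite !csum_S, IH, S_INR, <- Rplus_assoc. unfold em_term.
    set (x := y + INR N). replace (RtoC (x + 1)) with (RtoC x + 1)%C by (rewrite RtoC_plus; reflexivity).
    replace (RtoC (x + 1 / 2)) with (RtoC x + RtoC (1 / 2))%C by (rewrite RtoC_plus; reflexivity).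
    rewrite (RtoC_div 1 2) by lra. field.
Qed.

Lemma csum_shift (u : nat -> C) (N : nat) : csum (fun n => u (S n)) N = (csum u (S N) - u 0%nat)%C.
Proof.
  induction N as [|N IH]; [simpl; ring |]. rewrite csum_S, IH, (csum_S u (S N)). ring.
Qed.

Lemma is_lim_seq_neg_power (y c : R) : 0 < y -> 0 < c ->
  is_lim_seq (fun N => exp (- (c * ln (y + INR N)))) 0.
Proof.
  intros Hy Hc.
  apply (is_lim_seq_ext (fun N => Rpower (/ (y + INR N)) c)).
  { intros N. generalize (pos_INR N). intros. unfold Rpower. rewrite ln_Rinv by lra. f_equal. ring. }
  apply (filterlim_comp _ _ _ (fun N => / (y + INR N)) (fun t => Rpower t c) _ (at_right 0));
    [| apply filterlim_Rpower_0, Hc].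
  intros P [d Hd].
  assert (H : is_lim_seq (fun N => / (y + INR N)) 0).
  { apply (is_lim_seq_le_le_loc (fun _ => 0) _ (fun N => / INR N)).
    - exists 1%nat. intros n Hn. generalize (lt_0_INR n ltac:(lia)). intros.
      split; [left; apply Rinv_0_lt_compat; lra | apply Rinv_le_contravar; lra].
    - apply is_lim_seq_const.
    - apply is_lim_seq_inv_INR. }
  apply is_lim_seq_spec in H. change (eventually (fun N => P (/ (y + INR N)))).
  generalize (H d). apply filter_imp. intros N HN. apply Hd; [exact HN |]. generalize (pos_INR N). intros. apply Rinv_0_lt_compat. lra.
Qed.

(** For [Re s > 1] the boundary contributions at [x = alpha + 1 + N] are dominated by [|x^(1-s)|]
    and vanish in the limit. *)
Lemma em_sum_half_plane (alpha : R) (s zs : C) : 0 < alpha -> 1 < Re s ->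
  c_series (fun n => neg_power (INR n + alpha) s) zs ->
  em_sum alpha s = (RtoC (alpha + 1) * neg_power (alpha + 1) s
     + (1 - s) * (zs - neg_power alpha s - RtoC (1 / 2) * neg_power (alpha + 1) s))%C.
Proof.
  intros Ha Hs Hz. apply c_series_value, c_series_csum. apply c_series_csum in Hz.
  apply (is_lim_seq_incr_1 (fun N => Cmod (csum (fun n => neg_power (INR n + alpha) s) N - zs))) in Hz.
  set (y := alpha + 1) in *.
  pose (e := fun N => exp (- ((Re s - 1) * ln (y + INR N)))).
  assert (He : is_lim_seq e 0) by (apply is_lim_seq_neg_power; unfold y; lra).
  apply (is_lim_seq_0_squeeze _ (fun N => (1 + Cmod (1 - s)) * e N
    + Cmod (1 - s) * Cmod (csum (fun n => neg_power (INR n + alpha) s) (S N) - zs))).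
  - intros N. split; [apply Cmod_ge_0 |]. generalize (pos_INR N). intros HN.
    assert (Hx : 1 < y + INR N) by (unfold y; lra).
    rewrite csum_em_term.
    replace (csum (fun n => neg_power (y + INR n) s) N)
      with (csum (fun n => neg_power (INR n + alpha) s) (S N) - neg_power alpha s)%C.
    2:{ assert (E : forall u v : nat -> C, (forall n, u n = v n) -> csum u N = csum v N).
        { intros u v H. induction N as [|N' IH]; [reflexivity |].
          assert (HN' : 0 <= INR N') by apply pos_INR.
          rewrite !csum_S, H, IH; auto. unfold y. lra. }
        rewrite <- (E (fun n => neg_power (INR (S n) + alpha) s)).
        - rewrite (csum_shift (fun n => neg_power (INR n + alpha) s)). simpl (INR 0). now rewrite Rplus_0_l.
        - intros n. rewrite S_INR. unfold y. f_equal. ring. }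
    set (Q := csum (fun n => neg_power (INR n + alpha) s) (S N)).
    set (x := y + INR N) in *.
    assert (Hxp : Cmod (RtoC x * neg_power x s) = e N).
    { rewrite Cmod_mult, Cmod_R, Rabs_right, Cmod_neg_power by lra.
      rewrite <- (exp_ln x) at 1 by lra. rewrite <- exp_plus. unfold e. fold x. f_equal. ring. }
    assert (Hp : Cmod (neg_power x s) <= e N).
    { rewrite <- Hxp, Cmod_mult, Cmod_R, Rabs_right by lra. generalize (Cmod_ge_0 (neg_power x s)). nra. }
    match goal with |- Cmod ?w <= _ =>
      replace w with (- (RtoC x * neg_power x s)
        + ((1 - s) * (Q - zs) + (1 - s) * (RtoC (1 / 2) * neg_power x s)))%C by ring end.
    eapply Rle_trans; [apply Cmod_triangle |]. rewrite Cmod_opp, Hxp.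
    eapply Rle_trans; [apply Rplus_le_compat_l, Cmod_triangle |].
    rewrite !Cmod_mult, Cmod_R, (Rabs_right (1 / 2)) by lra.
    assert (Cmod (1 - s) * (1 / 2 * Cmod (neg_power x s)) <= Cmod (1 - s) * e N).
    { apply Rmult_le_compat_l; [apply Cmod_ge_0 |]. generalize (Cmod_ge_0 (neg_power x s)). lra. }
    lra.
  - replace (Finite 0) with (Finite ((1 + Cmod (1 - s)) * 0 + Cmod (1 - s) * 0)) by (f_equal; ring).
    apply is_lim_seq_plus'.
    + apply (is_lim_seq_scal_l _ (1 + Cmod (1 - s)) 0), He.
    + apply (is_lim_seq_scal_l _ (Cmod (1 - s)) 0), Hz.
Qed.

(** * Lerch's formula *)

(* The semicircle from [2] to [0] around the excluded point [1]. *)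
Definition semicircle (t : R) : C := (1 + cos t, sin t).

(** Connectedness of [[0, T]] in the form of an induction: the supremum of the initial segments on
    which [P] holds satisfies [P], and openness pushes it to [T]. *)
Lemma real_interval_induction (P : R -> Prop) (T : R) : 0 < T ->
  P 0 -> (forall t, 0 < t <= T -> (forall u, 0 <= u < t -> P u) -> P t) ->
  (forall t, 0 <= t <= T -> P t -> exists d, 0 < d /\ forall u, Rabs (u - t) < d -> P u) ->
  P T.
Proof.
  intros HT H0 Hstep Hopen.
  pose (E := fun t => 0 <= t <= T /\ forall u, 0 <= u <= t -> P u).
  destruct (completeness E) as [m [Hm1 Hm2]].
  - exists T. intros t [Ht _]. lra.
  - exists 0. split; [lra |]. intros u Hu. replace u with 0 by lra. exact H0.
  - assert (Hm0 : 0 <= m).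
    { apply Hm1. split; [lra |]. intros u Hu. replace u with 0 by lra. exact H0. }
    assert (HmT : m <= T) by (apply Hm2; intros t [Ht _]; lra).
    assert (Hlt : forall u, 0 <= u < m -> P u).
    { intros u Hu. destruct (Classical_Prop.classic (exists t, E t /\ u < t)) as [[t [[_ Ht] Hut]]|Hn].
      - apply Ht. lra.
      - exfalso. assert (m <= u); [| lra]. apply Hm2. intros t Ht.
        apply Rnot_lt_le. intros Hut. apply Hn. exists t. auto. }
    assert (HPm : P m).
    { destruct (Req_dec m 0) as [->|Hne]; [exact H0 |]. apply Hstep; [lra | exact Hlt]. }
    destruct (Hopen m ltac:(lra) HPm) as [d [Hd Hdm]].
    destruct (Rle_lt_or_eq_dec m T HmT) as [Hlt'|Heq]; [| now subst m].
    exfalso. set (t := Rmin T (m + d / 2)).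
    assert (Ht1 : t <= T) by apply Rmin_l. assert (Ht2 : t <= m + d / 2) by apply Rmin_r.
    assert (Ht3 : m < t) by (apply Rmin_glb_lt; lra).
    assert (t <= m); [| lra]. apply Hm1. split; [lra |]. intros u Hu.
    destruct (Rlt_le_dec u m) as [H|H]; [apply Hlt; lra |].
    apply Hdm. rewrite Rabs_right; lra.
Qed.

Lemma Rabs_cos_diff_le (t u : R) : Rabs (cos u - cos t) <= Rabs (u - t).
Proof.
  rewrite form2, !Rabs_mult, (Rabs_left (-2)) by lra.
  generalize (Rabs_sin_le_Rabs ((u - t) / 2)), (Rabs_sin_le ((u + t) / 2)), (Rabs_pos (sin ((u - t) / 2))).
  unfold Rdiv at 2. rewrite (Rabs_mult (u - t)), (Rabs_right (/ 2)) by lra. nra.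
Qed.

Lemma Rabs_sin_diff_le (t u : R) : Rabs (sin u - sin t) <= Rabs (u - t).
Proof.
  rewrite form4, !Rabs_mult, (Rabs_right 2) by lra.
  generalize (Rabs_sin_le_Rabs ((u - t) / 2)), (Rabs_cos_le ((u + t) / 2)), (Rabs_pos (sin ((u - t) / 2))).
  unfold Rdiv at 2. rewrite (Rabs_mult (u - t)), (Rabs_right (/ 2)) by lra. nra.
Qed.

Lemma semicircle_lipschitz (t u : R) : Cmod (semicircle u - semicircle t) <= 2 * Rabs (u - t).
Proof.
  eapply Rle_trans; [apply Cmod_le_Re_Im |].
  replace (Re (semicircle u - semicircle t)%C) with (cos u - cos t) by (simpl; ring).
  replace (Im (semicircle u - semicircle t)%C) with (sin u - sin t) by (simpl; ring).
  generalize (Rabs_cos_diff_le t u), (Rabs_sin_diff_le t u). lra.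
Qed.

(** The first two clauses delimit where the Euler-Maclaurin sum was expanded; the third keeps to the
    domain of the given continuation. *)
Lemma semicircle_domain (t : R) :
  0 <= Re (semicircle t) /\ Cmod (semicircle t) <= 2 /\ semicircle t <> RtoC 1.
Proof.
  split; [simpl; generalize (COS_bound t); lra |]. split.
  - replace (semicircle t) with (1 + (cos t, sin t))%C by (unfold semicircle, Cplus; simpl; f_equal; ring).
    eapply Rle_trans; [apply Cmod_triangle |]. rewrite Cmod_1.
    assert (E : Cmod (cos t, sin t) = 1).
    { unfold Cmod. simpl. replace (cos t * (cos t * 1) + sin t * (sin t * 1)) with 1.
      - apply sqrt_1.
      - generalize (sin2_cos2 t). unfold Rsqr. lra. }
    rewrite E. lra.
  - intros H. assert (H1 := f_equal Re H). assert (H2 := f_equal Im H). simpl in H1, H2.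
    generalize (sin2_cos2 t). unfold Rsqr. rewrite H2. assert (E : cos t = 0) by lra. rewrite E. lra.
Qed.

(** The subtracted expression is [(s - 1) * zeta] as solved from [em_sum_half_plane]. *)
Definition hurwitz_error (zeta : C -> R -> C) (alpha : R) (s : C) : C :=
  ((s - 1) * zeta s alpha
   - (((s - 1) * neg_power alpha s + RtoC (alpha + 1) * neg_power (alpha + 1) s
       + RtoC (1 / 2) * ((s - 1) * neg_power (alpha + 1) s)) - em_sum alpha s))%C.

Definition hurwitz_error_coef (a : nat -> C) (alpha : R) (s0 : C) (k : nat) : C :=
  (pred_coef s0 a k
   - ((pred_coef s0 (neg_power_coef alpha s0) k + RtoC (alpha + 1) * neg_power_coef (alpha + 1) s0 k
       + RtoC (1 / 2) * pred_coef s0 (neg_power_coef (alpha + 1) s0) k) - em_sum_coef alpha s0 k))%C.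

Lemma hurwitz_error_half_plane (zeta : C -> R -> C) (alpha : R) (s : C) :
  is_Hurwitz_zeta zeta -> 0 < alpha -> 1 < Re s -> hurwitz_error zeta alpha s = RtoC 0.
Proof.
  intros Hz Ha Hs. destruct (Hz alpha Ha) as [Hser _].
  unfold hurwitz_error. rewrite (em_sum_half_plane alpha s (zeta s alpha) Ha Hs (Hser s Hs)). ring.
Qed.

Lemma hurwitz_error_pseries (zeta : C -> R -> C) (alpha : R) (s0 : C) (a : nat -> C) (r : R) :
  0 < alpha -> 0 <= Re s0 -> Cmod s0 <= 2 ->
  (forall h, Cmod h < r -> c_pseries a h (zeta (s0 + h)%C alpha)) ->
  forall h, Cmod h < Rmin r (1 / 2) ->
    c_pseries (hurwitz_error_coef a alpha s0) h (hurwitz_error zeta alpha (s0 + h)%C).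
Proof.
  intros Ha Hs0 Hs2 Hf h Hh.
  assert (Hh1 : Cmod h < r) by (eapply Rlt_le_trans; [exact Hh | apply Rmin_l]).
  assert (Hh2 : Cmod h < 1 / 2) by (eapply Rlt_le_trans; [exact Hh | apply Rmin_r]).
  destruct (expands_em_sum alpha s0 Ha Hs0 Hs2) as [[M [_ HS]] _].
  destruct (expands_neg_power alpha s0 (1 / 2) ltac:(lra)) as [_ Hp].
  destruct (expands_neg_power (alpha + 1) s0 (1 / 2) ltac:(lra)) as [_ Hq].
  specialize (HS h Hh2). specialize (Hp h Hh2). specialize (Hq h Hh2). specialize (Hf h Hh1).
  unfold hurwitz_error. unfold hurwitz_error_coef.
  apply c_pseries_minus; [apply c_pseries_pred_mult, Hf |].
  apply c_pseries_minus; [| exact HS].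
  apply c_pseries_plus; [apply c_pseries_plus |].
  - apply c_pseries_pred_mult, Hp.
  - apply c_pseries_scal, Hq.
  - apply c_pseries_scal, c_pseries_pred_mult, Hq.
Qed.

(* Vanishing propagates along the semicircle: each of its points is a limit of earlier points,
   where the error already vanishes. *)
Lemma hurwitz_error_near_0 (zeta : C -> R -> C) (alpha : R) :
  is_Hurwitz_zeta zeta -> 0 < alpha ->
  exists d, 0 < d /\ forall h, Cmod h < d -> hurwitz_error zeta alpha h = RtoC 0.
Proof.
  intros Hz Ha.
  assert (H : exists d, 0 < d /\ forall h, Cmod h < d -> hurwitz_error zeta alpha (semicircle PI + h)%C = RtoC 0).
  { apply (real_interval_induction (fun t => exists d, 0 < d /\
      forall h, Cmod h < d -> hurwitz_error zeta alpha (semicircle t + h)%C = RtoC 0)); [apply PI_RGT_0 | | |].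
    - exists 1. split; [lra |]. intros h Hh. apply hurwitz_error_half_plane; auto.
      simpl. rewrite cos_0. generalize (re_le_Cmod h). intros H. apply Rabs_le_between in H.
      unfold Re in *. lra.
    - intros t Ht Hprev.
      destruct (semicircle_domain t) as [Hd1 [Hd2 Hd3]].
      destruct (Hz alpha Ha) as [_ Han]. destruct (Han _ Hd3) as [a [r Hf]].
      assert (Hr : 0 < Rmin r (1 / 2)) by (apply Rmin_glb_lt; [apply cond_pos | lra]).
      assert (HD := hurwitz_error_pseries zeta alpha (semicircle t) a r Ha Hd1 Hd2 Hf).
      assert (Hc : forall k, hurwitz_error_coef a alpha (semicircle t) k = RtoC 0).
      { apply (pseries_accumulating_zeros (hurwitz_error zeta alpha) (semicircle t) _ _ Hr HD).
        (* The semicircle is Lipschitz with constant 2, so this earlier point is within [eps / 2];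
           it is a different point because [cos] is strictly decreasing on [[0, pi]]. *)
        intros eps Heps. set (u := Rmax 0 (t - eps / 4)).
        assert (Hu : 0 <= u < t) by (unfold u, Rmax; destruct (Rle_dec 0 (t - eps / 4)); lra).
        assert (Hu2 : t - eps / 4 <= u) by apply Rmax_r.
        exists (semicircle u - semicircle t)%C. split; [| split].
        - intros E. assert (E1 := f_equal Re E). simpl in E1.
          generalize (cos_decreasing_1 u t ltac:(lra) ltac:(lra) ltac:(lra) ltac:(lra) ltac:(lra)). lra.
        - eapply Rle_lt_trans; [apply semicircle_lipschitz |]. rewrite Rabs_left; lra.
        - replace (semicircle t + (semicircle u - semicircle t))%C with (semicircle u + 0)%C by ring.
          destruct (Hprev u Hu) as [d [Hd H]]. apply H. rewrite Cmod_0. exact Hd. }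
      exists (Rmin r (1 / 2)). split; [exact Hr |]. intros h Hh.
      apply (c_series_unique (fun _ => RtoC 0)).
      + generalize (proj1 (c_pseries_series _ _ _) (HD h Hh)). apply c_series_ext.
        intros k. rewrite Hc. ring.
      + apply (c_series_finite _ 0). auto.
    (* A move of less than [d / 4] in the parameter displaces the centre by less than [d / 2], so
       the disc of radius [d / 2] there stays inside the old one. *)
    - intros t _ [d [Hd H]]. exists (d / 4). split; [lra |]. intros u Hu.
      exists (d / 2). split; [lra |]. intros h Hh.
      replace (semicircle u + h)%C with (semicircle t + ((semicircle u - semicircle t) + h))%C by ring.
      apply H. eapply Rle_lt_trans; [apply Cmod_triangle |].
      generalize (semicircle_lipschitz t u). lra. }
  destruct H as [d [Hd H]]. exists d. split; [exact Hd |]. intros h Hh.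
  rewrite <- (H h Hh). f_equal.
  replace (semicircle PI) with (RtoC 0); [ring |].
  unfold semicircle. rewrite cos_PI, sin_PI. unfold RtoC. f_equal. ring.
Qed.

Lemma C_derive_pseries (f : C -> C) (r : R) (a : nat -> C) :
  0 < r -> (forall h, Cmod h < r -> c_pseries a h (f (0 + h)%C)) -> C_derive f 0 = a 1%nat.
Proof.
  intros Hr Hf. destruct (pseries_expands f 0 r a Hr Hf) as [M HM].
  set (rho := r / 2) in *. assert (Hrho : 0 < rho) by (unfold rho; lra).
  assert (HM0 : 0 <= M).
  { destruct HM as [HM _]. generalize (HM 0%nat), (Cmod_ge_0 (a 0%nat)). simpl. lra. }
  assert (E0 : f 0 = a 0%nat).
  { generalize (expands_tail f 0 rho M a 0 1 HM). rewrite Cmod_0.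
    replace (0 + 0)%C with (RtoC 0) by ring.
    replace (M * (0 / rho) ^ 1 / (1 - 0 / rho)) with 0 by (simpl; field; lra).
    intros H. specialize (H Hrho). simpl in H.
    assert (H' : Cmod (f 0 - a 0%nat) = 0).
    { apply Rle_antisym; [| apply Cmod_ge_0]. eapply Rle_trans; [| exact H]. right. f_equal. ring. }
    apply Cmod_eq_0 in H'. replace (f 0) with ((f 0 - a 0%nat) + a 0%nat)%C by ring. rewrite H'. ring. }
  apply is_C_lim_unique.
  apply (filterlim_locally_ball_norm (U := C_NormedModule)). intros eps.
  (* The tail of order 2 divided by [|h|] is at most [2 M |h| / rho^2] once [|h| <= rho / 2]; the
     second bound makes this smaller than [eps]. *)
  set (d := Rmin (rho / 2) (eps * rho ^ 2 / (4 * (M + 1)))).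
  assert (Hd : 0 < d).
  { apply Rmin_glb_lt; [lra |]. apply Rdiv_lt_0_compat; [| lra].
    apply Rmult_lt_0_compat; [apply cond_pos | apply pow_lt, Hrho]. }
  enough (Hmain : forall h : C, Cmod (h - 0) < d -> h <> 0 ->
    Cmod ((f h - f 0) / (h - 0) - a 1%nat) < eps).
  { generalize (locally_ball_norm (V := C_NormedModule) (RtoC 0) (mkposreal d Hd)).
    unfold locally', within. apply filter_imp. exact Hmain. }
  intros h Hh Hne. replace (h - 0)%C with h in Hh by ring.
  assert (Hh0 : 0 < Cmod h) by (apply Cmod_gt_0, Hne).
  assert (Hd1 : d <= rho / 2) by apply Rmin_l.
  assert (Hd2 : d <= eps * rho ^ 2 / (4 * (M + 1))) by apply Rmin_r.
  generalize (expands_tail f 0 rho M a h 2 HM ltac:(lra)).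
  replace (0 + h)%C with h by ring. rewrite E0.
  replace (f h - csum (fun k => h ^ k * a k)%C 2)%C with (h * ((f h - a 0%nat) / (h - 0) - a 1%nat))%C.
  2:{ simpl. replace (h - 0)%C with h by ring. field. exact Hne. }
  rewrite Cmod_mult. set (q := Cmod ((f h - a 0%nat) / (h - 0) - a 1%nat)). set (x := Cmod h) in *.
  intros H.
  assert (Hx : x / rho <= 1 / 2).
  { apply (Rmult_le_reg_r rho); [lra |]. unfold Rdiv at 1. rewrite Rmult_assoc, Rinv_l; lra. }
  assert (H1 : M * (x / rho) ^ 2 / (1 - x / rho) <= 2 * (M * (x / rho) ^ 2)).
  { assert (0 <= M * (x / rho) ^ 2) by (apply Rmult_le_pos; [auto | apply pow2_ge_0]).
    apply (Rmult_le_reg_r (1 - x / rho)); [lra |]. unfold Rdiv at 1.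
    rewrite Rmult_assoc, Rinv_l; nra. }
  assert (H2 : q <= 2 * M * x / rho ^ 2).
  { apply (Rmult_le_reg_l x); [auto |].
    replace (x * (2 * M * x / rho ^ 2)) with (2 * (M * (x / rho) ^ 2)) by (field; lra). lra. }
  assert (Hr2 : 0 < rho ^ 2) by (apply pow_lt, Hrho).
  assert (H3 : x * (4 * (M + 1)) < eps * rho ^ 2).
  { replace (eps * rho ^ 2) with (eps * rho ^ 2 / (4 * (M + 1)) * (4 * (M + 1))) by (field; lra).
    apply Rmult_lt_compat_r; lra. }
  eapply Rle_lt_trans; [exact H2 |].
  apply (Rmult_lt_reg_r (rho ^ 2)); [auto |].
  unfold Rdiv. rewrite Rmult_assoc, Rinv_l by lra. generalize (cond_pos eps). nra.
Qed.

(** The partial sums telescope to [log_gauss - stirling_seq] plus elementary terms: the first tends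
    to [ln Gamma], the second supplies [ln (2 pi) / 2]. *)
Lemma stirling_defect_series (alpha : R) : 0 < alpha <= 1 ->
  is_series (fun n => stirling_defect (alpha + 1 + INR n))
    (log_gamma_normalized alpha + ln alpha - (alpha + 1 / 2) * ln (alpha + 1) + (alpha + 1)).
Proof.
  intros Ha. apply is_series_psum.
  set (c := ln alpha - (alpha + 1 / 2) * ln (alpha + 1) + (alpha + 1)).
  assert (E : forall N, psum (fun n => stirling_defect (alpha + 1 + INR n)) N
    = log_gauss (S N) alpha - stirling_seq (S N)
      + ((alpha + INR (S N) - 1 / 2) * (ln (alpha + INR (S N)) - ln (INR (S N))) - alpha) + c).
  { induction N as [|N IH].
    - unfold log_gauss, stirling_seq, c. simpl. rewrite ln_1, (Rplus_0_r alpha). field.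
    - rewrite psum_S, IH. unfold log_gauss, stirling_seq, stirling_defect.
      rewrite (psum_S _ (S N)), (fact_simpl (S N)), mult_INR.
      rewrite ln_mult by first [apply INR_fact_lt_0 | apply lt_0_INR; lia].
      rewrite !(S_INR (S N)), !(S_INR N). generalize (pos_INR N). intros HN.
      replace (alpha + 1 + INR N) with (alpha + (INR N + 1)) by ring.
      replace (alpha + (INR N + 1) + 1) with (alpha + (INR N + 1 + 1)) by ring. field. }
  apply (is_lim_seq_ext (fun N => log_gauss (S N) alpha - stirling_seq (S N)
      + ((alpha + INR (S N) - 1 / 2) * (ln (alpha + INR (S N)) - ln (INR (S N))) - alpha) + c));
    [intros; now rewrite E |].
  replace (log_gamma_normalized alpha + ln alpha - (alpha + 1 / 2) * ln (alpha + 1) + (alpha + 1))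
    with (ln (Gamma alpha) - ln (2 * PI) / 2 + 0 + c)
    by (unfold c; rewrite log_gamma_normalized_eq by exact Ha; ring).
  apply (is_lim_seq_incr_1 (fun N => log_gauss N alpha - stirling_seq N
      + ((alpha + INR N - 1 / 2) * (ln (alpha + INR N) - ln (INR N)) - alpha) + c)).
  apply is_lim_seq_plus'; [| apply is_lim_seq_const].
  apply is_lim_seq_plus'; [apply is_lim_seq_minus' |].
  - apply (is_lim_seq_close (fun _ => ln (Gamma alpha))); [apply is_lim_seq_const |].
    intros n Hn. generalize (log_gauss_bounds n alpha Hn Ha). intros. rewrite Rabs_left1; lra.
  - apply is_lim_seq_stirling.
  (* [(alpha + m - 1/2) ln(1 + alpha/m) - alpha] is [O(1/m)], by bounding the logarithm between
     [alpha / (alpha + m)] and [alpha / m]. *)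
  - apply (is_lim_seq_close (fun _ => 0)); [apply is_lim_seq_const |].
    intros n Hn. generalize (lt_0_INR n ltac:(lia)). intros Hn0. set (m := INR n) in *.
    assert (Hi : 0 < / m) by (apply Rinv_0_lt_compat; auto).
    assert (H1 : ln (alpha + m) - ln m <= alpha * / m).
    { generalize (ln_le_minus_1 ((alpha + m) / m) ltac:(apply Rdiv_lt_0_compat; lra)).
      rewrite ln_div by lra. replace ((alpha + m) / m - 1) with (alpha * / m) by (field; lra). auto. }
    assert (H2 : alpha * / (alpha + m) <= ln (alpha + m) - ln m).
    { generalize (ln_le_minus_1 (m / (alpha + m)) ltac:(apply Rdiv_lt_0_compat; lra)).
      rewrite ln_div by lra. replace (m / (alpha + m) - 1) with (- (alpha * / (alpha + m))) by (field; lra). lra. }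
    assert (Hm1 : 1 <= m) by (apply (le_INR 1), Hn).
    apply (Rmult_le_compat_l (alpha + m - 1 / 2)) in H1, H2; try lra.
    replace ((alpha + m - 1 / 2) * (alpha * / m)) with (alpha + alpha * (alpha - 1 / 2) * / m) in H1 by (field; lra).
    replace ((alpha + m - 1 / 2) * (alpha * / (alpha + m))) with (alpha - alpha / 2 * / (alpha + m)) in H2 by (field; lra).
    assert (H3 : / (alpha + m) <= / m) by (apply Rinv_le_contravar; lra).
    assert (H4 : 0 < / (alpha + m)) by (apply Rinv_0_lt_compat; lra).
    assert (H5 : alpha * (alpha - 1 / 2) * / m <= 1 * / m) by (apply Rmult_le_compat_r; nra).
    assert (H6 : alpha / 2 * / (alpha + m) <= 1 * / m) by (apply Rmult_le_compat; lra).
    apply Rabs_le. lra.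
Qed.

Lemma c_series_RtoC (u : nat -> R) (l : R) : is_series u l -> c_series (fun n => RtoC (u n)) (RtoC l).
Proof.
  intros H. apply is_series_psum in H. apply c_series_csum.
  apply (is_lim_seq_ext (fun N => Rabs (psum u N - l))).
  - intros N. rewrite <- Cmod_R, RtoC_minus. do 2 f_equal.
    induction N as [|N IH]; [reflexivity |]. simpl. rewrite RtoC_plus, IH. reflexivity.
  - apply (proj1 (is_lim_seq_abs_0 (fun N => psum u N - l))). replace (Finite 0) with (Finite (l - l)) by (f_equal; ring).
    apply is_lim_seq_minus'; [exact H | apply is_lim_seq_const].
Qed.

Lemma lerch_formula (zeta : C -> R -> C) (alpha : R) :
  is_Hurwitz_zeta zeta -> 0 < alpha <= 1 ->
  C_derive (fun s => zeta s alpha) (RtoC 0) = RtoC (log_gamma_normalized alpha).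
Proof.
  intros Hz Ha.
  destruct (Hz alpha ltac:(lra)) as [_ Han].
  destruct (Han (RtoC 0)) as [a [r Hf]]; [intros E; apply RtoC_inj in E; lra |].
  rewrite (C_derive_pseries (fun s => zeta s alpha) r a (cond_pos r) Hf).
  assert (H0 : 0 <= Re (RtoC 0)) by (simpl; lra).
  assert (H2 : Cmod (RtoC 0) <= 2) by (rewrite Cmod_0; lra).
  assert (Hc : forall k, hurwitz_error_coef a alpha 0 k = RtoC 0).
  { destruct (hurwitz_error_near_0 zeta alpha Hz ltac:(lra)) as [d [Hd Hzero]].
    apply (pseries_accumulating_zeros (hurwitz_error zeta alpha) 0 (Rmin r (1 / 2))).
    - apply Rmin_glb_lt; [apply cond_pos | lra].
    - apply hurwitz_error_pseries; auto. lra.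
    - intros eps Heps. set (e := Rmin eps d / 2).
      assert (He : 0 < Rmin eps d) by (apply Rmin_glb_lt; auto).
      assert (Hm : Cmod (RtoC e) = e) by (rewrite Cmod_R, Rabs_right; [reflexivity | unfold e; lra]).
      assert (He1 : Rmin eps d <= eps) by apply Rmin_l.
      assert (He2 : Rmin eps d <= d) by apply Rmin_r.
      exists (RtoC e). split; [| split].
      + intros E. apply RtoC_inj in E. unfold e in E. lra.
      + rewrite Hm. unfold e. lra.
      + replace (0 + RtoC e)%C with (RtoC e) by ring. apply Hzero. rewrite Hm. unfold e. lra. }
  assert (HS : em_sum_coef alpha 0 0 = RtoC 0 /\ em_sum_coef alpha 0 1
    = RtoC (log_gamma_normalized alpha + ln alpha - (alpha + 1 / 2) * ln (alpha + 1) + (alpha + 1))).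
  { destruct (expands_em_sum alpha 0 ltac:(lra) H0 H2) as [_ [HS _]].
    assert (Hx : forall n, 1 <= alpha + 1 + INR n) by (intros n; generalize (pos_INR n); lra).
    split; apply (c_series_unique _ _ _ (HS _)).
    - apply (c_series_ext (fun _ => RtoC 0)).
      + intros n. now rewrite (proj1 (em_term_coef_0 _ (Hx n))).
      + apply (c_series_finite _ 0). auto.
    - apply (c_series_ext (fun n => RtoC (stirling_defect (alpha + 1 + INR n)))).
      + intros n. now rewrite (proj2 (em_term_coef_0 _ (Hx n))).
      + apply c_series_RtoC, stirling_defect_series, Ha. }
  destruct HS as [HS0 HS1].
  (* Order 0 of the vanishing error gives [zeta(0, alpha) = 1/2 - alpha]; order 1 couples this value
     with the derivative and is then solved for the latter. *)
  assert (E0 := Hc 0%nat). assert (E1 := Hc 1%nat).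
  unfold hurwitz_error_coef, pred_coef, shift_coef in E0, E1.
  rewrite HS0 in E0. rewrite HS1 in E1.
  destruct (neg_power_coef_0 alpha) as [P0 P1]. destruct (neg_power_coef_0 (alpha + 1)) as [Q0 Q1].
  rewrite P0, Q0 in E0. rewrite P0, P1, Q0, Q1 in E1.
  set (L := log_gamma_normalized alpha) in *.
  assert (Ea0 : a 0%nat = RtoC (1 / 2 - alpha)).
  { replace (a 0%nat) with (RtoC (1 / 2 - alpha) - RtoC 0)%C; [ring |]. rewrite <- E0.
    rewrite RtoC_minus, RtoC_plus. rewrite (RtoC_div 1 2) by lra. field. }
  rewrite Ea0 in E1.
  replace (a 1%nat) with (RtoC L - RtoC 0)%C; [ring |]. rewrite <- E1.
  rewrite !RtoC_plus, !RtoC_minus, !RtoC_plus, !RtoC_opp, !RtoC_mult, !RtoC_plus.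
  rewrite (RtoC_div 1 2) by lra. field.
Qed.

Theorem mainTheorem5 :
  forall zeta : C -> R -> C,
  is_Hurwitz_zeta zeta ->
  let zeta'0 := fun alpha : R => C_derive (fun s : C => zeta s alpha) (RtoC 0) in
  let sin_term := fun (alpha : R) (n : nat) =>
    sin (2 * PI * INR n * alpha) / (PI * INR n)
      * (ln (2 * PI * INR n) + Euler_gamma) in
  let cos_term := fun (alpha : R) (n : nat) =>
    cos (2 * PI * INR n * alpha) / (2 * INR n) in
  let parseval_term := fun n : nat =>
    1 / INR n ^ 2
      * (((ln (2 * PI * INR n) + Euler_gamma) / PI) ^ 2 + 1 / 4) in
  (forall alpha : R, 0 < alpha <= 1 ->
     zeta'0 alpha = RtoC (ln (Gamma alpha / sqrt (2 * PI)))) /\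
  is_trig_Fourier_series (fun alpha : R => ln (Gamma alpha / sqrt (2 * PI)))
    0
    (fun n : nat => 1 / (2 * INR n))
    (fun n : nat => 1 / (PI * INR n) * (ln (2 * PI * INR n) + Euler_gamma)) /\
  (forall alpha : R, 0 < alpha < 1 ->
     ex_series (fun k : nat => sin_term alpha (S k)) /\
     ex_series (fun k : nat => cos_term alpha (S k)) /\
     ln (Gamma alpha / sqrt (2 * PI))
       = Series (fun k : nat => sin_term alpha (S k))
         + Series (fun k : nat => cos_term alpha (S k))) /\
  (* The mean square of a trigonometric series is half the sum of the squares of
     its coefficients, hence the factor 1/2 below. *)
  ex_series (fun k : nat => parseval_term (S k)) /\
  is_RInt_gen (V := C_R_NormedModule)
    (fun alpha : R => (zeta'0 alpha * zeta'0 alpha)%C)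
    (at_right 0) (at_left 1)
    (RtoC (1 / 2 * Series (fun k : nat => parseval_term (S k)))).
Proof.
  intros zeta Hzeta zeta'0 sin_term cos_term parseval_term.
  destruct log_gamma_parseval as [Hex HJ].
  split; [| split; [| split; [| split]]].
  - intros alpha Ha. apply lerch_formula; auto.
  - exact log_gamma_trig_Fourier_series.
  - exact log_gamma_fourier_expansion.
  - exact Hex.
  - change (is_RInt_gen (V := C_R_NormedModule) (fun alpha : R => (zeta'0 alpha * zeta'0 alpha)%C)
      (at_right 0) (at_left 1) (RtoC (1 / 2 * Series (fun k => log_gamma_parseval_term (S k))))).
    rewrite <- HJ.
    (* The two integrands need to agree only between points of [(0,1)], which is where the endpoint
       filters live and where the formula for the derivative holds. *)
    apply (is_RInt_gen_ext
      (fun alpha => RtoC (log_gamma_normalized alpha * log_gamma_normalized alpha))).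
    + apply (Filter_prod _ _ _ _ _ at_right_0_in at_left_1_in). simpl. intros x y Hx Hy z Hz.
      assert (Hz1 : 0 < z <= 1) by (revert Hz; unfold Rmin, Rmax; destruct (Rle_dec x y); lra).
      unfold zeta'0. rewrite (lerch_formula zeta z Hzeta Hz1), RtoC_mult. reflexivity.
    + apply (is_RInt_gen_RtoC (fun x => log_gamma_normalized x * log_gamma_normalized x) _ _ _
        (tame_is_RInt_gen _ (root_tame_mult _ _ root_tame_log_gamma_normalized
                                                root_tame_log_gamma_normalized))).
Qed.
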